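(* Let $C:f=0$ be a reduced curve of degree $d$ in $\mathbb{P}^2$ over $\mathbb{C}$, and let $r=\mathrm{mdr}(f)\ge 1$. If $r<d/2$ and $e$ is an integer such that $0\le e\le 2$, then $$n(f)_{d+r+e-5}=n(f)_{2d-r-e-1}=\nu(C)-\frac{(e-2)(e-3)}{2}+\alpha(C,e),$$ for some integer $\alpha(C,e)\ge 0$. In particular, the following hold. (1) For $e=2$, one has $\alpha(C,2)=0$ and $n(f)_j=\nu(C)$ for any integer $j\in[d+r-3,\,2d-r-3]$. (2) For $e=1$, either $\alpha(C,1)=1$, and then $C$ is free and $n(f)_{d+r-4}=n(f)_{2d-r-2}=\nu(C)=0$; or $\alpha(C,1)=0$, and then $C$ is not free and $n(f)_{d+r-4}=n(f)_{2d-r-2}=\nu(C)-1$.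
   Context: $S=\mathbb{C}[x,y,z]$ with the usual grading; $f\in S_d$ is the reduced homogeneous equation of $C$; $f_x,f_y,f_z$ are its partial derivatives. $AR(f)\subset S^3$ is the graded $S$-module with $AR(f)_k=\{(a,b,c)\in S_k^3: af_x+bf_y+cf_z=0\}$ and $\mathrm{mdr}(f)=\min\{k: AR(f)_k\neq 0\}$. $C$ is free if $AR(f)$ is a free graded $S$-module. $J_f=(f_x,f_y,f_z)$ is the Jacobian ideal, $\widehat{J}_f$ its saturation with respect to $(x,y,z)$, $N(f)=\widehat{J}_f/J_f$ the graded Jacobian module, and $n(f)_j=\dim_{\mathbb{C}} N(f)_j$. With $T=3(d-2)$, one sets $\nu(C)=\dim N(f)_{\lfloor T/2\rfloor}$. *)

(* Defs.v *)
From HB Require Import structures.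
From mathcomp Require Export all_boot all_order all_algebra.
From mathcomp Require Export boolp classical_sets reals.
From mathcomp Require Export complex mpoly.

Set Implicit Arguments.
Unset Strict Implicit.
Unset Printing Implicit Defensive.

Import Order.TTheory GRing.Theory Num.Theory.

#[global] Open Scope ring_scope.

(* Classically, every set of vectors of a finite-dimensional space is spanned  *)
(* by a finite family of its members; [lspan A] is the linear span of A.       *)
Lemma lspan_subproof (K : fieldType) (V : vectType K) (A : set V) :
  exists s : seq V, (forall v, v \in s -> A v) /\
                    (forall v, A v -> v \in <<s>>%VS).
Proof.
pose P k := `[< exists s : seq V,
  [/\ forall v, v \in s -> A v, free s & size s = k] >].
have P0 : exists k, P k by exists 0%N; apply/asboolP; exists [::]; rewrite nil_free.
have Pb k : P k -> (k <= \dim {:V})%N.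
  move=> /asboolP[s [_ /eqP <- <-]]; exact/dimvS/subvf.
case: (ex_maxnP P0 Pb) => k /asboolP[s [sA fs sk]] kmax.
exists s; split=> // v Av; apply: contrapT => /negP vs.
suff /kmax : P k.+1 by rewrite ltnn.
apply/asboolP; exists (v :: s); split; last by rewrite /= sk.
- by move=> u; rewrite inE => /predU1P[->|/sA].
- by rewrite free_cons vs.
Qed.

Definition lspan (K : fieldType) (V : vectType K) (A : set V) : {vspace V} :=
  <<sval (cid (lspan_subproof A))>>%VS.

Lemma mem_lspan (K : fieldType) (V : vectType K) (A : set V) :
    A 0 -> (forall a u v, A u -> A v -> A (a *: u + v)) ->
  forall v, v \in lspan A <-> A v.
Proof.
move=> A0 AL v; rewrite /lspan; case: cid => s /= [sA As]; split; last exact: As.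
move=> /(@coord_span _ _ _ (in_tuple s)) ->.
elim/big_ind: _ => // [u w Au Aw|i _]; first by rewrite -[u]scale1r; apply: AL.
rewrite -[_ *: _]addr0; apply: AL => //.
by apply: sA; rewrite mem_nth.
Qed.

Section JacobianModule.
Variable K : fieldType.
Implicit Types (f p q : {mpoly K[3]}) (g rho : 'rV[{mpoly K[3]}]_3).
Implicit Types (I : set {mpoly K[3]}).

(* "f = 0 is a reduced equation": f is nonzero and has no multiple factor *)
Definition reduced f : Prop :=
  f != 0 /\ forall g h : {mpoly K[3]}, f = g ^+ 2 * h -> g \is a GRing.unit.

Definition jac_comb f g : {mpoly K[3]} := \sum_(i < 3) g 0 i * f^`M(i).

Definition AR f : set 'rV[{mpoly K[3]}]_3 := [set rho | jac_comb f rho = 0].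

Definition ARk f (k : nat) : set 'rV[{mpoly K[3]}]_3 :=
  [set rho | AR f rho /\ forall i, rho 0 i \is k.-homog].

(* the least k with AR(f)_k != 0; it exists for f homogeneous, see mdrP *)
Definition mdr f : nat :=
  xget 0%N [set k | (exists2 rho, ARk f k rho & rho != 0) /\
    forall l rho, ARk f l rho -> rho != 0 -> (k <= l)%N].

(* AR(f) has a finite basis (the rows of B) of homogeneous elements *)
Definition is_free f : Prop :=
  exists (m : nat) (e : 'I_m -> nat) (B : 'M[{mpoly K[3]}]_(m, 3)),
    (forall i, ARk f (e i) (row i B)) /\
    forall rho, AR f rho -> exists! c : 'rV[{mpoly K[3]}]_m, rho = c *m B.

Definition jacobian_ideal f : set {mpoly K[3]} :=
  [set p | exists g, p = jac_comb f g].

(* S_k generates (x,y,z)^k, so the condition says (x,y,z)^k p is inside I *)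
Definition saturation I : set {mpoly K[3]} :=
  [set p | exists k : nat, forall q, q \is k.-homog -> I (q * p)].

Definition graded_piece I (k : nat) : {vspace dhomog 3 K k} :=
  lspan [set p : dhomog 3 K k | I p].

(* dim N(f)_j = dim (sat J_f)_j - dim (J_f)_j, as J_f is inside sat J_f        *)
(* (jacobian_sub_saturation); N(f)_j = 0 for j < 0                             *)
Definition jacobian_module_dim f (j : int) : nat :=
  match j with
  | Posz k => (\dim (graded_piece (saturation (jacobian_ideal f)) k)
               - \dim (graded_piece (jacobian_ideal f) k))%N
  | Negz _ => 0%N
  end.

(* %/ on int rounds down for a positive divisor *)
Definition nu (d : nat) f : nat :=
  jacobian_module_dim f ((3 * (d%:Z - 2)) %/ 2)%Z.

Lemma jacobian_sub_saturation f p :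
  jacobian_ideal f p -> saturation (jacobian_ideal f) p.
Proof.
move=> [g ->]; exists 0%N => q _; exists (q *: g).
by rewrite /jac_comb mulr_sumr; apply: eq_bigr => i _; rewrite mxE mulrA.
Qed.

Lemma jacobian_ideal0 f : jacobian_ideal f 0.
Proof. by exists 0; rewrite /jac_comb big1// => i _; rewrite mxE mul0r. Qed.

Lemma jacobian_idealL f a p q :
  jacobian_ideal f p -> jacobian_ideal f q -> jacobian_ideal f (a *: p + q).
Proof.
move=> [g ->] [h ->]; exists (a%:MP *: g + h).
rewrite /jac_comb scaler_sumr -big_split; apply: eq_bigr => i _ /=.
by rewrite !mxE mulrDl -mulrA mul_mpolyC.
Qed.

Lemma mem_graded_jacobian f k (p : dhomog 3 K k) :
  p \in graded_piece (jacobian_ideal f) k <-> jacobian_ideal f p.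
Proof.
apply: (mem_lspan (A := [set p : dhomog 3 K k | jacobian_ideal f p])).
  exact: jacobian_ideal0.
by move=> a u v /= Ju Jv; exact: (jacobian_idealL a Ju Jv).
Qed.

Lemma dhomog_split (l m : nat) q : q \is (l + m).-homog ->
  exists F : 'X_{1..3} -> 'X_{1..3}, forall n, n \in msupp q ->
    (F n <= n)%MM /\ mdeg (F n) = l.
Proof.
move=> /dhomogP qh.
have sub n : (l <= mdeg n)%N -> exists u : 'X_{1..3}, (u <= n)%MM /\ mdeg u = l.
  elim: l {qh} => [|l IH] ln.
    by exists 0%MM; rewrite mdeg0; split=> //; apply/mnm_lepP => i; rewrite mnm0E.
  have [u [un ul]] := IH (ltnW ln).
  have [i ui] : exists i, (u i < n i)%N.
    apply: contrapT => nu; move: ln; rewrite ltnNge -ul => /negP; apply.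
    rewrite !mdegE; apply: leq_sum => i _; rewrite leqNgt.
    by apply/negP => ?; apply: nu; exists i.
  exists (u + U_(i))%MM; rewrite mdegD mdeg1 ul addn1; split=> //.
  apply/mnm_lepP => j; rewrite mnmDE mnm1E.
  case: eqP => [<-|_]; first by rewrite addn1.
  by rewrite addn0; apply/mnm_lepP: j.
have /choice[F HF] : forall n, exists u : 'X_{1..3},
    n \in msupp q -> (u <= n)%MM /\ mdeg u = l.
  move=> n; case: (boolP (n \in msupp q)) => [nq|]; last by exists 0%MM.
  have [|u ?] := sub n; first by rewrite (qh _ nq) leq_addr.
  by exists u.
by exists F.
Qed.

Lemma saturation_jacL f a p q : saturation (jacobian_ideal f) p ->
  saturation (jacobian_ideal f) q -> saturation (jacobian_ideal f) (a *: p + q).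
Proof.
have jM u v : jacobian_ideal f v -> jacobian_ideal f (u * v).
  move=> [g ->]; exists (u *: g).
  by rewrite /jac_comb mulr_sumr; apply: eq_bigr => i _; rewrite mxE mulrA.
have mono l m r : (forall u, u \is l.-homog -> jacobian_ideal f (u * r)) ->
    forall u, u \is (l + m).-homog -> jacobian_ideal f (u * r).
  move=> H u /dhomog_split[F HF]; rewrite [u]mpolyE mulr_suml big_seq.
  elim/big_ind: _ => [|x y Jx Jy|n nu]; first exact: jacobian_ideal0.
    by rewrite -[x]scale1r; apply: jacobian_idealL.
  have [Fn Fl] := HF n nu.
  rewrite -(submK Fn) mpolyXD -scalerAl -[_ *: _]addr0.
  apply: jacobian_idealL; last exact: jacobian_ideal0.
  by rewrite -mulrA; apply: jM; apply: H; rewrite dhomogX; apply/eqP.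
move=> [k Hk] [l Hl]; exists (k + l)%N => u uh.
rewrite mulrDr -scalerAr; apply: jacobian_idealL; first exact: mono uh.
by apply: (mono l k) => //; rewrite addnC.
Qed.

Lemma mem_graded_saturation f k (p : dhomog 3 K k) :
  p \in graded_piece (saturation (jacobian_ideal f)) k
    <-> saturation (jacobian_ideal f) p.
Proof.
apply: (mem_lspan
  (A := [set p : dhomog 3 K k | saturation (jacobian_ideal f) p])).
  exact/jacobian_sub_saturation/jacobian_ideal0.
by move=> a u v /= Ju Jv; exact: (saturation_jacL a Ju Jv).
Qed.

Lemma mderiv_homog d f (i : 'I_3) : f \is d.-homog -> f^`M(i) \is d.-1.-homog.
Proof.
move=> /dhomogP fh; apply/dhomogP => m; rewrite mcoeff_msupp mcoeff_deriv => H.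
have : (m + U_(i))%MM \in msupp f.
  by rewrite mcoeff_msupp; apply: contraNneq H => ->; rewrite mul0rn.
by move=> /fh /=; rewrite mdegD mdeg1 addn1 => <-.
Qed.

Lemma mdrP d f : f \is d.-homog ->
  (exists2 rho, ARk f (mdr f) rho & rho != 0) /\
  forall l rho, ARk f l rho -> rho != 0 -> (mdr f <= l)%N.
Proof.
move=> fh; rewrite /mdr; case: xgetP => [k _ []//|no]; exfalso.
pose P k := `[< exists2 rho, ARk f k rho & rho != 0 >].
have [k Pk] : exists k, P k.
  pose i0 : 'I_3 := ord0; pose i1 : 'I_3 := lift ord0 ord0.
  pose v j (a : {mpoly K[3]}) : 'rV[{mpoly K[3]}]_3 := a *: delta_mx 0 j.
  have vE j a i : v j a 0 i = if i == j then a else 0.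
    by rewrite !mxE eqxx /=; case: eqP => _; rewrite ?mulr1 ?mulr0.
  have v1E j a : jac_comb f (v j a) = a * f^`M(j) by
    rewrite /jac_comb (bigD1 j)//= vE eqxx big1 ?addr0// => l /negPf lj;
    rewrite vE lj mul0r.
  have [f0|f0] := eqVneq f^`M(i0) 0.
    exists 0%N; apply/asboolP; exists (v i0 1).
      split=> [|i]; first by rewrite /AR /= v1E // f0 mulr0.
      by rewrite vE; case: eqP => _; rewrite ?dhomog1 ?dhomog0.
    apply/eqP => /matrixP /(_ 0 i0); rewrite vE eqxx mxE => /eqP.
    by rewrite oner_eq0.
  exists d.-1; apply/asboolP; exists (v i0 (- f^`M(i1)) + v i1 f^`M(i0)).
    split=> [|i]; rewrite /AR /=.
      have -> : jac_comb f (v i0 (- f^`M(i1)) + v i1 f^`M(i0)) =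
          jac_comb f (v i0 (- f^`M(i1))) + jac_comb f (v i1 f^`M(i0)).
        by rewrite /jac_comb -big_split; apply: eq_bigr => i _ /=;
          rewrite [X in X * _]mxE mulrDl.
      by rewrite !v1E // mulNr mulrC addNr.
    rewrite mxE !vE rpredD//; case: eqP => _; rewrite ?dhomog0 ?rpredN//;
    exact: mderiv_homog.
  apply/eqP => /matrixP /(_ 0 i1); rewrite mxE !vE eqxx mxE /= add0r => /eqP.
  by rewrite (negPf f0).
have ex : exists k, P k by exists k.
case: (ex_minnP ex) => m /asboolP Pm mmin.
apply: (no m); split=> // l rho Hl rho0; apply: mmin.
by apply/asboolP; exists rho.
Qed.

End JacobianModule.

(* Main.v *)
(* Put D = d - 1.  A generic line meets the curve in d distinct points, so that in
   suitable coordinates two combinations g1, g2 of the partial derivatives and a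
   linear form z are a regular sequence.  Multiplication by z is injective on
   A = S/(g1, g2), and bijective from degree 2D - 2 on; the residue is a perfect
   pairing on the limit V of the A_j, for which A_j and A_(2D-3-j) are orthogonal
   complements.  Multiplication by the third combination g3 is self-adjoint and
   N(f)_j is the quotient of the intersection of A_j and g3 V by g3 A_(j-D), hence
   n(f)_j = R - x_(2D-3-j) - x_(j-D), where R = dim g3 V and x_k = dim g3 A_k is
   computed from dim AR(f)_k.

   If rho is a syzygy of minimal degree r and sigma is any syzygy, then
   rho x sigma = h grad f, because the partial derivatives are coprime, and h has
   degree r + deg sigma - D.  Since rho is primitive, AR(f)_k = S_(k-r) rho for
   k < D - r, while AR(f)_(D-r) has one more dimension exactly when some h is a
   nonzero constant, that is, by Saito's criterion, when the curve is free. *)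

From HB Require Import structures.
Require Import Defs.
From mathcomp Require Import separable ring zify.

Set Implicit Arguments.
Unset Strict Implicit.
Unset Printing Implicit Defensive.

Import Order.TTheory GRing.Theory Num.Theory.

(** * Unique factorization *)

(** Why these degrees: in n(f)_j = R - x_(2D-3-j) - x_(j-D) the two indices add up to D - 3. For r -
    2 <= k < D - r one has 2 x_k = r (2k + 3 - r), affine in k, so the two terms sum to r (D - r)
    and n(f)_j is constant; the degree defining nu(C) lies in that range because 2r <= D. Just
    outside, one index k drops below r - 2, where 2 x_k = (k + 1)(k + 2) exceeds the affine value by
    (k - r + 1)(k - r + 2): for k = r - 3 and k = r - 4 this is the (e - 2)(e - 3) of the statement.
    The other index contributes alpha(C, e), the number of independent syzygies of degree d - r - e
    modulo multiples of rho. The constant R is computed only for free curves, from the formula at j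
    = -1, where N(f) vanishes. The limit V is not constructed: functionals on S_(i+N), N = 2D - 2,
    extending the residue from S_N along z^i, take its place. That a line meets the curve in d
    distinct points becomes separability of a restriction of degree d, obtained from a Bezout
    identity over K[x_0, x_1] in place of a discriminant. *)

Definition divides (R : comNzRingType) (a b : R) := exists c, b = c * a.

Definition prime_element (R : idomainType) (p : R) :=
  [/\ p != 0, p \isn't a GRing.unit &
      forall a b, divides p (a * b) -> divides p a \/ divides p b].

(* [N] plays the role of the number of prime factors counted with multiplicity *)
Definition factorial_ring (R : idomainType) := exists N : R -> nat,
  [/\ forall a b : R, a != 0 -> b != 0 -> N (a * b) = (N a + N b)%N,
      forall a : R, a != 0 -> N a = 0%N -> a \is a GRing.unit &
      forall a : R, a != 0 -> a \isn't a GRing.unit ->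
        exists2 p, prime_element p & divides p a].

Section Divides.
Variable R : idomainType.
Implicit Types a b c p : R.

Lemma divides_mull a b c : divides a b -> divides a (c * b).
Proof. by move=> [x ->]; exists (c * x); rewrite mulrA. Qed.

Lemma divides_mulr a b c : divides a b -> divides a (b * c).
Proof. by rewrite mulrC; exact: divides_mull. Qed.

Lemma dividesD a b c : divides a b -> divides a c -> divides a (b + c).
Proof. by move=> [x ->] [y ->]; exists (x + y); rewrite mulrDl. Qed.

Lemma dividesN a b : divides a b -> divides a (- b).
Proof. by move=> [x ->]; exists (- x); rewrite mulNr. Qed.

Lemma dividesB a b c : divides a b -> divides a c -> divides a (b - c).
Proof. by move=> ab ac; apply: dividesD => //; apply: dividesN. Qed.

Lemma divides0 a : divides a 0.
Proof. by exists 0; rewrite mul0r. Qed.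

Lemma divides_sum a I (r : seq I) (P : pred I) F :
  (forall i, P i -> divides a (F i)) -> divides a (\sum_(i <- r | P i) F i).
Proof.
by move=> aF; elim/big_ind: _ => //; [exact: divides0 | exact: dividesD].
Qed.

Lemma factorial_ind (facR : factorial_ring R) (P : R -> Prop) :
    (forall u, u \is a GRing.unit -> P u) ->
    (forall p a, prime_element p -> a != 0 -> P a -> P (p * a)) ->
  forall a, a != 0 -> P a.
Proof.
move: facR => [N [NM N0 Np]] Pu Pp a.
have [n] := ubnP (N a); elim: n a => // n IH a; rewrite ltnS => Nan a0.
have [/Pu//|/(Np a a0)[p pp [b ab]]] := boolP (a \is a GRing.unit).
have [p0 pnu _] := pp.
move: a0; rewrite ab mulf_eq0 negb_or => /andP[b0 _]; rewrite mulrC.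
apply: Pp => //; apply: IH => //; apply: leq_trans Nan; rewrite ab NM //.
rewrite -[X in (X < _)%N]addn0 ltn_add2l lt0n; apply: contra pnu => /eqP.
exact: N0.
Qed.

End Divides.

Section Gauss.
Variable R : idomainType.
Implicit Types a b c p : R.

Lemma divides_polyC p (f : {poly R}) :
  divides p%:P f <-> forall i, divides p f`_i.
Proof.
split=> [[g ->] i|pf]; first by exists g`_i; rewrite coefMC.
have /choice[g gE] := pf.
exists (\poly_(i < size f) g i); apply/polyP => i; rewrite coefMC coef_poly.
by case: ltnP => [_|/(nth_default 0) ->]; rewrite ?mul0r.
Qed.

(** Gauss' argument: let i and j be the first indices whose coefficients in [f] and [g] are not
    divisible by [p]. In the coefficient of degree i + j of the product every other term contains a
    coefficient of smaller index, so [p] would divide the product of these two. *)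
Lemma prime_polyC p : prime_element p -> prime_element (p%:P).
Proof.
move=> [p0 pu pp]; split=> [||f g]; first by rewrite polyC_eq0.
  by apply: contra pu; rewrite poly_unitE coefC eqxx => /andP[].
have minP (h : {poly R}) : ~ divides p%:P h ->
    exists i, ~ divides p h`_i /\ forall j, (j < i)%N -> divides p h`_j.
  move=> ph; have ex : exists i, `[< ~ divides p h`_i >].
    apply: contrapT => no; apply: ph; apply/divides_polyC => i.
    by apply: contrapT => ?; apply: no; exists i; apply/asboolP.
  case: (ex_minnP ex) => i /asboolP pi mini; exists i; split=> // j ji.
  by apply: contrapT => /asboolP /mini; rewrite leqNgt ji.
move=> pfg; apply: contrapT => /not_orP[/minP[i [pfi mini]] /minP[j [pgj minj]]].
have : divides p (f`_i * g`_j).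
  have := (divides_polyC p (f * g)).1 pfg (i + j)%N.
  have lti : (i < (i + j).+1)%N by rewrite ltnS leq_addr.
  rewrite coefM (bigD1 (Ordinal lti)) //= addKn => H.
  rewrite -[X in divides _ X](addrK (\sum_(i0 < (i + j).+1 | i0 != Ordinal lti)
     f`_i0 * g`_(i + j - i0))).
  apply: dividesB => //; apply: divides_sum => k kj.
  have [ki|ik] := ltnP k i; first by apply: divides_mulr; apply: mini.
  apply: divides_mull; apply: minj; rewrite ltn_subLR; last first.
    by rewrite -ltnS ltn_ord.
  by rewrite ltn_add2r ltn_neqAle ik andbT eq_sym.
by move=> /pp[].
Qed.

Lemma unit_polyC a : (a%:P \is a GRing.unit) = (a \is a GRing.unit).
Proof. by rewrite poly_unitE coefC eqxx size_polyC; case: (a =P 0) => [->|] //=; rewrite unitr0. Qed.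

(* Gauss' lemma: a prime factor of c divides g or h, and can be cancelled. *)
Lemma factorial_strip (facR : factorial_ring R) c (f g h : {poly R}) :
    c != 0 -> c *: f = g * h -> exists a b g' h',
  [/\ f = g' * h', g = a *: g', h = b *: h', a != 0 & b != 0].
Proof.
move=> c0; move: c c0 f g h.
apply: (factorial_ind facR) => [u uu|p c pp c0 IH] f g h.
  move=> E; have u0 : u != 0 by apply: contraTneq uu => ->; rewrite unitr0.
  exists u, 1, (u^-1 *: g), h; split; rewrite ?oner_eq0 ?scale1r //.
    by rewrite -scalerAl -E scalerA mulVr // scale1r.
  by rewrite scalerA mulrV // scale1r.
have [p0 _ _] := pp; have [_ _ pC] := prime_polyC pp.
rewrite -scalerA -mul_polyC => E.
have pn0 : p%:P != 0 :> {poly R} by rewrite polyC_eq0.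
have : divides p%:P (g * h) by exists (c *: f); rewrite -E mulrC.
move=> /pC[[g1 gE]|[h1 hE]].
  have /IH[a [b [g' [h' [-> g1E hE a0 b0]]]]] : c *: f = g1 * h.
    by apply: (mulfI pn0); rewrite E gE; ring.
  exists (p * a), b, g', h'; split=> //; last by rewrite mulf_neq0.
  by rewrite gE g1E mulrC mul_polyC scalerA.
have /IH[a [b [g' [h' [-> gE h1E a0 b0]]]]] : c *: f = g * h1.
  by apply: (mulfI pn0); rewrite E hE; ring.
exists a, (p * b), g', h'; split=> //; last by rewrite mulf_neq0.
by rewrite hE h1E mulrC mul_polyC scalerA.
Qed.

(** The count adds the degree to the number of prime factors of the leading coefficient. A nonunit
    without prime factor in [R] either splits, and induction applies, or is primitive and
    irreducible; then its pseudo-gcd with any [a] is, up to constants, 1 or [f], which makes [f]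
    itself prime. *)
Lemma factorial_poly : factorial_ring R -> factorial_ring {poly R}.
Proof.
move=> facR; have [N [NM N0 Np]] := facR.
pose M (f : {poly R}) := (N (lead_coef f) + (size f).-1)%N.
have MM f g : f != 0 -> g != 0 -> M (f * g) = (M f + M g)%N.
  move=> f0 g0; rewrite /M lead_coefM NM ?lead_coef_eq0 // size_mul //.
  have := polySpred f0; have := polySpred g0; lia.
have M0 f : f != 0 -> M f = 0%N -> f \is a GRing.unit.
  move=> f0 Mf; have /size1_polyC fE : (size f <= 1)%N.
    by have := polySpred f0; move: Mf; rewrite /M; lia.
  move: f0 Mf; rewrite fE polyC_eq0 unit_polyC /M lead_coefC => f0 Mf.
  by apply: N0 => //; move: Mf; lia.
exists M; split=> // f; have [n] := ubnP (M f).
elim: n f => // n IH f; rewrite ltnS => Mfn f0 fu.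
have [[p [pp pf]]|prim] := pselect (exists p, prime_element p /\ divides p%:P f).
  by exists p%:P => //; apply: prime_polyC.
have const_unit a : divides a%:P f -> a \is a GRing.unit.
  move=> [g fE]; apply: contrapT => /negP au; apply: prim.
  have a0 : a != 0 by apply: contraNneq f0 => a0; rewrite fE a0 mulr0.
  have [p pp [b ab]] := Np _ a0 au; exists p; split=> //.
  by exists (g * b%:P); rewrite fE ab polyCM mulrA.
(* Clearing denominators: as [f] is primitive, the constant that [factorial_strip] extracts from it
   is a unit. *)
have prim_divides c (a q : {poly R}) : c != 0 -> c *: a = q * f -> divides f a.
  move=> c0 /(factorial_strip facR c0)[x [y [q' [f' [-> _ fE _ y0]]]]].
  have yu : y \is a GRing.unit.
    by apply: const_unit; exists f'; rewrite fE mulrC mul_polyC.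
  exists (y^-1 *: q'); rewrite fE -scalerAl -scalerAr scalerA mulVr //.
  by rewrite scale1r.
have [[g [h [fE gu hu]]]|irr] := pselect (exists g h,
    [/\ f = g * h, g \isn't a GRing.unit & h \isn't a GRing.unit]).
  move: (f0); rewrite fE mulf_eq0 negb_or => /andP[g0 h0].
  have [|p pp pg] := IH g _ g0 gu.
    rewrite (leq_trans _ Mfn) // fE MM // -[X in (X < _)%N]addn0 ltn_add2l lt0n.
    by apply: contra hu => /eqP; apply: M0.
  by exists p => //; apply: divides_mulr.
exists f; last by exists 1; rewrite mul1r.
split=> // a b /= [q abE].
have [a0|a0] := eqVneq a 0; first by left; rewrite a0; apply: divides0.
have : gcdp f a %| f by apply: dvdp_gcdl.
move=> /Pdiv.Idomain.dvdpP[[c h] /= c0 /(factorial_strip facR c0)].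
move=> [x [y [h' [g [fE hE gE x0 y0]]]]].
have [gu|gu] := boolP (g \is a GRing.unit).
  right; have co : coprimep f a.
    rewrite /coprimep gE size_scale //; move: gu; rewrite poly_unitE.
    by case/andP.
  have : f %| a * b.
    by apply/Pdiv.Idomain.dvdpP; exists (1, q); rewrite ?oner_neq0 ?scale1r.
  rewrite Gauss_dvdpr // => /Pdiv.Idomain.dvdpP[[e k] /= e0].
  exact: prim_divides.
have hu : h' \is a GRing.unit.
  by apply: contrapT => /negP hu; apply: irr; exists h', g.
left; have : gcdp f a %| a by apply: dvdp_gcdr.
move=> /Pdiv.Idomain.dvdpP[[e k] /= e0 eE].
apply: (prim_divides e _ (y *: k * h'^-1)) => //.
by rewrite fE eE gE mulrA divrK // -!scalerAl -scalerAr.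
Qed.

End Gauss.

Lemma factorial_iso (A B : idomainType) (phi : {rmorphism A -> B})
    (psi : {rmorphism B -> A}) :
  cancel phi psi -> cancel psi phi -> factorial_ring B -> factorial_ring A.
Proof.
move=> phiK psiK [N [NM N0 Np]].
have phi0 a : a != 0 -> phi a != 0.
  by apply: contra => /eqP ph; rewrite -(phiK a) ph rmorph0.
have phiu a : phi a \is a GRing.unit -> a \is a GRing.unit.
  by move=> /(rmorph_unit psi); rewrite phiK.
exists (N \o phi); split=> /= [a b a0 b0|a a0 /N0 H|a a0 au].
- by rewrite rmorphM NM ?phi0.
- by apply/phiu/H/phi0.
have [|p [p0 pu pp] [c phE]] := Np _ (phi0 _ a0); first exact: contra (@phiu _) au.
exists (psi p); last by exists (psi c); rewrite -rmorphM -phE phiK.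
split=> [||x y [z xyE]].
- by apply: contra p0 => /eqP ps; rewrite -(psiK p) ps rmorph0.
- by apply: contra pu => /(rmorph_unit phi); rewrite psiK.
have /pp[[u xE]|[u yE]] : divides p (phi x * phi y).
- by exists (phi z); rewrite -rmorphM xyE rmorphM psiK.
- by left; exists (psi u); rewrite -rmorphM -xE phiK.
- by right; exists (psi u); rewrite -rmorphM -yE phiK.
Qed.

Section Mmulti.
Variables (K : fieldType) (n : nat).

(** The inverse of [muni], which singles out the last variable; through it factoriality passes from
    [{poly {mpoly K[n]}}] to [{mpoly K[n.+1]}]. *)
Definition mmultir : {poly {mpoly K[n]}} -> {mpoly K[n.+1]} :=
  horner_eval 'X_ord_max \o map_poly (@mwiden n K).
HB.instance Definition _ := GRing.RMorphism.on mmultir.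

Lemma mmultir_polyC c : mmultir c%:P = mwiden c.
Proof. by rewrite /mmultir /= map_polyC /horner_eval /= hornerC. Qed.

Lemma mmultirX : mmultir 'X = 'X_ord_max.
Proof. by rewrite /mmultir /= map_polyX /horner_eval /= hornerX. Qed.

Lemma muniXmax : muni ('X_ord_max : {mpoly K[n.+1]}) = 'X.
Proof.
rewrite muniE msuppX big_seq1 mcoeffX eqxx scale1r mnm1E eqxx expr1.
rewrite (_ : [multinom _ | i < n] = 0%MM) ?mpolyX0 ?scale1r //.
apply/mnmP => i; rewrite mnmE mnm0E mnm1E.
by case: eqP => // /(congr1 val) /= /eqP; rewrite gtn_eqF.
Qed.

Lemma muniXwiden i : muni ('X_(widen_ord (leqnSn n) i) : {mpoly K[n.+1]}) = ('X_i)%:P.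
Proof.
rewrite muniE msuppX big_seq1 mcoeffX eqxx scale1r mnm1E.
rewrite (_ : _ == _ = false); last by apply/eqP => /(congr1 val) /= /eqP; rewrite ltn_eqF.
rewrite expr0 alg_polyC (_ : [multinom _ | i0 < n] = U_(i)%MM) //.
by apply/mnmP => j; rewrite mnmE !mnm1E -!val_eqE.
Qed.

Lemma mpoly_morph_eq m (B : comNzRingType) (phi psi : {rmorphism {mpoly K[m]} -> B}) :
    (forall c, phi c%:MP = psi c%:MP) -> (forall i, phi 'X_i = psi 'X_i) ->
  phi =1 psi.
Proof.
move=> eqC eqX p; rewrite [p]mpolyE !rmorph_sum; apply: eq_bigr => k _.
rewrite -mul_mpolyC !rmorphM eqC mpolyXE_id !rmorph_prod; congr (_ * _).
by apply: eq_bigr => i _; rewrite !rmorphXn eqX.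
Qed.

Lemma muniK : cancel (@muni n K) mmultir.
Proof.
move=> p; apply: (mpoly_morph_eq (phi := mmultir \o (@muni n K)) (psi := idfun)).
  by move=> c; rewrite /= muniC mmultir_polyC mwidenC.
move=> i /=; have [j ->|->] := unliftP ord_max i; last by rewrite muniXmax mmultirX.
rewrite (_ : lift ord_max j = widen_ord (leqnSn n) j); last first.
  by apply/val_inj; rewrite /= /bump leqNgt ltn_ord.
by rewrite muniXwiden mmultir_polyC mwidenX mnmwiden1.
Qed.

Lemma muni_mwiden c : muni (mwiden c : {mpoly K[n.+1]}) = c%:P.
Proof.
apply: (mpoly_morph_eq (phi := @muni n K \o @mwiden n K) (psi := polyC)) => /=.
  by move=> a; rewrite mwidenC muniC.
by move=> i; rewrite mwidenX mnmwiden1 muniXwiden.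
Qed.

Lemma mmultirK : cancel mmultir (@muni n K).
Proof.
elim/poly_ind => [|p c IH]; first by rewrite !rmorph0.
by rewrite !rmorphD !rmorphM /= IH mmultirX muniXmax mmultir_polyC muni_mwiden.
Qed.

End Mmulti.

Lemma mpoly_unitE (K : fieldType) n (p : {mpoly K[n]}) :
  (p \is a GRing.unit) = (msize p == 1%N).
Proof.
apply/idP/idP => [pu|/msize_poly1P[c c0 ->]]; last first.
  by apply/unitrP; exists (c^-1)%:MP; rewrite -mpolyCM mulVf // -mpolyCM mulfV.
have p0 : p != 0 by apply: contraTneq pu => ->; rewrite unitr0.
have q0 : p^-1 != 0 by rewrite invr_eq0.
have := msizeM p0 q0; rewrite mulrV // msize1.
move: p0 q0; rewrite -!msize_poly_eq0.
move: (msize p) (msize p^-1) => [|[|m]] [|[|k]] //=; lia.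
Qed.

Lemma factorial_mpoly (K : fieldType) n : factorial_ring {mpoly K[n]}.
Proof.
elim: n => [|n IH]; last first.
  exact: factorial_iso (@muniK K n) (@mmultirK K n) (factorial_poly IH).
have uK (p : {mpoly K[0]}) : p != 0 -> p \is a GRing.unit.
  rewrite (nvar0_mpolyC p) mpolyC_eq0 => p0; rewrite mpoly_unitE.
  by apply/msize_poly1P; exists p@_0%MM.
by exists (fun=> 0%N); split=> // a /uK -> //.
Qed.

(** * Graded pieces *)

Section LinearAlgebra.
Variable K : fieldType.

Lemma factor_functional (U V : vectType K) (f : 'Hom(U, V)) (l : 'Hom(U, K^o)) :
  (forall u, f u = 0 -> l u = 0) -> exists l' : 'Hom(V, K^o), forall u, l' (f u) = l u.
Proof.
move=> fl; exists (l \o f^-1)%VF => u; rewrite comp_lfunE.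
have := fl (f^-1%VF (f u) - u).
rewrite !linearB /= limg_lfunVK ?memv_img ?memvf // subrr.
by move=> /(_ erefl)/eqP; rewrite subr_eq0 => /eqP.
Qed.

(** [L] and [Q] are the two radicals. Pairing with a basis of a complement of [L] in [U0] embeds W0
    / Q in a space of dimension dim U0 - dim L; exchanging the roles gives equality in
    [pairing_dim]. *)
Lemma pairing_dim_le (U W : vectType K) (b : U -> W -> K)
    (U0 L : {vspace U}) (W0 Q : {vspace W}) :
    (forall w, linear_for *%R (b^~ w)) -> (forall u, linear_for *%R (b u)) ->
    (forall u, u \in L <-> u \in U0 /\ forall w, w \in W0 -> b u w = 0) ->
    (forall w, w \in Q <-> w \in W0 /\ forall u, u \in U0 -> b u w = 0) ->
  (\dim W0 + \dim L <= \dim U0 + \dim Q)%N.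
Proof.
move=> bL bR HL HQ.
have LU : (L <= U0)%VS by apply/subvP => u /HL[].
have QW : (Q <= W0)%VS by apply/subvP => u /HQ[].
have dimC : (\dim (U0 :\: L) + \dim L = \dim U0)%N.
  by rewrite addnC -(dimv_cap_compl U0 L) (capv_idPr LU).
pose c := vbasis (U0 :\: L).
pose h (w : W) : 'rV[K]_(\dim (U0 :\: L)) := \row_i b c`_i w.
have hlin : linear h.
  by move=> a u v; apply/rowP => i; rewrite !mxE bR.
pose hL : {linear W -> 'rV[K]_(\dim (U0 :\: L))} :=
  HB.pack h (GRing.isLinear.Build K W _ _ h hlin).
pose H := linfun hL.
have := limg_ker_dim H W0.
have -> : (W0 :&: lker H = Q)%VS.
  apply/vspaceP => w; rewrite memv_cap memv_ker lfunE /=; apply/andP/idP.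
    move=> [wW /eqP hw]; apply/HQ; split=> // u; rewrite -(addv_diff_cap U0 L).
    move=> /memv_addP[x xC [y]]; rewrite memv_cap => /andP[_ /HL[_ yW]] ->.
    have b0 : forall u v, b (u + v) w = b u w + b v w.
      by move=> u1 v1; rewrite -[u1]scale1r bL mul1r scale1r.
    have b00 : b 0 w = 0.
      by have /= := bL w (-1) 0 0; rewrite scaler0 addr0 mulN1r addNr.
    rewrite b0 yW // addr0.
    rewrite (coord_vbasis xC); elim/big_ind: _ => [|x1 y1 x0 y0|i _].
    - exact: b00.
    - by rewrite b0 x0 y0 addr0.
    - have := bL w (coord c i x) c`_i 0; rewrite addr0 /= b00 addr0 => ->.
      by have := congr1 (fun r : 'rV_ _ => r 0 i) hw; rewrite !mxE => ->; rewrite mulr0.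
  move=> /HQ[wW uw]; split=> //; apply/eqP/rowP => i; rewrite !mxE uw //.
  by apply: (subvP (diffvSl U0 L)); apply: vbasis_mem; apply: mem_nth; rewrite size_tuple.
have : (\dim (H @: W0) <= \dim (U0 :\: L))%N.
  by apply: leq_trans (dimvS (subvf _)) _; rewrite dimvf /dim /= mul1n.
lia.
Qed.

Lemma pairing_dim (U W : vectType K) (b : U -> W -> K)
    (U0 L : {vspace U}) (W0 Q : {vspace W}) :
    (forall w, linear_for *%R (b^~ w)) -> (forall u, linear_for *%R (b u)) ->
    (forall u, u \in L <-> u \in U0 /\ forall w, w \in W0 -> b u w = 0) ->
    (forall w, w \in Q <-> w \in W0 /\ forall u, u \in U0 -> b u w = 0) ->
  (\dim W0 + \dim L = \dim U0 + \dim Q)%N.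
Proof.
move=> bL bR HL HQ; apply/eqP; rewrite eqn_leq (pairing_dim_le bL bR HL HQ).
by rewrite (pairing_dim_le (b := fun w u => b u w) bR bL HQ HL).
Qed.

End LinearAlgebra.

Section Graded.
Variable K : fieldType.
Local Notation S := {mpoly K[3]}.
Local Notation H := (dhomog 3 K).
Implicit Types (p q g : S) (A B : set S).

Lemma dim_dhomog k : \dim {: H k} = 'C(k.+2, 2).
Proof.
rewrite dimvf (_ : dim _ = 'C(k + 2, k)) // addn2.
by rewrite -(bin_sub (n := k.+2)) ?subSn ?subnn // -addn2 leq_addr.
Qed.

Definition proj_homog k p : H k := DHomog (pihomogP mdeg k p).

Lemma proj_homog_linear k : linear (proj_homog k).
Proof. by move=> a p q; apply/val_inj; rewrite /= linearP. Qed.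
HB.instance Definition _ k :=
  GRing.isLinear.Build K S (H k) _ (proj_homog k) (proj_homog_linear k).

Lemma proj_homogE k p : p \is k.-homog -> proj_homog k p = p :> S.
Proof. exact: pihomog_dE. Qed.

Lemma dhomog_inj k : injective (@mpoly_of_dhomog 3 K k).
Proof. exact: val_inj. Qed.

(** The projection makes the map total and linear for all [g], [j], [k]; it is multiplication by [g]
    only when the degrees add up, see [mul_homogE]. *)
Definition mul_homog_fun g j k (p : H j) : H k := proj_homog k (g * p).

Lemma mul_homog_fun_linear g j k : linear (@mul_homog_fun g j k).
Proof.
by move=> a p q; apply/val_inj; rewrite /= mulrDr -scalerAr linearP.
Qed.
HB.instance Definition _ g j k :=
  GRing.isLinear.Build K (H j) (H k) _ (@mul_homog_fun g j k)
    (@mul_homog_fun_linear g j k).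

Definition mul_homog g j k : 'Hom(H j, H k) := linfun (@mul_homog_fun g j k).

Lemma mul_homogE g e j k (p : H j) :
  g \is e.-homog -> (e + j = k)%N -> mul_homog g j k p = g * p :> S.
Proof.
move=> gh <-; have -> : mul_homog g j (e + j) p = mul_homog_fun g (e + j) p.
  exact: lfunE.
by rewrite /= pihomog_dE // dhomogM //; exact: dhomog_is_dhomog.
Qed.

Lemma lker_mul_homog g e j k :
  g != 0 -> g \is e.-homog -> (e + j = k)%N -> lker (mul_homog g j k) = 0%VS.
Proof.
move=> g0 gh jk; apply/eqP/lker0P => p q /(congr1 (@mpoly_of_dhomog 3 K k)).
by rewrite !(mul_homogE _ gh jk) => /(mulfI g0)/dhomog_inj.
Qed.

Lemma dim_mul_homog g e j k (U : {vspace H j}) :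
  g != 0 -> g \is e.-homog -> (e + j = k)%N -> \dim (mul_homog g j k @: U) = \dim U.
Proof. by move=> g0 gh jk; rewrite limg_dim_eq // (lker_mul_homog g0 gh jk) capv0. Qed.

(** Only a [K]-subspace is meant; closure under multiplication by polynomials is proved separately
    for each ideal. *)
Definition submod A := A 0 /\ forall a p q, A p -> A q -> A (a *: p + q).

Lemma submodD A p q : submod A -> A p -> A q -> A (p + q).
Proof. by move=> [_ AL] Ap Aq; rewrite -[p]scale1r; apply: AL. Qed.

Lemma submodZ A c p : submod A -> A p -> A (c *: p).
Proof. by move=> [A0 AL] Ap; rewrite -[_ *: _]addr0; apply: AL. Qed.

Lemma submodB A p q : submod A -> A p -> A q -> A (p - q).
Proof. by move=> AL Ap Aq; rewrite -scaleN1r addrC; apply: AL.2. Qed.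

Lemma mem_graded A k (p : H k) : submod A -> p \in graded_piece A k <-> A p.
Proof.
by move=> [A0 AL]; apply: (mem_lspan (A := [set p : H k | A p])) => // a u v; exact: AL.
Qed.

(** This is what allows the coefficients in a representation of a form by homogeneous generators to
    be taken homogeneous. *)
Lemma pihomogM k e p g : g \is e.-homog ->
  pihomog mdeg k (p * g) = if (e <= k)%N then pihomog mdeg (k - e) p * g else 0.
Proof.
move=> gh; rewrite {1}(pihomog_partitionE (mf := mdeg) (leqnn (msize p))) mulr_suml linear_sum /=.
have homc i : pihomog mdeg i p * g \is (i + e).-homog.
  by apply: dhomogM => //; exact: pihomogP.
case: leqP => ek; last first.
  apply: big1 => i _; rewrite (pihomog_ne0 _ (homc i)) //.
  by rewrite gtn_eqF // ltn_addl.
have [lt|ge] := ltnP (k - e) (msize p).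
  rewrite (bigD1 (Ordinal lt)) //= pihomog_dE ?big1 ?addr0 //.
    move=> i ik; rewrite (pihomog_ne0 _ (homc i)) //; apply: contra ik => /eqP ik.
    by apply/eqP/val_inj; rewrite /= -ik addnK.
  by have := homc (k - e)%N; rewrite subnK.
rewrite big1 => [|i _].
  rewrite (_ : pihomog mdeg (k - e) p = 0) ?mul0r //.
  rewrite pihomogE big_seq_cond big_pred0 // => m; apply/negP => /andP[/msize_mdeg_lt].
  by rewrite ltnNge => /negP mp /eqP mk; apply: mp; rewrite mk.
rewrite (pihomog_ne0 _ (homc i)) //; apply: contraTneq (ltn_ord i) => ik.
by rewrite -leqNgt (leq_trans ge) // -ik addnK.
Qed.

End Graded.

(** * Restriction to a line *)

Section Dehomogenization.
Variable K : fieldType.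
Local Notation S := {mpoly K[3]}.
Implicit Types (p q g : S) (u v : {poly K}).

Definition i0 : 'I_3 := @Ordinal 3 0 isT.
Definition i1 : 'I_3 := @Ordinal 3 1 isT.
Definition i2 : 'I_3 := @Ordinal 3 2 isT.

(* restriction of a form to the line x_0 = 0, in the affine chart x_1 = 1 *)
Definition restrict : S -> {poly K} :=
  mmap (@polyC K) (fun i : 'I_3 => if i == i0 then 0 else if i == i1 then 1 else 'X).
HB.instance Definition _ := GRing.RMorphism.on restrict.

Lemma restrictC c : restrict c%:MP = c%:P.
Proof. exact: mmapC. Qed.

Lemma restrictX0 : restrict 'X_i0 = 0.
Proof. by rewrite /restrict mmapX mmap1U. Qed.

Lemma restrictX1 : restrict 'X_i1 = 1.
Proof. by rewrite /restrict mmapX mmap1U. Qed.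

Lemma restrictX2 : restrict 'X_i2 = 'X.
Proof. by rewrite /restrict mmapX mmap1U. Qed.

Lemma big_ord3 (R : Type) (idx : R) (op : Monoid.law idx) (F : 'I_3 -> R) :
  \big[op/idx]_(i < 3) F i = op (F i0) (op (F i1) (F i2)).
Proof.
rewrite !big_ord_recl big_ord0 Monoid.mulm1.
by congr (op (F _) (op (F _) (F _))); apply/val_inj.
Qed.

Lemma restrictZ c p : restrict (c *: p) = c *: restrict p.
Proof. by rewrite -mul_mpolyC rmorphM /= restrictC mul_polyC. Qed.

Lemma restrictXm (m : 'X_{1..3}) :
  restrict 'X_[m] = if m i0 == 0%N then 'X^(m i2) else 0.
Proof.
rewrite /restrict mmapX /mmap1 big_ord3 /= expr1n mul1r.
by case: (m i0) => [|k]; rewrite ?expr0 ?mul1r // expr0n mul0r.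
Qed.

Lemma mdeg3 (m : 'X_{1..3}) : mdeg m = (m i0 + (m i1 + m i2))%N.
Proof. by rewrite mdegE big_ord3. Qed.

Lemma restrictE p :
  restrict p = \sum_(m <- msupp p | m i0 == 0%N) p@_m *: 'X^(m i2).
Proof.
rewrite [in LHS](mpolyE p) rmorph_sum [RHS]big_mkcond /=; apply: eq_bigr => m _.
by rewrite restrictZ restrictXm; case: ifP => // _; rewrite scaler0.
Qed.

Lemma size_restrict k p : p \is k.-homog -> (size (restrict p) <= k.+1)%N.
Proof.
move=> /dhomogP ph; rewrite restrictE big_seq_cond.
apply: (big_ind (fun u => (size u <= k.+1)%N)); first by rewrite size_poly0.
  by move=> u v uk vk; apply: leq_trans (size_polyD _ _) _; rewrite geq_max uk.
move=> m /andP[/ph /= mk _]; apply: leq_trans (size_scale_leq _ _) _.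
by rewrite size_polyXn ltnS -mk mdeg3; lia.
Qed.

(** Homogenization by ['X_i1]. Coefficients of degree above [k] are dropped, so it is a section of
    [restrict] only on polynomials of size at most [k.+1]. *)
Definition lift_form k u : S :=
  \sum_(i < k.+1) u`_i *: ('X_i2 ^+ i * 'X_i1 ^+ (k - i)).

Lemma dhomogXU (i : 'I_3) : ('X_i : S) \is 1.-homog.
Proof. by rewrite dhomogX /= mdeg1. Qed.

Lemma dhomogXn (i : 'I_3) k : ('X_i ^+ k : S) \is k.-homog.
Proof. by have := dhomogMn k (dhomogXU i); rewrite mul1n. Qed.

Lemma lift_form_homog k u : lift_form k u \is k.-homog.
Proof.
apply: rpred_sum => i _; apply: rpredZ.
by have := dhomogM (dhomogXn i2 i) (dhomogXn i1 (k - i)); rewrite subnKC // -ltnS.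
Qed.

Lemma lift_form_linear k : linear (lift_form k).
Proof.
move=> a u v; rewrite /lift_form scaler_sumr -big_split; apply: eq_bigr => i _ /=.
by rewrite coefD coefZ scalerDl scalerA.
Qed.
HB.instance Definition _ k :=
  GRing.isLinear.Build K {poly K} S _ (lift_form k) (lift_form_linear k).

Lemma lift_formK k u : (size u <= k.+1)%N -> restrict (lift_form k u) = u.
Proof.
move=> uk; rewrite rmorph_sum /= -[RHS](coefK u) poly_def.
rewrite (big_ord_widen _ (fun i => u`_i *: 'X^i) uk) [RHS]big_mkcond /=.
apply: eq_bigr => i _; rewrite restrictZ rmorphM !rmorphXn /= restrictX1 restrictX2.
by rewrite expr1n mulr1; case: ltnP => // /(nth_default 0) ->; rewrite scale0r.
Qed.

Lemma restrict_decomp k p : p \is k.-homog ->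
  exists2 q, q \is k.-1.-homog & p = lift_form k (restrict p) + 'X_i0 * q.
Proof.
move=> ph; rewrite [p]mpolyE big_seq; elim/big_ind: _ => [|x y|m mp].
- by exists 0; rewrite ?dhomog0 // rmorph0 linear0 mulr0 addr0.
- move=> [q1 h1 {1}->] [q2 h2 {1}->]; exists (q1 + q2); first exact: rpredD.
  by rewrite rmorphD linearD /=; ring.
have mk := dhomog_mf ph mp; rewrite restrictZ linearZ /= restrictXm.
have mS : 'X_[m] = 'X_i0 ^+ m i0 * ('X_i1 ^+ m i1 * 'X_i2 ^+ m i2) :> S.
  by rewrite mpolyXE_id big_ord3.
case: eqP => m0.
  exists 0; rewrite ?dhomog0 // mulr0 addr0; congr (_ *: _).
  move: mk; rewrite /= mdeg3 m0 add0n => mk.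
  have lt : (m i2 < k.+1)%N by lia.
  rewrite /lift_form (bigD1 (Ordinal lt)) //= coefXn eqxx scale1r big1 ?addr0.
    by rewrite mS m0 mul1r mulrC -mk addnK.
  move=> i im; rewrite coefXn; case: eqP => [e|]; rewrite ?scale0r //.
  by case/eqP: im; apply/val_inj.
have le : (U_(i0) <= m)%MM.
  by apply/mnm_lepP => j; rewrite mnm1E; case: eqP => // <-; lia.
exists (p@_m *: 'X_[m - U_(i0)]).
  apply: rpredZ; rewrite dhomogX /=; apply/eqP.
  by have := congr1 (@mdeg 3) (submK le); rewrite mdegD mdeg1 mk /=; lia.
by rewrite linear0 scaler0 add0r -scalerAr -mpolyXD addmC submK.
Qed.

Lemma restrict_eq0 k p : p \is k.-homog -> restrict p = 0 ->
  exists2 q, q \is k.-1.-homog & p = 'X_i0 * q.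
Proof.
move=> ph p0; have [q qh ->] := restrict_decomp ph.
by exists q; rewrite // p0 linear0 add0r.
Qed.

End Dehomogenization.

(** * The complete intersection of two binary forms of degree D *)

Section BinaryForms.
Variable K : fieldType.
Variables (D : nat) (P Q : {poly K}).
Hypotheses (D_gt0 : (0 < D)%N) (sizeP : size P = D.+1) (sizeQ : (size Q <= D.+1)%N).
Hypothesis coPQ : coprimep P Q.
Implicit Types (u v a b c : {poly K}).

(* degree-t part of the ideal of the two binary forms of degree D that P and Q
   dehomogenize; truncated subtraction makes it 0 for t < D *)
Definition binary_ideal t u :=
  exists a b, [/\ (size a <= t.+1 - D)%N, (size b <= t.+1 - D)%N & u = a * P + b * Q].

Let P0 : P != 0. Proof. by rewrite -size_poly_gt0 sizeP. Qed.

Lemma binary_syzygy a b : a * P + b * Q = 0 ->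
  exists2 c, a = c * Q & b = - c * P.
Proof.
move=> E; have : P %| b * Q.
  have -> : b * Q = - a * P by apply/eqP; rewrite -subr_eq0 mulNr opprK addrC E.
  exact: dvdp_mulIr.
rewrite Gauss_dvdpl // => /dvdpP[c bE]; exists (- c); rewrite ?opprK //.
apply: (mulIf P0); apply/eqP; rewrite mulNr -subr_eq0 mulNr opprK.
by rewrite -[X in _ == X]E bE; apply/eqP; ring.
Qed.

Lemma binary_syzygy0 a b : a * P + b * Q = 0 -> (size b <= D)%N -> a = 0 /\ b = 0.
Proof.
move=> /binary_syzygy[c -> ->] sb; suff -> : c = 0 by rewrite oppr0 !mul0r.
apply/eqP; apply: contraLR sb => c0.
rewrite mulNr size_polyN size_mul // sizeP addnS /= -ltnNge.
by rewrite -[X in (X < _)%N]add0n ltn_add2r size_poly_gt0.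
Qed.

(** Bezout gives u = a P + b Q with b reduced modulo P, so deg b < D; from t >= 2D - 1 on this
    bounds b Q, hence also a P, by degree t. *)
Lemma binary_ideal_large t u :
  (D.*2 <= t.+1)%N -> (size u <= t.+1)%N -> binary_ideal t u.
Proof.
move=> Dt ut; have [[x y] /= E] := Bezout_eq1_coprimepP _ _ coPQ.
pose b := (u * y) %% P; pose a := u * x + (u * y) %/ P * Q.
have sb : (size b <= D)%N by rewrite -ltnS -sizeP ltn_modp.
have uE : u = a * P + b * Q.
  rewrite -[LHS]mulr1 -E /a; have := divp_eq (u * y) P; rewrite -/b => e.
  by rewrite mulrDr [in LHS]mulrA [X in _ + X]mulrA [in LHS]e; ring.
exists a, b; split=> //; last by apply: leq_trans sb _; lia.
have [->|a0] := eqVneq a 0; first by rewrite size_poly0.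
have aP : a * P = u - b * Q by rewrite uE addrK.
have : (size (a * P)%R <= t.+1)%N.
  rewrite aP (leq_trans (size_polyD _ _)) // geq_max ut size_polyN.
  apply: leq_trans (size_polyMleq _ _) _.
  by move: sb sizeQ Dt; move: (size b) (size Q); clear; lia.
by rewrite size_mul // sizeP; move: (size a); clear -D_gt0 Dt; lia.
Qed.

(** The quotient has no socle below degree 2D - 2; [u] and [u * 'X] dehomogenize the products of the
    form with the two variables. The two representations of [u * 'X] differ by a Koszul relation,
    which is 0 for degree reasons, so the coefficients of the first one have small enough degree for
    [t]. *)
Lemma binary_ideal_socle t u : (t.+2 < D.*2)%N -> (size u <= t.+1)%N ->
  binary_ideal t.+1 u -> binary_ideal t.+1 (u * 'X) -> binary_ideal t u.
Proof.
move=> tD ut [a [b [sa sb uE]]] [a' [b' [sa' sb' uE']]].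
have [e1 e2] : a * 'X - a' = 0 /\ b * 'X - b' = 0.
  apply: binary_syzygy0.
    transitivity ((a * P + b * Q) * 'X - (a' * P + b' * Q)); first by ring.
    by rewrite -uE' uE subrr.
  rewrite (leq_trans (size_polyD _ _)) // geq_max size_polyN.
  rewrite (leq_trans (size_polyMleq _ _)) ?size_polyX /=.
    by move: sb' tD; move: (size b'); clear; lia.
  by move: sb tD; move: (size b); clear; lia.
exists a, b; split=> //.
  have [->|a0] := eqVneq a 0; first by rewrite size_poly0.
  move: sa'; have -> : a' = a * 'X by apply/eqP; rewrite eq_sym -subr_eq0 e1.
  by rewrite size_mulX //; move: (size a); clear; lia.
have [->|b0] := eqVneq b 0; first by rewrite size_poly0.
move: sb'; have -> : b' = b * 'X by apply/eqP; rewrite eq_sym -subr_eq0 e2.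
by rewrite size_mulX //; move: (size b); clear; lia.
Qed.

(* The residue pairing: writing u = a P + b Q with deg b < D, the class of u modulo
   the degree-(2D - 2) part of the ideal is the coefficient of b in degree D - 1. *)
Definition residue (B u : {poly K}) : K^o := ((u * B) %% P)`_D.-1.

Lemma residue_linear B : linear (residue B).
Proof.
by move=> a u v; rewrite /residue mulrDl -scalerAl modpD modpZl coefD coefZ.
Qed.
HB.instance Definition _ B :=
  GRing.isLinear.Build K {poly K} K^o _ (residue B) (residue_linear B).

Lemma residue_eq0 A B u : A * P + B * Q = 1 -> (size u <= D.*2.-1)%N ->
  residue B u = 0 <-> binary_ideal D.*2.-2 u.
Proof.
move=> E su; rewrite /residue; split=> [r0|[a [b [sa sb ->]]]]; last first.
  have sbD : (size b <= D.-1)%N by apply: leq_trans sb _; lia.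
  have -> : (a * P + b * Q) * B = (a * B - b * A) * P + b.
    rewrite [X in _ = _ + X](_ : b = b * (A * P + B * Q)); first by ring.
    by rewrite E mulr1.
  rewrite modpD modp_mull add0r modp_small; last first.
    by rewrite sizeP ltnS (leq_trans sbD) ?leq_pred.
  by rewrite nth_default.
pose b := (u * B) %% P; pose a := u * A + (u * B) %/ P * Q.
have sb : (size b <= D.-1)%N.
  apply/leq_sizeP => j; rewrite leq_eqVlt => /predU1P[<- //|Dj].
  apply: nth_default; apply: leq_trans (_ : (D <= j)%N); last by lia.
  by rewrite -ltnS -sizeP ltn_modp.
have uE : u = a * P + b * Q.
  rewrite -[LHS]mulr1 -E /a; have := divp_eq (u * B) P; rewrite -/b => e.
  by rewrite mulrDr [in LHS]mulrA [X in _ + X]mulrA [in LHS]e; ring.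
exists a, b; split=> //; last by apply: leq_trans sb _; lia.
have [->|a0] := eqVneq a 0; first by rewrite size_poly0.
have aP : a * P = u - b * Q by rewrite uE addrK.
have : (size (a * P)%R <= D.*2.-1)%N.
  rewrite aP (leq_trans (size_polyD _ _)) // geq_max su size_polyN.
  apply: leq_trans (size_polyMleq _ _) _.
  by move: sb sizeQ D_gt0; move: (size b) (size Q); clear; lia.
by rewrite size_mul // sizeP; move: (size a); clear -D_gt0; lia.
Qed.

End BinaryForms.

(** * The ideal of [g1] and [g2] in the plane, lifted from the line x_0 = 0 *)

Definition pair_ideal (K : fieldType) (g1 g2 : {mpoly K[3]}) : set {mpoly K[3]} :=
  [set p | exists a b, p = a * g1 + b * g2].

Section PairIdeal.
Variable K : fieldType.
Local Notation S := {mpoly K[3]}.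
Local Notation z := ('X_i0 : {mpoly K[3]}).
Variables (D : nat) (g1 g2 : S).
Implicit Types (p q a b c : S).
Hypotheses (D_gt0 : (0 < D)%N) (g1h : g1 \is D.-homog) (g2h : g2 \is D.-homog).
Hypothesis size_g1 : size (restrict g1) = D.+1.
Hypothesis co_g12 : coprimep (restrict g1) (restrict g2).

Local Notation G := (pair_ideal g1 g2).
Local Notation N := (D.*2.-2).
Local Notation binary := (binary_ideal D (restrict g1) (restrict g2)).

Let size_g2 : (size (restrict g2) <= D.+1)%N := size_restrict g2h.

Lemma pair_ideal_submod : submod G.
Proof.
split=> [|c p q [a [b ->]] [a' [b' ->]]]; first by exists 0, 0; rewrite !mul0r addr0.
by exists (c *: a + a'), (c *: b + b'); rewrite -!mul_mpolyC; ring.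
Qed.

Lemma pair_ideal_mull q p : G p -> G (q * p).
Proof. by move=> [a [b ->]]; exists (q * a), (q * b); ring. Qed.

Lemma dhomogMX0 k m p : p \is k.-homog -> z ^+ m * p \is (m + k).-homog.
Proof. by move=> ph; apply: dhomogM => //; exact: dhomogXn. Qed.

Lemma dhomogMX k p : p \is k.-homog -> z * p \is k.+1.-homog.
Proof. by move=> /(dhomogMX0 1). Qed.

Lemma msize_dhomog k p : p \is k.-homog -> (msize p <= k.+1)%N.
Proof.
move=> /dhomogP ph; rewrite msizeE big_seq; elim/big_ind: _ => // [m n mk nk|m /ph /= ->//].
by rewrite geq_max mk nk.
Qed.

Lemma X0_neq0 : z != 0.
Proof. by rewrite -msize_poly_eq0 msizeX. Qed.

Lemma dhomog0_X0 p q : p \is 0.-homog -> p = z * q -> p = 0.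
Proof.
move=> ph pE; apply/eqP; apply: contraTT (msize_dhomog ph) => p0.
have q0 : q != 0 by apply: contraNneq p0 => q0; rewrite pE q0 mulr0.
rewrite pE msizeM ?X0_neq0 // msizeX mdeg1 /= -ltnNge ltnS lt0n.
by rewrite msize_poly_eq0.
Qed.

(** For k < D the truncated degree [k - D] is 0 and would admit constants, hence the separate
    clause. *)
Lemma pair_ideal_homog k p : p \is k.-homog -> G p ->
  exists a b, [/\ a \is (k - D).-homog, b \is (k - D).-homog,
    (k < D)%N -> a = 0 /\ b = 0 & p = a * g1 + b * g2].
Proof.
move=> ph [a [b pE]]; move: (pihomog_dE ph).
rewrite {1}pE linearD /= (pihomogM _ _ g1h) (pihomogM _ _ g2h).
case: leqP => kD <-.
  exists (pihomog mdeg (k - D) a), (pihomog mdeg (k - D) b).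
  by split=> //; exact: pihomogP.
by exists 0, 0; split; rewrite ?dhomog0 // !mul0r.
Qed.

Lemma restrict_pair_ideal k p : p \is k.-homog -> G p -> binary k (restrict p).
Proof.
move=> ph /(pair_ideal_homog ph)[a [b [ah bh ab0 ->]]].
exists (restrict a), (restrict b).
have sz c : c \is (k - D).-homog -> ((k < D)%N -> c = 0) ->
    (size (restrict c) <= k.+1 - D)%N.
  move=> ch c0; have [kD|kD] := ltnP k D; first by rewrite c0 // rmorph0 size_poly0.
  by rewrite subSn // size_restrict.
split; [| |by rewrite rmorphD !rmorphM].
  by apply: sz => // /ab0[].
by apply: sz => // /ab0[].
Qed.

(** Lifting the coefficients gives an element of the ideal with the same restriction as [p], and the
    difference is divisible by z. The descents along powers of z below iterate this step. *)
Lemma lift_binary_ideal k p : p \is k.-homog -> binary k (restrict p) ->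
  exists q g, [/\ q \is k.-1.-homog, g \is k.-homog, G g & p = z * q + g].
Proof.
move=> ph [a [b [sa sb pE]]].
have [kD|kD] := ltnP k D.
  have p0 : restrict p = 0.
    rewrite pE; move: sa sb; rewrite (_ : k.+1 - D = 0)%N; last by lia.
    by rewrite !leqn0 !size_poly_eq0 => /eqP-> /eqP->; rewrite !mul0r addr0.
  have [q qh ->] := restrict_eq0 ph p0; exists q, 0; split=> //.
  - exact: dhomog0.
  - exact: pair_ideal_submod.1.
  - by rewrite addr0.
move: sa sb; rewrite subSn // => sa sb.
pose g := lift_form (k - D) a * g1 + lift_form (k - D) b * g2.
have gh : g \is k.-homog.
  by rewrite -[k](subnK kD); apply: rpredD; apply: dhomogM => //; exact: lift_form_homog.
have [||q qh qE] := @restrict_eq0 _ k (p - g).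
- exact: rpredB.
- by rewrite /g rmorphB rmorphD !rmorphM /= !lift_formK // pE subrr.
exists q, g; split=> //; first by exists (lift_form (k - D) a), (lift_form (k - D) b).
by rewrite -qE subrK.
Qed.

(** On the line every relation is a multiple of the Koszul one; after subtracting a lift of that
    multiple, both coefficients are divisible by z. *)
Lemma pair_syzygy_modX0 k a b : a \is k.-homog -> b \is k.-homog ->
    restrict (a * g1 + b * g2) = 0 ->
  exists c a' b', [/\ c \is (k - D).-homog /\ ((k < D)%N -> c = 0),
    a' \is k.-1.-homog, b' \is k.-1.-homog, a = c * g2 + z * a' & b = - c * g1 + z * b'].
Proof.
move=> ah bh; rewrite rmorphD !rmorphM /= => E.
have [kD|kD] := ltnP k D.
  have [|a0 b0] := binary_syzygy0 size_g1 co_g12 E.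
    by apply: leq_trans (size_restrict bh) _.
  have [a' a'h ->] := restrict_eq0 ah a0; have [b' b'h ->] := restrict_eq0 bh b0.
  by exists 0, a', b'; rewrite oppr0 !mul0r !add0r; split=> //; rewrite dhomog0.
have [c aE bE] := binary_syzygy size_g1 co_g12 E.
have sc : (size c <= (k - D).+1)%N.
  have [->|c0] := eqVneq c 0; first by rewrite size_poly0.
  have := size_restrict bh; rewrite bE mulNr size_polyN size_mul //; last first.
    by rewrite -size_poly_gt0 size_g1.
  by rewrite size_g1; move: (size c) kD; clear; lia.
pose C := lift_form (k - D) c; have Ch : C \is (k - D).-homog by exact: lift_form_homog.
have CE : restrict C = c by rewrite lift_formK.
have Cgh g : g \is D.-homog -> C * g \is k.-homog.
  by move=> gh; rewrite -[k](subnK kD); exact: dhomogM.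
have [||a' a'h a'E] := @restrict_eq0 _ k (a - C * g2).
- by rewrite rpredB // Cgh.
- by rewrite rmorphB rmorphM /= CE aE subrr.
have [||b' b'h b'E] := @restrict_eq0 _ k (b + C * g1).
- by rewrite rpredD // Cgh.
- by rewrite rmorphD rmorphM /= CE bE mulNr addNr.
exists C, a', b'; split=> //.
- by rewrite -a'E addrC subrK.
- by rewrite -b'E mulNr addrC addrK.
Qed.

(** z is a nonzerodivisor modulo the ideal: changing (a, b) by a multiple of (g2, - g1) leaves a g1
    + b g2 unchanged and makes both coefficients divisible by z. *)
Lemma pair_ideal_X0 k p : p \is k.-homog -> G (z * p) -> G p.
Proof.
move=> ph zpG; have zph : z * p \is k.+1.-homog.
  exact: dhomogMX.
have [a [b [ah bh _ E]]] := pair_ideal_homog zph zpG.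
have [|c [a' [b' [_ _ _ aE bE]]]] := pair_syzygy_modX0 ah bh.
  by rewrite -E rmorphM /= restrictX0 mul0r.
exists a', b'; apply: (mulfI X0_neq0); rewrite E aE bE; ring.
Qed.

Lemma pair_ideal_X0n m k p : p \is k.-homog -> G (z ^+ m * p) -> G p.
Proof.
move=> ph; elim: m => [|m IH]; first by rewrite mul1r.
rewrite exprS -mulrA => H; apply: IH; apply: pair_ideal_X0 H.
exact: dhomogMX0 ph.
Qed.

(** In degrees above N = 2D - 2 every binary form lies in the binary ideal, so z can be split off
    again and again, down to degree N. *)
Lemma pair_ideal_large m p : p \is (m + N).-homog -> exists q g,
  [/\ q \is N.-homog, g \is (m + N).-homog, G g & p = z ^+ m * q + g].
Proof.
elim: m p => [|m IH] p ph.
  exists p, 0; split=> //; rewrite ?dhomog0 ?expr0 ?mul1r ?addr0 //.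
  exact: pair_ideal_submod.1.
have [|q [g [qh gh Gg pE]]] := lift_binary_ideal ph.
  by apply: binary_ideal_large; rewrite ?size_restrict //; lia.
have [q' [g' [q'h g'h Gg' qE]]] := IH _ qh.
exists q', (z * g' + g); split=> //.
- by rewrite rpredD // addSn dhomogMX.
- by apply: submodD => //; [exact: pair_ideal_submod|exact: pair_ideal_mull].
- by rewrite pE qE exprS; ring.
Qed.

(** Once the Koszul part is removed, what remains is z times a relation of lower degree; in degree 0
    it vanishes by [dhomog0_X0]. *)
Lemma pair_syzygy k a b : a \is k.-homog -> b \is k.-homog ->
    a * g1 + b * g2 = 0 -> exists c, [/\ c \is (k - D).-homog, (k < D)%N -> c = 0,
    a = c * g2 & b = - c * g1].
Proof.
elim: k a b => [|k IH] a b ah bh E.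
all: have [|c [a' [b' [[ch c0] a'h b'h aE bE]]]] := pair_syzygy_modX0 ah bh;
  first by rewrite E rmorph0.
all: have E' : a' * g1 + b' * g2 = 0
  by apply: (mulfI X0_neq0); rewrite mulr0 -E aE bE; ring.
  move: aE bE; rewrite c0 // oppr0 !mul0r !add0r => aE bE.
  by exists 0; rewrite dhomog0 oppr0 !mul0r; split=> //; [apply: dhomog0_X0 aE|apply: dhomog0_X0 bE].
have [c' [c'h c'0 a'E b'E]] := IH _ _ a'h b'h E'.
exists (c + z * c'); split.
- rewrite rpredD //; have [kD|kD] := ltnP k D; first by rewrite c'0 // mulr0 dhomog0.
  by rewrite subSn // dhomogMX.
- by move=> kD; rewrite c0 // c'0 ?mulr0 ?addr0 //; lia.
- by rewrite aE a'E; ring.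
- by rewrite bE b'E; ring.
Qed.

End PairIdeal.

(** * The residue pairing *)

Definition triple_ideal (K : fieldType) (g1 g2 g3 : {mpoly K[3]}) : set {mpoly K[3]} :=
  [set p | exists a b c, p = a * g1 + b * g2 + c * g3].

Section Linkage.
Variable K : fieldType.
Local Notation S := {mpoly K[3]}.
Local Notation H := (dhomog 3 K).
Local Notation z := ('X_i0 : {mpoly K[3]}).
Variables (D : nat) (g1 g2 g3 : S).
Implicit Types (p q a b c : S).
Hypotheses (D_gt0 : (0 < D)%N) (g1h : g1 \is D.-homog) (g2h : g2 \is D.-homog).
Hypothesis (g3h : g3 \is D.-homog).
Hypothesis size_g1 : size (restrict g1) = D.+1.
Hypothesis co_g12 : coprimep (restrict g1) (restrict g2).

Local Notation G := (pair_ideal g1 g2).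
Local Notation J := (triple_ideal g1 g2 g3).
Local Notation Sat := (saturation J).
Local Notation N := (D.*2.-2).
Local Notation binary := (binary_ideal D (restrict g1) (restrict g2)).

Let size_g2 : (size (restrict g2) <= D.+1)%N := size_restrict g2h.
Let Gsub := pair_ideal_submod g1 g2.
Let G_X0n := pair_ideal_X0n g1h g2h size_g1 co_g12.
Let G_large := pair_ideal_large D_gt0 g1h g2h size_g1 co_g12.

(** Nondegeneracy of the product of binary forms of complementary degrees k and N - k, by climbing
    to the socle degree N one variable at a time. *)
Lemma binary_socle m k p : (k + m = N)%N -> p \is k.-homog ->
    (forall w, w \is m.-homog -> binary N (restrict (p * w))) ->
  binary k (restrict p).
Proof.
elim: m k p => [|m IH] k p km ph H.
  by rewrite addn0 in km; have := H 1 (dhomog1 _ _); rewrite mulr1 km.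
have km1 : (k.+1 + m = N)%N by lia.
have X j : restrict (p * 'X_j) = restrict p * restrict 'X_j by rewrite rmorphM.
have hX j q l : q \is l.-homog -> ('X_j : S) * q \is l.+1.-homog.
  by move=> /(dhomogM (dhomogXU K j)); rewrite add1n.
have bX j : binary k.+1 (restrict (p * 'X_j)).
  apply: (IH _ _ km1) => [|w wh]; first by rewrite mulrC hX.
  by rewrite -mulrA; apply: H; exact: hX.
apply: (binary_ideal_socle size_g1 co_g12); first by lia.
- exact: size_restrict.
- by have := bX i1; rewrite X restrictX1 mulr1.
- by have := bX i2; rewrite X restrictX2.
Qed.

Variables (A B : {poly K}).
Hypothesis bezout : A * restrict g1 + B * restrict g2 = 1.
Local Notation res := (residue D (restrict g1) B).

Lemma res_eq0 p : p \is N.-homog -> res (restrict p) = 0 <-> binary N (restrict p).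
Proof.
move=> ph; apply: (residue_eq0 D_gt0 size_g1 size_g2 co_g12 bezout).
by have := size_restrict ph; lia.
Qed.

(* Phi is well defined since S_(i+N) = z^i S_N + G_(i+N) and the residue kills G_N. *)
Lemma residue_functional (i : nat) : exists Phi : S -> K,
  [/\ forall (x : K) p q, Phi (x *: p + q) = x * Phi p + Phi q,
      forall p, p \is N.-homog -> Phi (z ^+ i * p) = res (restrict p) &
      forall g, g \is (i + N).-homog -> G g -> Phi g = 0].
Proof.
(* The map (p, q) -> z^i p + pr q, with pr the projection to G_(i+N), has image z^i S_N + G_(i+N).
   The functional (p, q) -> res p kills its kernel, because z^i p in G forces p in G, and so it
   factors through the map. *)
pose U := (H N * H (i + N))%type.
pose fF (u : U) : H (i + N) :=
  mul_homog (z ^+ i) N (i + N) u.1 + projv (graded_piece G (i + N)) u.2.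
have flin : linear fF.
  by move=> a u v; rewrite /fF /= !linearP scalerDr !addrA; congr (_ + _); rewrite addrAC.
pose fL : {linear U -> H (i + N)} := HB.pack fF (GRing.isLinear.Build K U _ _ fF flin).
pose lF (u : U) : K^o := res (restrict u.1).
have llin : linear lF.
  move=> a u v; transitivity (res (restrict (a *: (u.1 : S) + (v.1 : S)))) => //.
  by rewrite rmorphD /= restrictZ linearP.
pose lL : {linear U -> K^o} := HB.pack lF (GRing.isLinear.Build K U _ _ lF llin).
have [|l' l'E] := @factor_functional K _ _ (linfun fL) (linfun lL).
  move=> u; rewrite !lfunE /= /fF /lF => /(congr1 (@mpoly_of_dhomog 3 K (i + N))).
  rewrite raddfD /= (mul_homogE _ (dhomogXn _ i0 i)) // => E.
  have /(mem_graded _ Gsub) Gq := memv_proj (graded_piece G (i + N)) u.2.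
  have uh : (u.1 : S) \is N.-homog by exact: dhomog_is_dhomog.
  apply/(res_eq0 uh)/restrict_pair_ideal => //.
  apply: (G_X0n (m := i) uh).
  rewrite (_ : _ * _ = - (projv (graded_piece G (i + N)) u.2 : H _) :> S).
    by rewrite -scaleN1r; apply: submodZ.
  by apply/eqP; rewrite -addr_eq0 E.
exists (fun p => l' (proj_homog (i + N) p)); split.
- by move=> a p q; rewrite !linearP.
- move=> p ph; pose u : U := (DHomog ph, 0).
  have <- : fL u = proj_homog (i + N) (z ^+ i * p).
    apply/dhomog_inj; rewrite proj_homogE; last exact: dhomogMX0.
    by rewrite /= /fF /= linear0 addr0 (mul_homogE _ (dhomogXn _ i0 i)).
  by have := l'E u; rewrite !lfunE.
- move=> g gh Gg; pose u : U := (0, DHomog gh).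
  have <- : fL u = proj_homog (i + N) g.
    apply/dhomog_inj; rewrite proj_homogE //= /fF /= linear0 add0r projv_id //.
    by apply/mem_graded.
  have := l'E u; rewrite !lfunE /= => ->.
  by rewrite /lF /= rmorph0 linear0.
Qed.

(** The conclusion of [residue_functional] as a predicate. One such functional for each [i] replaces
    the residue on the limit V. *)
Definition extends_residue (i : nat) (Phi : S -> K) :=
  [/\ forall (x : K) p q, Phi (x *: p + q) = x * Phi p + Phi q,
      forall p, p \is N.-homog -> Phi (z ^+ i * p) = res (restrict p) &
      forall g, g \is (i + N).-homog -> G g -> Phi g = 0].

Lemma extends_residueD i Phi p q : extends_residue i Phi -> Phi (p + q) = Phi p + Phi q.
Proof. by move=> [lin _ _]; rewrite -[p]scale1r lin mul1r scale1r. Qed.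

(* For s = i + 1: modulo G, the annihilator of S_i in S_N is z^(i+1) S_(N-1-i). *)
Lemma residue_annihilator i Phi p : extends_residue i Phi -> p \is N.-homog ->
    (forall w, w \is i.-homog -> Phi (p * w) = 0) ->
  forall s, (s <= i.+1)%N -> (s <= N)%N ->
  exists q g, [/\ q \is (N - s).-homog, g \is N.-homog, G g & p = z ^+ s * q + g].
Proof.
move=> ext ph Hp; elim=> [|s IH] si sN.
  by exists p, 0; rewrite subn0 dhomog0 expr0 mul1r addr0; split=> //; case: Gsub.
have [q [g [qh gh Gg pE]]] := IH (ltnW si) (ltnW sN).
(* Testing [p] on z^(i-s) w turns the hypothesis into res (q w) = 0 for all w of degree s, the
   degree complementary to that of q; the pairing on the line then puts q in the ideal modulo z. *)
have qb : binary (N - s)%N (restrict q).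
  apply: (binary_socle (m := s)) => //; first by lia.
  move=> w wh; have qwh : q * w \is N.-homog.
    by have := dhomogM qh wh; rewrite subnK // ltnW.
  apply/(res_eq0 qwh).
  have [_ <- // Phi0] := ext; have := Hp (z ^+ (i - s) * w).
  have si' : (s <= i)%N by [].
  have -> : p * (z ^+ (i - s) * w) = z ^+ i * (q * w) + (z ^+ (i - s) * w) * g.
    rewrite pE (_ : z ^+ i = z ^+ s * z ^+ (i - s)); first by ring.
    by rewrite -exprD subnKC.
  have wih : z ^+ (i - s) * w \is i.-homog by have := dhomogMX0 (i - s) wh; rewrite subnK.
  rewrite (extends_residueD _ _ ext) [X in _ + X]Phi0 ?addr0; first exact.
    exact: dhomogM.
  exact: pair_ideal_mull.
have [q' [g' [q'h g'h Gg' qE]]] := lift_binary_ideal D_gt0 g1h g2h size_g1 co_g12 qh qb.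
exists q', (z ^+ s * g' + g); split.
- by rewrite subnS.
- by rewrite rpredD //; have := dhomogMX0 s g'h; rewrite subnKC // ltnW.
- by apply: (submodD Gsub) => //; exact: pair_ideal_mull.
- by rewrite pE qE exprSr; ring.
Qed.

Lemma residue_nondegenerate i Phi p : (N <= i)%N -> extends_residue i Phi ->
  p \is N.-homog -> (forall w, w \is i.-homog -> Phi (p * w) = 0) -> G p.
Proof.
move=> Ni ext ph Hp.
have [|q [g [qh gh Gg pE]]] := residue_annihilator ext ph Hp _ (leqnn N); first by lia.
have qwh w : w \is N.-homog -> q * w \is N.-homog.
  by rewrite subnn in qh; move=> /(dhomogM qh).
(* One descent step beyond s = N: now [q] is a constant, and a constant that is divisible by z
   modulo G lies in G. *)
have qb : binary 0 (restrict q).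
  rewrite subnn in qh.
  apply: (binary_socle (m := N)) => // w wh.
  apply/(res_eq0); first exact: qwh.
  have [_ PhiX Phi0] := ext; rewrite -PhiX; last exact: qwh.
  have := Hp (z ^+ (i - N) * w).
  have -> : p * (z ^+ (i - N) * w) = z ^+ i * (q * w) + (z ^+ (i - N) * w) * g.
    rewrite pE (_ : z ^+ i = z ^+ N * z ^+ (i - N)); first by ring.
    by rewrite -exprD subnKC.
  have wih : z ^+ (i - N) * w \is i.-homog by have := dhomogMX0 (i - N) wh; rewrite subnK.
  rewrite (extends_residueD _ _ ext) [X in _ + X]Phi0 ?addr0; first exact.
    exact: dhomogM.
  exact: pair_ideal_mull.
rewrite subnn in qh.
have [q' [g' [q'h g'h Gg' qE]]] := lift_binary_ideal D_gt0 g1h g2h size_g1 co_g12 qh qb.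
suff q0 : q = g'.
  by rewrite pE q0; apply: (submodD Gsub) => //; exact: pair_ideal_mull.
apply/eqP; rewrite -subr_eq0; apply/eqP; apply: (dhomog0_X0 (q := q')).
  by rewrite rpredB.
by rewrite qE addrK.
Qed.

Lemma triple_ideal_submod : submod J.
Proof.
split=> [|x p q [a [b [c ->]]] [a' [b' [c' ->]]]].
  by exists 0, 0, 0; rewrite !mul0r !addr0.
exists (x *: a + a'), (x *: b + b'), (x *: c + c'); rewrite -!mul_mpolyC; ring.
Qed.

Lemma triple_ideal_mull q p : J p -> J (q * p).
Proof. by move=> [a [b [c ->]]]; exists (q * a), (q * b), (q * c); ring. Qed.

Lemma pair_triple_ideal p : G p -> J p.
Proof. by move=> [a [b ->]]; exists a, b, 0; rewrite mul0r addr0. Qed.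

(** Powers of z suffice to test saturation, because S_(m+N) is contained in z^m S_N + G and G lies
    in J. *)
Lemma saturation_X0n m j p : p \is j.-homog -> J (z ^+ m * p) -> Sat p.
Proof.
move=> ph Jp; exists (m + N)%N => q /G_large[q' [g [_ _ Gg ->]]].
have -> : (z ^+ m * q' + g) * p = q' * (z ^+ m * p) + p * g by ring.
apply: (submodD triple_ideal_submod); first exact: triple_ideal_mull.
exact/triple_ideal_mull/pair_triple_ideal.
Qed.

Lemma saturation_triple_submod : submod Sat.
Proof.
split=> [|x p q [k Hk] [l Hl]].
  by exists 0%N => q _; rewrite mulr0; case: triple_ideal_submod.
have mono k1 l1 r : (forall u, u \is k1.-homog -> J (u * r)) ->
    forall u, u \is (k1 + l1).-homog -> J (u * r).
  move=> H1 u /dhomog_split[F HF]; rewrite [u]mpolyE mulr_suml big_seq.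
  elim/big_ind: _ => [|p1 p2 J1 J2|n nu]; first by case: triple_ideal_submod.
    exact: (submodD triple_ideal_submod).
  have [Fn Fl] := HF n nu.
  rewrite -(submK Fn) mpolyXD -scalerAl; apply: (submodZ _ triple_ideal_submod).
  by rewrite -mulrA; apply: triple_ideal_mull; apply: H1; rewrite dhomogX; apply/eqP.
exists (k + l)%N => u uh; rewrite mulrDr -scalerAr.
apply: triple_ideal_submod.2; first exact: mono uh.
by apply: (mono l k) => //; rewrite addnC.
Qed.

Lemma triple_ideal_sat p : J p -> Sat p.
Proof. by exists 0%N => q _; exact: triple_ideal_mull. Qed.

Lemma saturation_mull q p : Sat p -> Sat (q * p).
Proof.
by move=> [k Hk]; exists k => u uh; rewrite mulrCA; apply: triple_ideal_mull; exact: Hk.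
Qed.

(** Self-adjointness of multiplication by [g3]: in the limit V the saturation in degree N is the
    part of g3 V lying in A_N, so what it annihilates is the kernel of [g3]. *)
Lemma residue_annihilator_sat i Phi q : extends_residue i Phi -> q \is i.-homog ->
  (forall p, p \is N.-homog -> Sat p -> Phi (p * q) = 0) <-> G (q * g3).
Proof.
move=> ext qh; have [_ PhiX PhiG] := ext; split=> [Hq|Gq p ph Sp]; last first.
  have [m Hm] := Sp; have [a [b [c E]]] := Hm (z ^+ m) (dhomogXn _ _ _).
  have pqh : p * q \is (i + N).-homog by rewrite addnC; exact: dhomogM.
  apply: PhiG => //; apply: (G_X0n (m := m) pqh).
  have -> : z ^+ m * (p * q) = q * (a * g1 + b * g2) + c * (q * g3).
    by rewrite mulrA E; ring.
  by apply: (submodD Gsub); apply: pair_ideal_mull => //; exists a, b.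
have [PhiN extN] := residue_functional N.
have qgh : q * g3 \is (i + D).-homog by exact: dhomogM.
(* [h] is q g3 moved to degree N along powers of z, downwards by [G_large] or upwards by
   multiplication. *)
have [a [b [h [hh Gh abN]]]] : exists (a b : nat) (h : S), [/\ h \is N.-homog,
    G (z ^+ a * h - z ^+ b * (q * g3)) & (a + N = b + (i + D))%N].
  have [le|lt] := leqP N (i + D).
    have := qgh; rewrite -{1}(subnK le) => /G_large[h [g [hh gh Gg ->]]].
    exists (i + D - N)%N, 0%N, h; split=> //; last by lia.
    rewrite mul1r opprD addNKr -scaleN1r; exact: (submodZ _ Gsub).
  exists 0%N, (N - (i + D))%N, (z ^+ (N - (i + D)) * (q * g3)); split; last by lia.
    by have := dhomogMX0 (N - (i + D)) qgh; rewrite subnK // ltnW.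
  by rewrite mul1r subrr; case: Gsub.
suff Gh' : G h.
  apply: (G_X0n (m := b) qgh).
  have -> : z ^+ b * (q * g3) = z ^+ a * h - (z ^+ a * h - z ^+ b * (q * g3)) by ring.
  by apply: (submodB Gsub) => //; exact: pair_ideal_mull.
(* Modulo G, w g3 is z^D p with p in the saturation and p q is z^i p'; then h w is z^N p' modulo G,
   while res p' = Phi (p q) = 0. *)
apply: (residue_nondegenerate (leqnn N) extN hh) => w wh.
have : w * g3 \is (D + N).-homog by rewrite addnC; exact: dhomogM.
move=> /G_large[p [g [ph gh Gg wE]]].
have Sp : Sat p.
  apply: (saturation_X0n (m := D) ph).
  have -> : z ^+ D * p = w * g3 - g by rewrite wE addrK.
  apply: (submodB triple_ideal_submod); last exact: pair_triple_ideal.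
  by exists 0, 0, w; rewrite !mul0r !add0r.
have : p * q \is (i + N).-homog by rewrite addnC; exact: dhomogM.
move=> /G_large[p' [g' [p'h g'h Gg' pqE]]].
have r0 : res (restrict p') = 0.
  rewrite -PhiX // -[LHS]addr0 -[X in _ + X](PhiG g') //.
  by rewrite -(extends_residueD _ _ ext) -pqE Hq.
have hwh : h * w - z ^+ N * p' \is (N + N).-homog.
  by rewrite rpredB ?dhomogMX0 //; exact: dhomogM.
have Ghw : G (h * w - z ^+ N * p').
  apply: (G_X0n (m := a) hwh).
  have -> : z ^+ a * (h * w - z ^+ N * p') = w * (z ^+ a * h - z ^+ b * (q * g3)) +
      (z ^+ b * q * g + z ^+ b * z ^+ D * g').
    have E1 : z ^+ b * q * (w * g3) = z ^+ b * z ^+ D * (z ^+ i * p' + g') + z ^+ b * q * g.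
      by rewrite wE -pqE; ring.
    have E2 : z ^+ a * z ^+ N = z ^+ b * z ^+ D * z ^+ i.
      by rewrite -!exprD abN (addnC i) addnA.
    apply/eqP; rewrite -subr_eq0; apply/eqP.
    transitivity (z ^+ b * q * (w * g3) - (z ^+ b * z ^+ D * (z ^+ i * p' + g') +
      z ^+ b * q * g) - (z ^+ a * z ^+ N - z ^+ b * z ^+ D * z ^+ i) * p'); first by ring.
    by rewrite E1 E2 !subrr mul0r subr0.
  by do 2?[apply: (submodD Gsub)]; apply: pair_ideal_mull.
have [_ PhiNX PhiNG] := extN.
have -> : h * w = (h * w - z ^+ N * p') + z ^+ N * p' by rewrite subrK.
by rewrite (extends_residueD _ _ extN) PhiNG // PhiNX // r0 addr0.
Qed.

Local Notation gp := graded_piece.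

(** Multiplication by z^m embeds E_j / G_j in S_k / G_k. *)
Lemma dim_shift (E : set S) m j k : (m + j = k)%N -> submod E -> (forall p, G p -> E p) ->
  (\dim (mul_homog (z ^+ m) j k @: gp E j + gp G k)%VS + \dim (gp G j) =
   \dim (gp E j) + \dim (gp G k))%N.
Proof.
move=> jk Esub GE; set f := mul_homog _ _ _.
have zm0 : z ^+ m != 0 by rewrite expf_neq0 // X0_neq0.
have fE (p : H j) : f p = z ^+ m * p :> S := mul_homogE p (dhomogXn K i0 m) jk.
have kf : lker f = 0%VS by apply: (lker_mul_homog zm0 (dhomogXn K i0 m) jk).
have dimf U : \dim (f @: U) = \dim U by rewrite limg_dim_eq // kf capv0.
rewrite -(dimf (gp G j)) -(dimf (gp E j)) -[RHS]dimv_sum_cap; congr (_ + \dim _)%N.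
apply/vspaceP => u; apply/memv_imgP/memv_capP.
  move=> [p /(mem_graded _ Gsub) Gp ->]; split; last first.
    by apply/(mem_graded _ Gsub); rewrite fE; exact: pair_ideal_mull.
  by apply: memv_img; apply/(mem_graded _ Esub)/GE.
move=> [/memv_imgP[p _ ->] /(mem_graded _ Gsub)]; rewrite fE => Gp.
exists p => //; apply/(mem_graded _ Gsub); apply: G_X0n Gp.
exact: dhomog_is_dhomog.
Qed.

Definition colon_g3 : set S := [set q | G (q * g3)].

Lemma colon_submod : submod colon_g3.
Proof.
split; rewrite /colon_g3 /=; first by rewrite mul0r; case: Gsub.
by move=> a p q Gp Gq; rewrite /= mulrDl -scalerAl; exact: Gsub.2.
Qed.

(** Multiplication by [g3] identifies S_i / (G : g3)_i with J_(D+i) / G_(D+i). *)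
Lemma dim_triple_ideal i : (\dim (gp J (D + i)) + \dim (gp colon_g3 i) =
  \dim (gp G (D + i)) + \dim {: H i})%N.
Proof.
pose f := mul_homog g3 i (D + i).
have fE (p : H i) : f p = g3 * p :> S := mul_homogE p g3h erefl.
have -> : gp J (D + i) = (limg f + gp G (D + i))%VS.
  apply/vspaceP => u; apply/idP/memv_addP.
    move=> /(mem_graded _ triple_ideal_submod)[a [b [c E]]].
    pose c' := proj_homog i c.
    have : G (u - f c' : H _).
      exists (pihomog mdeg i a), (pihomog mdeg i b); rewrite /= fE.
      have uh : (u : S) \is (D + i).-homog by exact: dhomog_is_dhomog.
      have := pihomog_dE uh; rewrite {1}E !linearD /=.
      rewrite (pihomogM _ _ g1h) (pihomogM _ _ g2h) (pihomogM _ _ g3h) leq_addr addKn.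
      by move=> /= <-; rewrite [g3 * _]mulrC addrK.
    move=> /(mem_graded _ Gsub) Gu; exists (f c'); first exact/memv_img/memvf.
    by exists (u - f c') => //; rewrite addrC subrK.
  move=> [_ /memv_imgP[c _ ->] [v /(mem_graded _ Gsub) Gv ->]].
  apply/(mem_graded _ triple_ideal_submod); rewrite raddfD /=.
  apply: (submodD triple_ideal_submod); last exact: pair_triple_ideal.
  by rewrite fE; exists 0, 0, (c : S); rewrite !mul0r !add0r mulrC.
have QE : gp colon_g3 i = (f @^-1: gp G (D + i))%VS.
  apply/vspaceP => q; rewrite -memv_preim; apply/idP/idP.
    by move=> /(mem_graded _ colon_submod) Gq; apply/(mem_graded _ Gsub); rewrite fE mulrC.
  by move=> /(mem_graded _ Gsub); rewrite fE mulrC => Gq; apply/(mem_graded _ colon_submod).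
have := dimv_sum_cap (limg f) (gp G (D + i)).
have := limg_ker_dim f fullv; rewrite capfv.
have := limg_ker_dim f (gp colon_g3 i).
have -> : (gp colon_g3 i :&: lker f = lker f)%VS.
  apply/capv_idPr; rewrite QE; apply/subvP => u; rewrite memv_ker -memv_preim => /eqP ->.
  exact: mem0v.
have -> : (f @: gp colon_g3 i = limg f :&: gp G (D + i))%VS.
  rewrite QE -lpreim_cap_limg lpreimK ?capvSr // capvC //.
move=> e1 e2 e3; rewrite -e1 -e2 addnCA e3 [RHS]addnCA; congr (_ + _)%N.
exact: addnC.
Qed.

Lemma saturation_X0n_inv m j p : p \is j.-homog -> Sat (z ^+ m * p) -> Sat p.
Proof.
move=> ph [k Hk]; apply: (saturation_X0n (m := k + m) ph).
by rewrite exprD -mulrA; apply: Hk; exact: dhomogXn.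
Qed.

Lemma saturation_pair p : G p -> Sat p.
Proof. by move=> /pair_triple_ideal/triple_ideal_sat. Qed.

Let Satsub := saturation_triple_submod.

Lemma pairing_linear i Phi : extends_residue i Phi ->
  (forall w : H i, linear_for *%R (fun u : H N => Phi ((u : S) * (w : S)))) /\
  (forall u : H N, linear_for *%R (fun w : H i => Phi ((u : S) * (w : S)))).
Proof.
move=> [lin _ _]; split=> [w|u] x u1 u2.
  have -> : (x *: u1 + u2 : H N) = x *: (u1 : S) + (u2 : S) :> S by [].
  by rewrite mulrDl -scalerAl lin.
have -> : (x *: u1 + u2 : H i) = x *: (u1 : S) + (u2 : S) :> S by [].
by rewrite mulrDr -scalerAr lin.
Qed.

Lemma colon_annihilator i Phi (q : H i) : extends_residue i Phi ->
  q \in gp colon_g3 i <-> q \in fullv /\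
    forall u : H N, u \in gp Sat N -> Phi ((u : S) * (q : S)) = 0.
Proof.
move=> ext; rewrite (mem_graded _ colon_submod) /colon_g3 /=.
rewrite -(residue_annihilator_sat ext (dhomog_is_dhomog q)).
split=> [Hq|[_ Hq] p ph Sp].
  split; first exact: memvf.
  by move=> u /(mem_graded _ Satsub); apply: Hq; exact: dhomog_is_dhomog.
by apply: (Hq (DHomog ph)); apply/(mem_graded _ Satsub).
Qed.

(** In the pairing Phi (u w) of Sat_N with S_i the left radical is z^(i+1) Sat_j + G_N, by
    [residue_annihilator], and the right one is (G : g3)_i. Comparing dimensions, Sat_j / G_j has
    dimension dim Sat_N / G_N - dim J_(D+i) / G_(D+i). *)
Lemma linkage_dim i j : (i.+1 + j = N)%N ->
  (\dim (gp Sat j) + \dim (gp J (D + i)) + \dim (gp G N) =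
   \dim (gp G j) + \dim (gp G (D + i)) + \dim (gp Sat N))%N.
Proof.
move=> ijN; have [Phi ext] := residue_functional i.
have [linl linr] := pairing_linear ext.
have [_ PhiX PhiG] := ext.
pose f := mul_homog (z ^+ i.+1) j N.
have fE (p : H j) : f p = z ^+ i.+1 * p :> S := mul_homogE p (dhomogXn K i0 i.+1) ijN.
have HL (u : H N) : u \in (f @: gp Sat j + gp G N)%VS <-> u \in gp Sat N /\
    forall w : H i, w \in fullv -> Phi ((u : S) * (w : S)) = 0.
  split.
    move=> /memv_addP[_ /memv_imgP[p /(mem_graded _ Satsub) Sp ->]].
    move=> [g /(mem_graded _ Gsub) Gg ->]; split.
      apply/(mem_graded _ Satsub); rewrite raddfD /= fE.
      apply: (submodD Satsub); last exact: saturation_pair.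
      exact: saturation_mull.
    move=> w _; rewrite raddfD /= fE mulrDl (extends_residueD _ _ ext).
    have wh := dhomog_is_dhomog w.
    rewrite [X in _ + X]PhiG ?addr0; last first.
    - by rewrite mulrC; exact: pair_ideal_mull.
    - by rewrite addnC; apply: dhomogM => //; exact: dhomog_is_dhomog.
    rewrite exprSr -!mulrA PhiX; last first.
      rewrite -ijN addSn (addnC i); apply: dhomogMX; apply: dhomogM => //.
      exact: dhomog_is_dhomog.
    by rewrite rmorphM /= restrictX0 mul0r linear0.
  move=> [/(mem_graded _ Satsub) Su Hu].
  have [|||q [g [qh gh Gg uE]]] := @residue_annihilator i Phi u ext _ _ i.+1 (leqnn _).
  - exact: dhomog_is_dhomog.
  - by move=> w wh; apply: (Hu (DHomog wh)); exact: memvf.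
  - by rewrite -ijN leq_addr.
  have qh' : q \is j.-homog by rewrite -ijN addKn in qh.
  apply/memv_addP; exists (f (DHomog qh')).
    apply/memv_img/(mem_graded _ Satsub); apply: (saturation_X0n_inv (m := i.+1) qh').
    have -> : z ^+ i.+1 * q = (u : S) - g by rewrite uE addrK.
    by apply: (submodB Satsub) => //; exact: saturation_pair.
  exists (DHomog gh); first exact/(mem_graded _ Gsub).
  by apply/dhomog_inj; rewrite raddfD /= fE.
have HQ (w : H i) := colon_annihilator w ext.
have e1 := pairing_dim linl linr HL HQ.
have e2 := dim_triple_ideal i.
have e3 := dim_shift ijN Satsub saturation_pair.
have arith (s t u v w x y b a : nat) : (s + t = u + v -> w + v = x + s -> t + y = a + b ->
  a + w + b = y + x + u)%N by lia.
exact: arith e1 e2 e3.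
Qed.

(** For i >= N the left radical of the same pairing shrinks to G_N, so that J_(D+i) / G_(D+i) has
    reached its stable dimension. *)
Lemma linkage_dim_large i : (N <= i)%N ->
  (\dim (gp J (D + i)) + \dim (gp G N) = \dim (gp G (D + i)) + \dim (gp Sat N))%N.
Proof.
move=> Ni; have [Phi ext] := residue_functional i.
have [linl linr] := pairing_linear ext.
have [_ PhiX PhiG] := ext.
have HL (u : H N) : u \in gp G N <-> u \in gp Sat N /\
    forall w : H i, w \in fullv -> Phi ((u : S) * (w : S)) = 0.
  rewrite (mem_graded _ Gsub); split=> [Gu|[Su Hu]].
    split; first by apply/(mem_graded _ Satsub); exact: saturation_pair.
    move=> w _; apply: PhiG; last by rewrite mulrC; exact: pair_ideal_mull.
    by rewrite addnC; apply: dhomogM; exact: dhomog_is_dhomog.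
  apply: (residue_nondegenerate Ni ext); first exact: dhomog_is_dhomog.
  by move=> w wh; apply: (Hu (DHomog wh)); exact: memvf.
have HQ (w : H i) := colon_annihilator w ext.
have e1 := pairing_dim linl linr HL HQ.
have e2 := dim_triple_ideal i.
have arith (s t u v w x : nat) : (s + t = u + v -> w + v = x + s -> w + t = x + u)%N by lia.
exact: arith e1 e2.
Qed.

(** From degree N on every form is z^m times one of degree N modulo G, and membership in the
    saturation passes through z^m. *)
Lemma saturation_dim_large m : (\dim (gp Sat (m + N)) + \dim (gp G N) =
  \dim (gp G (m + N)) + \dim (gp Sat N))%N.
Proof.
have := dim_shift (erefl (m + N)%N) Satsub saturation_pair.
set f := mul_homog _ _ _.
have fE (p : H N) : f p = z ^+ m * p :> S := mul_homogE p (dhomogXn K i0 m) erefl.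
suff -> : (f @: gp Sat N + gp G (m + N))%VS = gp Sat (m + N).
  by move=> ->; exact: addnC.
apply/vspaceP => u; apply/memv_addP/idP.
  move=> [_ /memv_imgP[p /(mem_graded _ Satsub) Sp ->]].
  move=> [g /(mem_graded _ Gsub) Gg ->]; apply/(mem_graded _ Satsub).
  rewrite raddfD /= fE; apply: (submodD Satsub); last exact: saturation_pair.
  exact: saturation_mull.
move=> /(mem_graded _ Satsub) Su.
have uh : (u : S) \is (m + N).-homog by exact: dhomog_is_dhomog.
have [q [g [qh gh Gg uE]]] := G_large uh.
exists (f (DHomog qh)).
  apply/memv_img/(mem_graded _ Satsub); apply: (saturation_X0n_inv (m := m) qh).
  have -> : z ^+ m * q = (u : S) - g by rewrite uE addrK.
  by apply: (submodB Satsub) => //; exact: saturation_pair.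
exists (DHomog gh); first exact/(mem_graded _ Gsub).
by apply/dhomog_inj; rewrite raddfD /= fE.
Qed.

End Linkage.

(** * The saturation defect in terms of dimensions of J *)

Section LinkageFormula.
Variable K : fieldType.
Local Notation S := {mpoly K[3]}.
Local Notation H := (dhomog 3 K).
Local Notation gp := graded_piece.
Implicit Types (p q a b c : S) (J : set S).

Definition saturation_defect J (j : int) : nat :=
  if j is Posz k then (\dim (gp (saturation J) k) - \dim (gp J k))%N else 0%N.

(* The dimension of J_(D+k) modulo the ideal of a regular sequence of two forms of
   degree D; 0 for k < 0. *)
Definition excess D J (k : int) : int :=
  if k is Posz k' then (\dim (gp J (D + k')))%:Z - 2 * ('C(k'.+2, 2))%:Z
    + (if (D <= k')%N then ('C((k' - D).+2, 2))%:Z else 0) else 0.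

Variables (D : nat) (g1 g2 g3 : S).
Hypotheses (D_gt0 : (0 < D)%N) (g1h : g1 \is D.-homog) (g2h : g2 \is D.-homog).
Hypothesis (g3h : g3 \is D.-homog).
Hypothesis size_g1 : size (restrict g1) = D.+1.
Hypothesis co_g12 : coprimep (restrict g1) (restrict g2).
Local Notation G := (pair_ideal g1 g2).
Local Notation J := (triple_ideal g1 g2 g3).
Local Notation N := (D.*2.-2).

Let g1_neq0 : g1 != 0.
Proof.
by apply: contra_eq_neq size_g1 => ->; rewrite rmorph0 size_poly0.
Qed.

Let g2_neq0 : g2 != 0.
Proof.
apply: contraTneq co_g12 => ->; rewrite rmorph0 coprimep0.
by apply/negP => /eqp_size; rewrite size_g1 size_poly1; case: D D_gt0.
Qed.

(** G_(D+k) is the sum of g1 S_k and g2 S_k, whose intersection is g1 g2 S_(k-D) because all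
    relations are Koszul. *)
Lemma dim_pair_ideal k : (\dim (gp G (D + k)) +
  (if D <= k then \dim {: H (k - D)} else 0) = (\dim {: H k}).*2)%N.
Proof.
pose m1 := mul_homog g1 k (D + k); pose m2 := mul_homog g2 k (D + k).
have m1E (p : H k) : m1 p = g1 * p :> S := mul_homogE p g1h erefl.
have m2E (p : H k) : m2 p = g2 * p :> S := mul_homogE p g2h erefl.
have dimm (g : S) (gh : g \is D.-homog) : g != 0 -> \dim (limg (mul_homog g k (D + k))) = \dim {: H k}.
  by move=> g0; rewrite (dim_mul_homog _ g0 gh).
have Gsub := pair_ideal_submod g1 g2.
have -> : gp G (D + k) = (limg m1 + limg m2)%VS.
  apply/vspaceP => u; apply/idP/memv_addP.
    move=> /(mem_graded _ Gsub) Gu.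
    have uh : (u : S) \is (D + k).-homog by exact: dhomog_is_dhomog.
    have [a [b]] := pair_ideal_homog g1h g2h uh Gu; rewrite addKn => -[ah bh _ uE].
    exists (m1 (DHomog ah)); first exact/memv_img/memvf.
    exists (m2 (DHomog bh)); first exact/memv_img/memvf.
    by apply/dhomog_inj; rewrite raddfD /= m1E m2E uE /= (mulrC a) (mulrC b).
  move=> [_ /memv_imgP[a _ ->] [_ /memv_imgP[b _ ->] ->]].
  apply/(mem_graded _ Gsub); rewrite raddfD /= m1E m2E; exists (a : S), (b : S).
  by rewrite mulrC [(b : S) * _]mulrC.
have := dimv_sum_cap (limg m1) (limg m2); rewrite !dimm // addnn => <-.
congr (_ + _)%N; case: leqP => [kD|kD].
  pose m := mul_homog (g1 * g2) (k - D) (D + k).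
  have g12h : g1 * g2 \is (D + D).-homog by exact: dhomogM.
  have DDk : (D + D + (k - D))%N = (D + k)%N by lia.
  have mE (p : H (k - D)) : m p = g1 * g2 * p :> S := mul_homogE p g12h DDk.
  have <- : \dim (limg m) = \dim {: H (k - D)}.
    exact: (dim_mul_homog _ (mulf_neq0 g1_neq0 g2_neq0) g12h DDk).
  congr (\dim _); apply/vspaceP => u; apply/memv_imgP/memv_capP.
    move=> [c _ ->]; have ch : (c : S) \is (k - D).-homog by exact: dhomog_is_dhomog.
    have cgh g : g \is D.-homog -> g * (c : S) \is k.-homog.
      by move=> /dhomogM/(_ ch); rewrite subnKC.
    split; apply/memv_imgP.
      by exists (DHomog (cgh _ g2h)); rewrite ?memvf //; apply/dhomog_inj; rewrite m1E mE mulrA.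
    exists (DHomog (cgh _ g1h)); rewrite ?memvf //; apply/dhomog_inj.
    by rewrite m2E mE /= mulrCA mulrA.
  move=> [/memv_imgP[a _ ->] /memv_imgP[b _ /(congr1 (@mpoly_of_dhomog 3 K (D + k)))]].
  rewrite m1E m2E => ab.
  have [ah bh] : (a : S) \is k.-homog /\ - (b : S) \is k.-homog.
    by rewrite rpredN; split; exact: dhomog_is_dhomog.
  have [|c [ch _ aE _]] := pair_syzygy D_gt0 g1h g2h size_g1 co_g12 ah bh.
    by rewrite mulrC ab; ring.
  exists (DHomog ch); rewrite ?memvf //; apply/dhomog_inj.
  by rewrite m1E mE aE /=; ring.
rewrite (_ : (limg m1 :&: limg m2)%VS = 0%VS) ?dimv0 //.
apply/eqP; rewrite -subv0; apply/subvP => u /memv_capP.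
move=> [/memv_imgP[a _ ->] /memv_imgP[b _ /(congr1 (@mpoly_of_dhomog 3 K (D + k)))]].
rewrite m1E m2E => ab.
have [ah bh] : (a : S) \is k.-homog /\ - (b : S) \is k.-homog.
  by rewrite rpredN; split; exact: dhomog_is_dhomog.
have [|c [ch c0 aE _]] := pair_syzygy D_gt0 g1h g2h size_g1 co_g12 ah bh.
  by rewrite mulrC ab; ring.
rewrite memv0; apply/eqP/dhomog_inj; rewrite m1E aE c0 //=.
by rewrite mul0r mulr0.
Qed.

Lemma excessE (k : nat) :
  excess D J k = (\dim (gp J (D + k)))%:Z - (\dim (gp G (D + k)))%:Z.
Proof.
have := dim_pair_ideal k; rewrite /excess !dim_dhomog.
by case: leqP; lia.
Qed.

Lemma graded_triple_small k : (k < D)%N -> gp J k = 0%VS /\ gp G k = 0%VS.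
Proof.
move=> kD; split; apply/eqP; rewrite -subv0; apply/subvP => u; rewrite memv0.
  have uh : (u : S) \is k.-homog by exact: dhomog_is_dhomog.
  move=> /(mem_graded _ (triple_ideal_submod g1 g2 g3))[a [b [c uE]]].
  apply/eqP/dhomog_inj; rewrite -(pihomog_dE uh) uE !linearD /=.
  rewrite (pihomogM _ _ g1h) (pihomogM _ _ g2h) (pihomogM _ _ g3h).
  by rewrite leqNgt kD !addr0.
have uh : (u : S) \is k.-homog by exact: dhomog_is_dhomog.
move=> /(mem_graded _ (pair_ideal_submod g1 g2))[a [b uE]].
apply/eqP/dhomog_inj; rewrite -(pihomog_dE uh) uE !linearD /=.
rewrite (pihomogM _ _ g1h) (pihomogM _ _ g2h).
by rewrite leqNgt kD !addr0.
Qed.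

Theorem linkage_formula : exists R : int, forall j : int,
  (saturation_defect J j)%:Z =
    R - excess D J (2 * D%:Z - 3 - j) - excess D J (j - D%:Z).
Proof.
have [[A B] /= bezout] := Bezout_eq1_coprimepP _ _ co_g12.
exists ((\dim (gp (saturation J) N))%:Z - (\dim (gp G N))%:Z).
have large i : (N <= i)%N -> excess D J i =
    (\dim (gp (saturation J) N))%:Z - (\dim (gp G N))%:Z.
  move=> Ni; rewrite excessE.
  have := linkage_dim_large D_gt0 g1h g2h g3h size_g1 co_g12 bezout Ni; lia.
(* In negative degrees the formula reads 0 = R - R - 0, since 2D - 3 - j >= N. *)
case=> j; last first.
  have -> : 2 * D%:Z - 3 - Negz j = Posz (N + j)%N by rewrite NegzE; lia.
  rewrite large ?leq_addr // (_ : Negz j - D%:Z = Negz (j + D)); last by rewrite !NegzE; lia.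
  by rewrite /= subrr.
have Jsub := triple_ideal_submod g1 g2 g3.
have Ssub := saturation_triple_submod g1 g2 g3.
have JS : (\dim (gp J j) <= \dim (gp (saturation J) j))%N.
  apply/dimvS/subvP => u /(mem_graded _ Jsub) Ju; apply/(mem_graded _ Ssub).
  exact: triple_ideal_sat.
have e2 : excess D J (j%:Z - D%:Z) = (\dim (gp J j))%:Z - (\dim (gp G j))%:Z.
  have [jD|Dj] := ltnP j D.
    have -> : j%:Z - D%:Z = Negz (D - j.+1) by rewrite NegzE; lia.
    by have [-> ->] := graded_triple_small jD; rewrite !dimv0.
  have -> : j%:Z - D%:Z = Posz (j - D)%N by lia.
  by rewrite excessE subnKC.
(* Below degree N use [linkage_dim] with i = N - 1 - j; from N on the index 2D - 3 - j is negative
   and Sat_j / G_j has the stable dimension R. *)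
have e1 : (\dim (gp (saturation J) j))%:Z - (\dim (gp G j))%:Z =
    (\dim (gp (saturation J) N))%:Z - (\dim (gp G N))%:Z - excess D J (2 * D%:Z - 3 - j%:Z).
  have [jN|Nj] := ltnP j N.
    have -> : 2 * D%:Z - 3 - j%:Z = Posz (N - j.+1)%N by lia.
    rewrite excessE.
    have ijN : ((N - j.+1).+1 + j = N)%N by lia.
    have := linkage_dim D_gt0 g1h g2h g3h size_g1 co_g12 bezout ijN; lia.
  have -> : 2 * D%:Z - 3 - j%:Z = Negz (j - N) by rewrite NegzE; lia.
  rewrite /= subr0.
  have := saturation_dim_large g3 D_gt0 g1h g2h size_g1 co_g12 (j - N).
  by rewrite subnK //; lia.
rewrite e2 /saturation_defect -subzn // -e1; lia.
Qed.

End LinkageFormula.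

(** * Generic coordinates *)

Section LinearSubstitution.
Variable K : fieldType.
Local Notation S := {mpoly K[3]}.
Local Notation H := (dhomog 3 K).
Local Notation gp := graded_piece.
Implicit Types (p q : S) (J : set S) (M : 'M[K]_3).

Definition lsubst M : S -> S :=
  mmap (@mpolyC 3 K) (fun i : 'I_3 => \sum_(j < 3) M i j *: 'X_j).
HB.instance Definition _ M := GRing.RMorphism.on (lsubst M).

Lemma lsubstC M c : lsubst M c%:MP = c%:MP.
Proof. exact: mmapC. Qed.

Lemma lsubstX M i : lsubst M 'X_i = \sum_(j < 3) M i j *: 'X_j.
Proof. by rewrite /lsubst mmapX mmap1U. Qed.

Lemma lsubstZ M c p : lsubst M (c *: p) = c *: lsubst M p.
Proof. by rewrite -!mul_mpolyC rmorphM /= lsubstC. Qed.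

Lemma lsubst_linear M : linear (lsubst M).
Proof. by move=> c p q; rewrite rmorphD /= lsubstZ. Qed.

Lemma lsubst_comp M1 M2 p : lsubst M2 (lsubst M1 p) = lsubst (M1 *m M2) p.
Proof.
apply: (mpoly_morph_eq (phi := lsubst M2 \o lsubst M1)) => [c|i] /=.
  by rewrite !lsubstC.
rewrite !lsubstX rmorph_sum /=.
rewrite (eq_bigr (fun j => \sum_(k < 3) (M1 i j * M2 j k) *: 'X_k)) => [|j _]; last first.
  by rewrite lsubstZ lsubstX scaler_sumr; apply: eq_bigr => k _; rewrite scalerA.
by rewrite exchange_big; apply: eq_bigr => k _; rewrite mxE scaler_suml.
Qed.

Lemma lsubst1 p : lsubst 1%:M p = p.
Proof.
apply: (mpoly_morph_eq (phi := lsubst 1%:M) (psi := idfun)) => [c|i] /=.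
  exact: lsubstC.
rewrite lsubstX (bigD1 i) //= mxE eqxx scale1r big1 ?addr0 // => j ji.
by rewrite mxE eq_sym (negPf ji) scale0r.
Qed.

Lemma lsubstK M : M \in unitmx -> cancel (lsubst M) (lsubst (invmx M)).
Proof. by move=> Mu p; rewrite lsubst_comp mulmxV // lsubst1. Qed.

Lemma lsubstVK M : M \in unitmx -> cancel (lsubst (invmx M)) (lsubst M).
Proof. by move=> Mu p; rewrite lsubst_comp mulVmx // lsubst1. Qed.

Lemma lsubst_homog M k p : p \is k.-homog -> lsubst M p \is k.-homog.
Proof.
move=> ph; rewrite [p]mpolyE rmorph_sum big_seq; apply: rpred_sum => m mp.
rewrite /= lsubstZ; apply: rpredZ; rewrite mpolyXE_id rmorph_prod big_ord3.
have l i : lsubst M 'X_i \is 1.-homog.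
  by rewrite lsubstX; apply: rpred_sum => j _; apply: rpredZ; exact: dhomogXU.
have lm i : lsubst M ('X_i ^+ m i) \is (m i).-homog.
  by rewrite rmorphXn; have := dhomogMn (m i) (l i); rewrite mul1n.
have := dhomog_mf ph mp; rewrite /= mdeg3 => <-.
by apply: dhomogM => //; apply: dhomogM.
Qed.

Lemma saturation_lsubst M J J' : M \in unitmx ->
    (forall p, J' p <-> J (lsubst (invmx M) p)) ->
  forall p, saturation J' p <-> saturation J (lsubst (invmx M) p).
Proof.
move=> Mu JJ p; split=> -[k Hk]; exists k => q qh.
  have := Hk (lsubst M q) (lsubst_homog M qh).
  by rewrite JJ rmorphM /= lsubstK.
by rewrite JJ rmorphM /=; apply: Hk; exact: lsubst_homog.
Qed.

Lemma dim_lsubst M J J' k : M \in unitmx -> submod J -> submod J' ->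
  (forall p, J' p <-> J (lsubst (invmx M) p)) -> \dim (gp J' k) = \dim (gp J k).
Proof.
move=> Mu Jsub J'sub JJ.
pose h (p : H k) : H k := DHomog (lsubst_homog M (dhomog_is_dhomog p)).
have hlin : linear h.
  by move=> a u v; apply/dhomog_inj; exact: lsubst_linear.
pose f := linfun (HB.pack h (GRing.isLinear.Build K (H k) (H k) _ h hlin) : {linear H k -> H k}).
have fE (p : H k) : f p = h p by rewrite lfunE.
have f0 : lker f == 0%VS.
  by apply/lker0P => u v; rewrite !fE => /(congr1 (@mpoly_of_dhomog 3 K k)) /= /(can_inj (lsubstK Mu))/dhomog_inj.
rewrite -(limg_dim_eq (f := f) (U := gp J k)); last by rewrite (eqP f0) capv0.
congr (\dim _); apply/vspaceP => u; apply/idP/memv_imgP.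
  move=> /(mem_graded _ J'sub)/JJ Ju.
  have uh : (u : S) \is k.-homog by exact: dhomog_is_dhomog.
  exists (DHomog (lsubst_homog (invmx M) uh)); first exact/(mem_graded _ Jsub).
  by rewrite fE; apply/dhomog_inj; rewrite /= lsubstVK.
move=> [p /(mem_graded _ Jsub) Jp ->]; apply/(mem_graded _ J'sub)/JJ.
by rewrite fE /= lsubstK.
Qed.

Lemma deriv_morph (psi : {rmorphism S -> {poly K}}) : (forall c, psi c%:MP = c%:P) ->
  forall p, (psi p)^`() = \sum_(i < 3) (psi 'X_i)^`() * psi (p^`M(i)).
Proof.
move=> psiC; pose P p := (psi p)^`() = \sum_(i < 3) (psi 'X_i)^`() * psi (p^`M(i)).
have PD p q : P p -> P q -> P (p + q).
  rewrite /P rmorphD derivD => -> ->; rewrite -big_split; apply: eq_bigr => i _ /=.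
  by rewrite mderivD rmorphD mulrDr.
have PM p q : P p -> P q -> P (p * q).
  rewrite /P rmorphM derivM => -> ->; rewrite mulr_suml mulr_sumr -big_split.
  by apply: eq_bigr => i _ /=; rewrite mderivM rmorphD !rmorphM /=; ring.
have PC c : P c%:MP.
  by rewrite /P psiC derivC big1 // => i _; rewrite mderivC rmorph0 mulr0.
have PX i : P 'X_i.
  rewrite /P (bigD1 i) //= mderivX mnm1E eqxx scale1r.
  rewrite (_ : (U_(i) - U_(i))%MM = 0%MM) ?mpolyX0 ?rmorph1 ?mulr1; last first.
    by apply/mnmP => j; rewrite mnmBE subnn mnm0E.
  rewrite big1 ?addr0 // => j ji.
  by rewrite mderivX mnm1E eq_sym (negPf ji) scale0r rmorph0 mulr0.
move=> p; rewrite -/(P p) [p]mpolyE; elim/big_ind: _ => [||m _].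
- by rewrite -mpolyC0.
- exact: PD.
rewrite -mul_mpolyC; apply: (PM) => //; rewrite mpolyXE_id.
elim/big_ind: _ => [||i _]; [by rewrite -mpolyC1|exact: (PM)|].
elim: (m i) => [|k IH]; first by rewrite expr0 -mpolyC1.
by rewrite exprS; exact: PM.
Qed.

Lemma euler_homog d p : p \is d.-homog -> \sum_(i < 3) 'X_i * p^`M(i) = p *+ d.
Proof.
move=> ph; rewrite {1 2}[p]mpolyE.
rewrite (eq_bigr (fun i => \sum_(m <- msupp p) ((m i)%:R * p@_m) *: 'X_[m])) => [|i _].
  rewrite exchange_big -sumrMnl /= !big_seq; apply: eq_bigr => m mp.
  rewrite -scaler_suml -mulr_suml -natr_sum -mdegE (dhomog_mf ph mp).
  by rewrite mulr_natl scalerMnl.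
rewrite linear_sum mulr_sumr; apply: eq_bigr => m _.
rewrite linearZ /= mderivX scalerA mulrC -scalerAl [p@_m * _]mulrC.
have [m0|m0] := posnP (m i); first by rewrite m0 mul0r !scale0r.
have le : (U_(i) <= m)%MM.
  by apply/mnm_lepP => j; rewrite mnm1E; case: eqP => // <-.
by rewrite -mpolyXD submK.
Qed.

End LinearSubstitution.

Section GoodCoordinates.
Variable K : numFieldType.
Local Notation S := {mpoly K[3]}.
Implicit Types (M : 'M[K]_3).

Lemma poly_nonroot (p : {poly K}) : p != 0 -> exists x, p.[x] != 0.
Proof.
move=> p0; apply: contrapT => no.
pose rs := [seq (i%:R : K) | i <- iota 0 (size p)].
have rsu : uniq rs.
  by rewrite map_inj_uniq ?iota_uniq // => i j /eqP; rewrite eqr_nat => /eqP.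
have rsr : all (root p) rs.
  apply/allP => x _; apply/rootP/eqP; apply: contrapT => /negP px.
  by apply: no; exists x.
by have := max_poly_roots p0 rsr rsu; rewrite size_map size_iota ltnn.
Qed.

Lemma meval_muni n (p : {mpoly K[n.+1]}) (v : 'I_n -> K) (w : 'I_n.+1 -> K) :
    (forall i, w (widen_ord (leqnSn n) i) = v i) ->
  p.@[w] = (map_poly (meval v) (muni p)).[w ord_max].
Proof.
move=> wv; pose psi : {rmorphism {mpoly K[n.+1]} -> K} :=
  horner_eval (w ord_max) \o (map_poly (meval v) \o (@muni n K)).
apply: (mpoly_morph_eq (phi := meval w) (psi := psi)) => [c|i] /=.
  by rewrite mevalC muniC /horner_eval map_polyC /= mevalC hornerC.
rewrite mevalXU /horner_eval; have [j ->|->] := unliftP ord_max i.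
  rewrite (_ : lift ord_max j = widen_ord (leqnSn n) j); last first.
    by apply/val_inj; rewrite /= /bump leqNgt ltn_ord.
  by rewrite muniXwiden map_polyC /= mevalXU hornerC wv.
by rewrite muniXmax map_polyX hornerX.
Qed.

Lemma mpoly_nonroot n (p : {mpoly K[n]}) : p != 0 -> exists v, p.@[v] != 0.
Proof.
elim: n p => [|n IH] p p0.
  exists (fun=> 0); move: p0; rewrite (nvar0_mpolyC p) mevalC.
  by rewrite mpolyC_eq0.
have F0 : muni p != 0 by apply: contra p0 => /eqP F0; rewrite -(muniK p) F0 rmorph0.
have [|v vF] := IH (lead_coef (muni p)); first by rewrite lead_coef_eq0.
have [|x xF] := @poly_nonroot (map_poly (meval v) (muni p)).
  apply: contra vF => /eqP /polyP /(_ (size (muni p)).-1).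
  by rewrite coef_map coef0 /= -/(lead_coef _) => ->.
pose w (i : 'I_n.+1) := if unlift ord_max i is Some j then v j else x.
exists w; rewrite (@meval_muni _ _ v) /w ?unlift_none // => i.
rewrite (_ : widen_ord _ i = lift ord_max i) ?liftK //.
by apply/val_inj; rewrite /= /bump leqNgt ltn_ord.
Qed.

(* the columns are e_1, e_2, o *)
Definition basis_last (o : 'I_3 -> K) : 'M[K]_3 :=
  \matrix_(i, j) (if j == i2 then o i else (i == if j == i0 then i1 else i2)%:R).

Lemma forall_ord3 (P : 'I_3 -> Prop) : P i0 -> P i1 -> P i2 -> forall i, P i.
Proof.
move=> P0 P1 P2 [[|[|[|//]]] lt].
- by rewrite (_ : Ordinal lt = i0) //; apply/val_inj.
- by rewrite (_ : Ordinal lt = i1) //; apply/val_inj.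
- by rewrite (_ : Ordinal lt = i2) //; apply/val_inj.
Qed.

Lemma basis_last_unit o : o i0 != 0 -> basis_last o \in unitmx.
Proof.
move=> o0; pose B : 'M[K]_3 := \matrix_(i, j)
  (if i == i2 then (j == i0)%:R / o i0
   else (j == if i == i0 then i1 else i2)%:R - (j == i0)%:R * o (if i == i0 then i1 else i2) / o i0).
suff /mulmx1_unit[] : B *m basis_last o = 1%:M by [].
apply/matrixP; apply: forall_ord3; apply: forall_ord3; rewrite !mxE big_ord3 !mxE /=; field => //.
Qed.

Lemma ord_max3 : ord_max = i2 :> 'I_3.
Proof. exact: val_inj. Qed.

(** The value at (0, 0, 1) is the coefficient of x_2^d. A constant leading coefficient guarantees
    that specializing x_0 and x_1 keeps the degree d. *)
Lemma muni_monic d (f : S) : f \is d.-homog -> f.@[fun i => (i == i2)%:R] != 0 ->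
  size (muni f) = d.+1 /\ lead_coef (muni f) = (f.@[fun i => (i == i2)%:R])%:MP.
Proof.
set c := f.@[_] => fh c0; have szF : (size (muni f) <= d.+1)%N.
  rewrite muniE big_seq; apply: (big_ind (fun p : {poly _} => (size p <= d.+1)%N)).
  - by rewrite size_poly0.
  - by move=> p q pd qd; apply: leq_trans (size_polyD _ _) _; rewrite geq_max pd.
  move=> m mf; apply: leq_trans (size_scale_leq _ _) _; rewrite size_polyXn ltnS.
  by have := dhomog_mf fh mf; rewrite /= mdeg3 ord_max3; lia.
have Fd : (muni f)`_d = c%:MP.
  rewrite muniE coef_sum /c mevalE rmorph_sum /= !big_seq; apply: eq_bigr => m mf.
  rewrite coefZ coefXn ord_max3 rmorphM /= big_ord3 /= expr1n mulr1.
  have := dhomog_mf fh mf; rewrite /= mdeg3 => md; case: eqP => dm.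
    have [m0 m1] : m i0 = 0%N /\ m i1 = 0%N by lia.
    rewrite m0 m1 !expr0 !mulr1 (_ : [multinom _ | i < 2] = 0%MM) ?mpolyX0 -?mul_mpolyC ?mulr1 //.
    apply/mnmP => i; rewrite mnmE mnm0E; case: i => [[|[|//]] lt].
      by rewrite (_ : widen_ord _ _ = i0) //; exact: val_inj.
    by rewrite (_ : widen_ord _ _ = i1) //; exact: val_inj.
  rewrite mulr0; have [m0|m0] : (0 < m i0)%N \/ (0 < m i1)%N by lia.
    by rewrite !expr0n !eqn0Ngt m0 /= mul0r !mulr0.
  by rewrite !expr0n !eqn0Ngt m0 /= !mulr0.
have F1 : size (muni f) = d.+1.
  apply/eqP; rewrite eqn_leq szF ltnNge; apply: contra c0 => /leq_sizeP /(_ d (leqnn _)).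
  by rewrite Fd => /eqP; rewrite mpolyC_eq0.
by split=> //; rewrite /lead_coef F1.
Qed.

Lemma reduced_lsubst M (f : S) : M \in unitmx -> reduced f -> reduced (lsubst M f).
Proof.
move=> Mu [f0 red]; split=> [|g h fE].
  by apply: contra f0 => /eqP f0; rewrite -(lsubstK Mu f) f0 rmorph0.
have /red : f = lsubst (invmx M) g ^+ 2 * lsubst (invmx M) h.
  by rewrite -(lsubstK Mu f) fE rmorphM rmorphXn.
by move=> gu; rewrite -(lsubstVK Mu g); apply: rmorph_unit.
Qed.

(** Two applications of Gauss' lemma turn a square factor over the fraction field of K[x_0, x_1]
    into a square factor of [f], which must be a unit. Square-free gives separable because in
    characteristic 0 nonconstant polynomials have nonzero derivative. *)
Lemma muni_separable (f : S) : reduced f -> separable_poly (muni f).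
Proof.
move=> [f0 red]; have F0 : muni f != 0.
  by apply: contra f0 => /eqP F0; rewrite -(muniK f) F0 rmorph0.
apply/separable_polyP; split; last first.
  move=> u _ u1; have : (u^`())`_(size u).-2 != 0; last first.
    by apply: contraNneq => ->; rewrite coef0.
  rewrite coef_deriv -scaler_nat.
  have -> : (size u).-2.+1 = (size u).-1 by case: (size u) u1 => [|[]].
  rewrite scaler_eq0 negb_or pnatr_eq0 -/(lead_coef u) lead_coef_eq0 -size_poly_gt0.
  by case: (size u) u1 => [|[]].
apply/poly_square_freeP => u u1; apply/negP => /Pdiv.Idomain.dvdpP[[c q] /= c0 E].
have facR := @factorial_mpoly K 2.
have E1 : c *: muni f = u * (u * q) by rewrite E; ring.
have [a [b [u' [w [FE uE uqE a0 b0]]]]] := factorial_strip facR c0 E1.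
have E2 : b *: w = u' * (a *: q) by rewrite -uqE uE -scalerAl scalerAr.
have [a' [b' [u2 [w' [wE u'E _ a'0 _]]]]] := factorial_strip facR b0 E2.
have /red : f = mmultir u2 ^+ 2 * mmultir (a' *: w').
  by rewrite -(muniK f) FE u'E wE -rmorphXn -rmorphM -!scalerAl -scalerAr expr2 mulrA.
move=> mu; have : u2 \is a GRing.unit by rewrite -(mmultirK u2); apply: rmorph_unit.
rewrite poly_unitE => /andP[/eqP su2 _].
by case/eqP: u1; rewrite uE u'E !size_scale.
Qed.

(* A generic line meets the curve in d distinct points. *)
Lemma separable_restriction d (f : S) : (0 < d)%N -> f \is d.-homog -> reduced f ->
  exists2 M, M \in unitmx &
    size (restrict (lsubst M f)) = d.+1 /\ separable_poly (restrict (lsubst M f)).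
Proof.
move=> d0 fh fred; have [f0 _] := fred.
(* A point off the curve, to be moved to (0 : 0 : 1); its nonzero first coordinate makes
   [basis_last o] invertible. *)
have [o] : exists v, (f * 'X_i0).@[v] != 0.
  by apply: mpoly_nonroot; rewrite mulf_neq0 // X0_neq0.
rewrite mevalM mevalXU mulf_eq0 negb_or => /andP[fo oi0].
have M1u := basis_last_unit oi0; set M1 := basis_last o in M1u.
pose f1 := lsubst M1 f.
have f1h : f1 \is d.-homog by exact: lsubst_homog.
have f1e : f1.@[fun i => (i == i2)%:R] != 0.
  rewrite (_ : f1.@[_] = f.@[o]) //.
  apply: (mpoly_morph_eq (phi := meval (fun i : 'I_3 => (i == i2)%:R) \o lsubst M1)
    (psi := meval o)) => [c|i] /=; first by rewrite lsubstC !mevalC.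
  by rewrite lsubstX big_ord3 /= !(mevalD, mevalZ, mevalXU) !mxE /=; ring.
have [szF lcF] := muni_monic f1h f1e.
have := muni_separable (reduced_lsubst M1u fred); rewrite -/f1 separable_poly.unlock.
move=> /Bezout_coprimepP[[u w] /= E].
(* [c] stands in for the discriminant: wherever it does not vanish, the specialized polynomial stays
   coprime to its derivative. *)
have [c c0 cE] : exists2 c : {mpoly K[2]}, c != 0 & u * muni f1 + w * (muni f1)^`() = c%:P.
  have /eqP : size (u * muni f1 + w * (muni f1)^`()) = 1%N by rewrite (eqp_size E) size_poly1.
  by move=> /size_poly1P.
have X0n : ('X_ord0 : {mpoly K[2]}) != 0 by rewrite -msize_poly_eq0 msizeX.
have [v] : exists v, (c * 'X_ord0).@[v] != 0 by apply: mpoly_nonroot; rewrite mulf_neq0.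
rewrite mevalM mevalXU mulf_eq0 negb_or => /andP[cv v0].
(* [M2] will have columns e_1, q, e_2, so that x_0 = 0, x_1 = 1 parametrizes the line (v_0, v_1, X)
   through (0 : 0 : 1), and restricting amounts to evaluating the coefficients of [muni] at v. *)
pose q (i : 'I_3) := if i == i0 then v ord0 else if i == i1 then v (lift ord0 ord0) else 0.
have M2u : basis_last q \in unitmx by apply: basis_last_unit.
pose M2 := xcol i1 i2 (basis_last q).
have M2u' : M2 \in unitmx by rewrite /M2 xcolE unitmx_mul M2u unitmx_perm.
have M2a i : M2 i i1 = q i by rewrite !mxE perm.tpermL.
have M2b i : M2 i i2 = (i == i2)%:R by rewrite !mxE perm.tpermR.
have restr p : restrict (lsubst M2 p) = map_poly (meval v) (muni p).
  apply: (mpoly_morph_eq (phi := @restrict K \o lsubst M2)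
    (psi := map_poly (meval v) \o (@muni 2 K))) => [a|i] /=.
    by rewrite lsubstC restrictC muniC map_polyC /= mevalC.
  rewrite lsubstX big_ord3 !rmorphD /= !restrictZ restrictX0 restrictX1 restrictX2.
  rewrite scaler0 add0r M2a M2b; elim/forall_ord3: i => /=.
  - rewrite /q /= (_ : i0 = widen_ord (leqnSn 2) ord0); last exact: val_inj.
    by rewrite muniXwiden map_polyC /= mevalXU scale0r addr0 alg_polyC.
  - rewrite /q /= (_ : i1 = widen_ord (leqnSn 2) (lift ord0 ord0)); last exact: val_inj.
    by rewrite muniXwiden map_polyC /= mevalXU scale0r addr0 alg_polyC.
  - by rewrite /q /= -ord_max3 muniXmax map_polyX scale0r add0r scale1r.
have FvE : map_poly (meval v) (muni f1) = restrict (lsubst (M1 *m M2) f).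
  by rewrite -lsubst_comp restr.
exists (M1 *m M2); first by rewrite unitmx_mul M1u.
rewrite -FvE; split.
  rewrite size_map_poly_id0 // lcF /= mevalC //.
rewrite deriv_map; apply/Bezout_eq1_coprimepP.
exists ((meval v c)^-1 *: map_poly (meval v) u, (meval v c)^-1 *: map_poly (meval v) w) => /=.
rewrite -!scalerAl -scalerDr -!rmorphM -rmorphD /= cE map_polyC /=.
by rewrite -mul_polyC -polyCM mulVf.
Qed.

Lemma saturation_defect_lsubst M J J' j : M \in unitmx ->
    submod J -> submod J' -> submod (saturation J) -> submod (saturation J') ->
    (forall p, J' p <-> J (lsubst (invmx M) p)) ->
  saturation_defect J' j = saturation_defect J j.
Proof.
move=> Mu sJ sJ' sS sS' JJ; case: j => //= k.
rewrite (dim_lsubst k Mu sJ sJ' JJ).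
by rewrite (dim_lsubst k Mu sS sS' (saturation_lsubst Mu JJ)).
Qed.

Theorem jacobian_linkage D (f : S) : (0 < D)%N -> f \is D.+1.-homog -> reduced f ->
  exists R : int, forall j : int, (jacobian_module_dim f j)%:Z =
    R - excess D (jacobian_ideal f) (2 * D%:Z - 3 - j)
      - excess D (jacobian_ideal f) (j - D%:Z).
Proof.
move=> D0 fh fred; have [M Mu [szF sepF]] := separable_restriction (ltn0Sn D) fh fred.
set F := restrict (lsubst M f) in szF sepF.
(* By the chain rule, the derivative of [lsubst M f] along x_j. *)
pose g j := \sum_(i < 3) M i j *: lsubst M f^`M(i).
have gh j : g j \is D.-homog.
  by apply: rpred_sum => i _; apply/rpredZ/lsubst_homog; exact: (mderiv_homog i fh).
pose psi : {rmorphism S -> {poly K}} := @restrict K \o lsubst M.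
have psiX i : psi 'X_i = (M i i1)%:P + (M i i2) *: 'X.
  rewrite /= lsubstX big_ord3 !rmorphD /= !restrictZ restrictX0 restrictX1 restrictX2.
  by rewrite scaler0 add0r alg_polyC.
have g2E : restrict (g i2) = F^`().
  rewrite -[RHS]/((psi f)^`()) deriv_morph => [|c]; last by rewrite /= lsubstC restrictC.
  rewrite /g rmorph_sum; apply: eq_bigr => i _.
  by rewrite psiX derivD derivC derivZ derivX add0r alg_polyC mul_polyC /= restrictZ.
(* Euler's identity on x_0 = 0, x_1 = 1. It writes F as a combination of the two restrictions, so
   that separability of F makes them coprime. *)
have eulerF : restrict (g i1) + 'X * restrict (g i2) = F *+ D.+1.
  rewrite -rmorphMn -[RHS]/(restrict _) -[lsubst M f *+ _]rmorphMn.
  rewrite -[RHS]/(psi _) -(euler_homog fh) rmorph_sum /g !rmorph_sum mulr_sumr -big_split.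
  apply: eq_bigr => i _; transitivity (psi 'X_i * psi f^`M(i)); last by rewrite -rmorphM.
  by rewrite psiX mulrDl /= !restrictZ -scalerAl mul_polyC scalerAr.
have size_g : size (restrict (g i2)) = D.+1.
  rewrite g2E; apply/eqP; rewrite eqn_leq -ltnS -szF lt_size_deriv /=; last first.
    by rewrite -size_poly_gt0 szF.
  rewrite ltnNge; apply/negP => /leq_sizeP /(_ D (leqnn _)) /eqP.
  rewrite coef_deriv mulrn_eq0 /= -[D.+1]/(D.+2.-1) -szF -/(lead_coef F) lead_coef_eq0.
  by rewrite -size_poly_eq0 szF.
have co_g : coprimep (restrict (g i2)) (restrict (g i1)).
  move: sepF; rewrite separable_poly.unlock => /Bezout_eq1_coprimepP[[u w] /= E].
  apply/Bezout_eq1_coprimepP; pose e : K := D.+1%:R^-1.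
  exists (w + e *: (u * 'X), e *: u); rewrite /= -E g2E.
  have FE : F = e *: (restrict (g i1) + 'X * restrict (g i2)).
    by rewrite eulerF -scaler_nat scalerA mulVf ?scale1r // pnatr_eq0.
  transitivity (u * (e *: (restrict (g i1) + 'X * F^`())) + w * F^`()).
    by rewrite -!mul_polyC; ring.
  by rewrite -g2E -FE g2E.
(* [g i2] comes first because the first form needs a restriction of exact degree D, which F' has. *)
have [R RE] := linkage_formula D0 (gh i2) (gh i1) (gh i0) size_g co_g.
set J' := triple_ideal (g i2) (g i1) (g i0) in RE.
have JJ p : J' p <-> jacobian_ideal f (lsubst (invmx M) p).
  split.
    move=> [a [b [c ->]]]; pose h := fun j => if j == i2 then a else if j == i1 then b else c.
    exists (\row_i (\sum_(j < 3) M i j *: lsubst (invmx M) (h j))).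
    rewrite (_ : _ + _ = \sum_(j < 3) h j * g j); last first.
      by rewrite big_ord3 /h /=; ring.
    rewrite rmorph_sum /jac_comb /=.
    under [RHS]eq_bigr => i _ do rewrite mxE mulr_suml.
    rewrite exchange_big; apply: eq_bigr => j _ /=; rewrite rmorphM /g rmorph_sum mulr_sumr.
    by apply: eq_bigr => i _ /=; rewrite lsubstZ lsubstK // -scalerAr -scalerAl.
  move=> [h E]; have pE : p = \sum_(k < 3) lsubst M (h 0 k) * lsubst M f^`M(k).
    rewrite -[LHS](lsubstVK Mu) E /jac_comb rmorph_sum.
    by apply: eq_bigr => k _; rewrite /= rmorphM.
  have fk k : lsubst M f^`M(k) = \sum_(j < 3) invmx M j k *: g j.
    under eq_bigr => j _ do rewrite /g scaler_sumr.
    rewrite exchange_big (bigD1 k) //= [X in _ + X]big1 => [|i ik].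
      rewrite addr0; have := congr1 (fun A : 'M_3 => A k k) (mulmxV Mu).
      rewrite !mxE eqxx => E1; rewrite -[LHS]scale1r -[1 in LHS]E1 scaler_suml.
      by apply: eq_bigr => j _; rewrite scalerA mulrC.
    have := congr1 (fun A : 'M_3 => A i k) (mulmxV Mu); rewrite !mxE (negPf ik) => E1.
    transitivity ((\sum_j M i j * invmx M j k) *: lsubst M f^`M(i)); last by rewrite E1 scale0r.
    by rewrite scaler_suml; apply: eq_bigr => j _; rewrite scalerA mulrC.
  pose h' j := \sum_(k < 3) invmx M j k *: lsubst M (h 0 k).
  exists (h' i2), (h' i1), (h' i0); rewrite pE.
  rewrite (_ : _ + _ = \sum_(j < 3) h' j * g j); last by rewrite big_ord3 /=; ring.
  under eq_bigr => k _ do rewrite fk mulr_sumr.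
  rewrite exchange_big; apply: eq_bigr => j _; rewrite /h' mulr_suml.
  by apply: eq_bigr => k _; rewrite -scalerAl -scalerAr.
have sJ : submod (jacobian_ideal f) by split; [exact: jacobian_ideal0|exact: jacobian_idealL].
have sSJ : submod (saturation (jacobian_ideal f)).
  by split; [exact/jacobian_sub_saturation/jacobian_ideal0|exact: saturation_jacL].
have sJ' : submod J' by exact: triple_ideal_submod.
have sSJ' : submod (saturation J') by exact: saturation_triple_submod.
have excE k : excess D J' k = excess D (jacobian_ideal f) k.
  by case: k => //= k; rewrite (dim_lsubst _ Mu sJ sJ' JJ).
exists R => j; rewrite -!excE -RE; congr Posz.
by rewrite (saturation_defect_lsubst j Mu sJ sJ' sSJ sSJ' JJ); case: j.
Qed.

End GoodCoordinates.

(** * Syzygies of the partial derivatives *)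

Section PrimitiveVectors.
Variables (R : idomainType).
Implicit Types (u v w : 'I_3 -> R).

Definition primitive_vector u := forall p, prime_element p -> ~ forall i, divides p (u i).

Definition cross u v (i : 'I_3) : R :=
  if i == i0 then u i1 * v i2 - u i2 * v i1
  else if i == i1 then u i2 * v i0 - u i0 * v i2 else u i0 * v i1 - u i1 * v i0.

(** Start from c w = b u with c a nonzero entry of [u]. A prime factor of c divides every b u_i but
    not every u_i, hence divides b; cancelling the primes of c one by one leaves a unit. *)
Lemma primitive_collinear (facR : factorial_ring R) u w : primitive_vector u ->
  (exists i, u i != 0) -> (forall i j, w i * u j = w j * u i) ->
  exists h, forall i, w i = h * u i.
Proof.
move=> pu [j uj0] col.
have main c : c != 0 -> forall b w, (forall i, c * w i = b * u i) ->
    exists h, forall i, w i = h * u i.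
  move: c; apply: (factorial_ind facR) => [c cu b w' E|p c pp c0 IH b w' E].
    by exists (c^-1 * b) => i; rewrite -mulrA -E mulKr.
  have [p0 _ pP] := pp.
  have [b' bE] : divides p b.
    apply: contrapT => pb; apply: (pu _ pp) => i.
    have /pP[] // : divides p (b * u i).
    by exists (c * w' i); rewrite -E; ring.
  apply: (IH b') => i; apply: (mulfI p0); rewrite mulrA E bE; ring.
by apply: (main _ uj0 (w j)) => i; rewrite mulrC col.
Qed.

Lemma cross_eq0 u w : (forall i, cross u w i = 0) -> forall i j, w i * u j = w j * u i.
Proof.
move=> c0; have := c0 i0; have := c0 i1; have := c0 i2; rewrite /cross /=.
move=> /eqP; rewrite subr_eq0 => /eqP e2 /eqP; rewrite subr_eq0 => /eqP e1 /eqP.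
rewrite subr_eq0 => /eqP e0.
apply: forall_ord3; apply: forall_ord3 => //; rewrite ?(mulrC (w _)) //.
Qed.

(** Triple product identity: (u x v) x g = v (u . g) - u (v . g). *)
Lemma cross_orthogonal (g u v : 'I_3 -> R) : \sum_(i < 3) u i * g i = 0 ->
  \sum_(i < 3) v i * g i = 0 -> forall i j, cross u v i * g j = cross u v j * g i.
Proof.
rewrite !big_ord3 => eu ev.
have E i : cross (cross u v) g i =
    v i * (u i0 * g i0 + (u i1 * g i1 + u i2 * g i2))
  - u i * (v i0 * g i0 + (v i1 * g i1 + v i2 * g i2)).
  by move: i; apply: forall_ord3; rewrite /cross /=; ring.
have E0 i : cross (cross u v) g i = 0.
  by rewrite E [X in _ * X - _]eu [X in _ - _ * X]ev !mulr0 subrr.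
by move=> i j; rewrite mulrC -(cross_eq0 E0) mulrC.
Qed.

End PrimitiveVectors.

(** * The gradient of a reduced form *)

Section Gradient.
Variable K : numFieldType.
Local Notation S := {mpoly K[3]}.
Implicit Types (p q f : S).

Lemma msize_mderiv n (p : {mpoly K[n]}) i : (msize p^`M(i) <= (msize p).-1)%N.
Proof.
rewrite [X in (X <= _)%N]msizeE big_seq; elim/big_ind: _ => // [a b Ha Hb|m].
  by rewrite geq_max Ha.
rewrite mcoeff_msupp mcoeff_deriv => H.
have : (m + U_(i))%MM \in msupp p.
  by rewrite mcoeff_msupp; apply: contraNneq H => ->; rewrite mul0rn.
by move=> /msize_mdeg_lt; rewrite mdegD mdeg1 addn1; case: (msize p).
Qed.

Lemma mderiv_eq0_const n (p : {mpoly K[n]}) : (forall i, p^`M(i) = 0) -> (msize p <= 1)%N.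
Proof.
move=> p0; rewrite msizeE big_seq; elim/big_ind: _ => // [a b Ha Hb|m mp].
  by rewrite geq_max Ha.
suff -> : m = 0%MM by rewrite mdeg0.
apply/mnmP => i; rewrite mnm0E; apply/eqP; apply: contraTT mp => mi.
have le : (U_(i) <= m)%MM.
  by apply/mnm_lepP => j; rewrite mnm1E; case: eqP => // <-; rewrite lt0n.
have := congr1 (mcoeff (m - U_(i))) (p0 i); rewrite mcoeff_deriv mcoeff0 submK //.
by move=> /eqP; rewrite mulrn_eq0 /= mcoeff_msupp negbK.
Qed.

Lemma prime_msize n (p : {mpoly K[n]}) : prime_element p -> (1 < msize p)%N.
Proof.
move=> [p0 pu _]; move: pu; rewrite mpoly_unitE.
by have := msize_poly_eq0 p; rewrite (negPf p0); case: (msize p) => [|[]].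
Qed.

Lemma msize_divides n (p q : {mpoly K[n]}) : q != 0 -> divides p q -> (msize p <= msize q)%N.
Proof.
move=> q0 [c qE]; move: q0; rewrite qE mulf_eq0 negb_or => /andP[c0 p0].
rewrite msizeM //; move: c0; rewrite -msize_poly_eq0.
by case: (msize c) => // k _; rewrite addSn /= leq_addl.
Qed.

Variables (D : nat) (f : S).
Hypotheses (fh : f \is D.+1.-homog) (fred : reduced f).

Definition grad i : S := f^`M(i).

Lemma grad_homog i : grad i \is D.-homog.
Proof. exact: (mderiv_homog i fh). Qed.

Lemma grad_neq0 : exists i, grad i != 0.
Proof.
apply: contrapT => no; have [f0 _] := fred.
have := euler_homog fh; rewrite big1 => [/eqP|i _].
  by rewrite eq_sym -scaler_nat scaler_eq0 (negPf f0) pnatr_eq0.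
have -> : f^`M(i) = 0 by apply/eqP; apply: contrapT => /negP ?; apply: no; exists i.
by rewrite mulr0.
Qed.

(** By Euler a common prime factor p divides f = h p, and therefore h times each derivative of p. If
    p divides h, then f has a square factor; otherwise p divides its own derivatives, which vanish
    for degree reasons, and p is constant. *)
Lemma grad_primitive : primitive_vector grad.
Proof.
move=> p pp pg; have [p0 pu pP] := pp; have [f0 red] := fred.
have [h fE] : divides p f.
  have -> : f = (D.+1%:R^-1 : K)%:MP * \sum_(i < 3) 'X_i * grad i.
    rewrite (euler_homog fh) -scaler_nat mul_mpolyC scalerA mulVf ?scale1r //.
    by rewrite pnatr_eq0.
  by apply: divides_mull; apply: divides_sum => i _; apply: divides_mull.
have php i : divides p (h * p^`M(i)).
  have -> : h * p^`M(i) = grad i - h^`M(i) * p by rewrite /grad fE mderivM; ring.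
  by apply: dividesB => //; exists h^`M(i).
have [[h' hE]|nph] := pselect (divides p h).
  by move: pu; rewrite (red p h') // fE hE; ring.
have p_const i : p^`M(i) = 0.
  apply/eqP; apply: contrapT => /negP pi0.
  have /pP[//|/(msize_divides pi0) le] := php i.
  have := leq_trans le (msize_mderiv p i); have := prime_msize pp.
  by case: (msize p) => // k _; rewrite ltnn.
by have := prime_msize pp; rewrite ltnNge mderiv_eq0_const.
Qed.

Definition is_syzygy (u : 'I_3 -> S) := \sum_(i < 3) u i * grad i = 0.

Lemma syzygy_cross u v : is_syzygy u -> is_syzygy v ->
  exists h, forall i, cross u v i = h * grad i.
Proof.
move=> su sv; apply: (primitive_collinear (@factorial_mpoly K 3)).
- exact: grad_primitive.
- exact: grad_neq0.
- exact: cross_orthogonal.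
Qed.

Lemma syzygy_pihomog k u : is_syzygy u -> is_syzygy (fun i => pihomog mdeg k (u i)).
Proof.
move=> su; have := congr1 (pihomog mdeg (k + D)) su; rewrite linear_sum linear0 => E.
rewrite /is_syzygy -[RHS]E /=.
by apply: eq_bigr => i _; rewrite (pihomogM _ _ (grad_homog i)) leq_addl addnK.
Qed.

(* Dividing u by a common prime factor would give a syzygy of lower degree. *)
Lemma minimal_syzygy_primitive r u : is_syzygy u -> (forall i, u i \is r.-homog) ->
    (exists i, u i != 0) ->
    (forall l v, is_syzygy v -> (forall i, v i \is l.-homog) -> (exists i, v i != 0) -> (r <= l)%N) ->
  primitive_vector u.
Proof.
move=> su uh [i ui0] min p pp /choice[v uE]; have [p0 _ _] := pp.
have sv : is_syzygy v.
  apply: (mulfI p0); rewrite mulr0 mulr_sumr -[RHS]su; apply: eq_bigr => j _.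
  by rewrite uE; ring.
have vi0 : v i != 0 by apply: contraNneq ui0 => vi0; rewrite uE vi0 mul0r.
have szv : (msize (v i) <= r)%N.
  have := msize_dhomog (uh i); rewrite uE msizeM //; have := prime_msize pp.
  by move: vi0; rewrite -msize_poly_eq0; move: (msize p) (msize (v i)) => a b; lia.
(* [v] need not be homogeneous, so a nonzero component of degree below r is used. *)
have [l lr vl0] : exists2 l, (l < r)%N & pihomog mdeg l (v i) != 0.
  apply: contrapT => no; move: vi0; rewrite (pihomog_partitionE (mf := mdeg) szv).
  rewrite big1 ?eqxx // => l _; apply/eqP; apply: contrapT => /negP vl; apply: no.
  by exists l.
have := min l _ (syzygy_pihomog l sv) (fun j => pihomogP _ _ _) (ex_intro _ i vl0).
by rewrite leqNgt lr.
Qed.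

End Gradient.

(** * Syzygies near the minimal degree and Saito's criterion *)

Section Syzygies.
Variable K : numFieldType.
Local Notation S := {mpoly K[3]}.
Local Notation H := (dhomog 3 K).
Local Notation gp := graded_piece.
Implicit Types (p q h : S) (u v w rho sigma tau : 'I_3 -> S).
Variables (D : nat) (f : S).
Hypotheses (fh : f \is D.+1.-homog) (fred : reduced f).
Local Notation grad := (grad f).
Local Notation syzygy := (is_syzygy f).
Local Notation J := (jacobian_ideal f).

Definition homogv k u := forall i, u i \is k.-homog.
Definition nonzerov u := exists i, u i != 0.

Lemma cross_homog k l u v : homogv k u -> homogv l v -> homogv (k + l) (cross u v).
Proof.
by move=> uh vh i; rewrite /cross; do 2?[case: ifP => _]; rewrite rpredB //; apply: dhomogM.
Qed.

Lemma nonzerov_dec u : nonzerov u \/ forall i, u i = 0.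
Proof.
have [?|no] := pselect (nonzerov u); [by left|right=> i].
by apply/eqP; apply: contrapT => /negP ui; apply: no; exists i.
Qed.

Lemma msize_dhomog_eq k p : p \is k.-homog -> p != 0 -> msize p = k.+1.
Proof.
move=> ph p0; have := dhomog_uniq p0 ph (dhomog_msize ph).
by move: p0; rewrite -msize_poly_eq0; case: (msize p) => // n _ /= ->.
Qed.

Lemma syzygy_parallel rho sigma : primitive_vector rho -> nonzerov rho ->
  (forall i, cross rho sigma i = 0) -> exists h, forall i, sigma i = h * rho i.
Proof.
move=> prho rho0 c0; apply: (primitive_collinear (@factorial_mpoly K 3)) => //.
exact: cross_eq0.
Qed.

(** [msize h] is one more than the degree, so the bound reads deg h + D <= k + l. *)
Lemma cross_degree k l u v h : homogv k u -> homogv l v ->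
  (forall i, cross u v i = h * grad i) -> h != 0 -> (msize h + D <= (k + l).+1)%N.
Proof.
move=> uh vh cE h0; have [i gi0] := grad_neq0 fh fred.
have := msize_dhomog (cross_homog uh vh i); rewrite cE msizeM //.
by rewrite (msize_dhomog_eq (grad_homog fh i)) // addnS.
Qed.

Section MinimalSyzygy.
Variables (r : nat) (rho : 'I_3 -> S).
Hypotheses (srho : syzygy rho) (rhoh : homogv r rho) (rho_neq0 : nonzerov rho).
Hypothesis minr : forall l v, syzygy v -> homogv l v -> nonzerov v -> (r <= l)%N.

Let rho_prim : primitive_vector rho := minimal_syzygy_primitive fh srho rhoh rho_neq0 minr.

Lemma small_syzygy k sigma : (r + k < D)%N -> syzygy sigma -> homogv k sigma ->
  exists h, forall i, sigma i = h * rho i.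
Proof.
move=> rk ss sh; have [h hE] := syzygy_cross fh fred srho ss.
apply: syzygy_parallel => // i; rewrite hE; have [->|h0] := eqVneq h 0; first exact: mul0r.
have := cross_degree rhoh sh hE h0; move: h0; rewrite -msize_poly_eq0.
by move: (msize h) rk => a; lia.
Qed.

End MinimalSyzygy.

(* Saito's criterion for a basis of the module of syzygies *)
Definition saito_pair r s rho sigma :=
  [/\ syzygy rho /\ homogv r rho, syzygy sigma /\ homogv s sigma &
      exists2 c : K, c != 0 & forall i, cross rho sigma i = c%:MP * grad i].

Lemma saito_nonzero r s rho sigma : saito_pair r s rho sigma -> nonzerov rho /\ nonzerov sigma.
Proof.
move=> [_ _ [c c0 cE]]; have [i gi0] := grad_neq0 fh fred.
have : cross rho sigma i != 0 by rewrite cE mulf_neq0 // mpolyC_eq0.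
move=> ci0; split.
  by have [//|u0] := nonzerov_dec rho; move: ci0; rewrite /cross !u0 !mul0r subrr !if_same eqxx.
by have [//|u0] := nonzerov_dec sigma; move: ci0; rewrite /cross !u0 !mulr0 subrr !if_same eqxx.
Qed.

Lemma cross_swap u v i : cross u v i = - cross v u i.
Proof. by move: i; apply: forall_ord3; rewrite /cross /=; ring. Qed.

Lemma saito_sym r s rho sigma : saito_pair r s rho sigma -> saito_pair s r sigma rho.
Proof.
move=> [Hr Hs [c c0 cE]]; split=> //; exists (- c); first by rewrite oppr_eq0.
by move=> i; rewrite cross_swap cE raddfN mulNr.
Qed.

Lemma saito_degree r s rho sigma : saito_pair r s rho sigma -> (r + s = D)%N.
Proof.
move=> [[_ rh] [_ sh] [c c0 cE]]; have [i gi0] := grad_neq0 fh fred.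
have gh := grad_homog fh i; apply: (dhomog_uniq (p := c%:MP * grad i)).
- by rewrite mulf_neq0 // mpolyC_eq0.
- by rewrite -cE; exact: cross_homog.
- by rewrite mul_mpolyC; apply: dhomogZ.
Qed.

Lemma saito_primitive r s rho sigma : saito_pair r s rho sigma -> primitive_vector rho.
Proof.
move=> [_ _ [c c0 cE]] p pp prho; apply: (grad_primitive fh fred pp) => i.
have -> : grad i = (c^-1)%:MP * cross rho sigma i.
  by rewrite cE mulrA -mpolyCM mulVf // mul1r.
apply: divides_mull; rewrite /cross.
by do 2?[case: ifP => _]; apply: dividesB; apply: divides_mulr.
Qed.

Lemma cross_linear u v w a b i :
  cross u (fun j => a * v j + b * w j) i = a * cross u v i + b * cross u w i.
Proof. by move: i; apply: forall_ord3; rewrite /cross /=; ring. Qed.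

Lemma cross_self u i : cross u u i = 0.
Proof. by move: i; apply: forall_ord3; rewrite /cross /=; ring. Qed.

Lemma saito_span r s rho sigma tau : saito_pair r s rho sigma -> syzygy tau ->
  exists a b, forall i, tau i = a * rho i + b * sigma i.
Proof.
move=> spair st; have [[sr rh] [ss sh] [c c0 cE]] := spair.
have [h hE] := syzygy_cross fh fred sr st.
have [rho0 _] := saito_nonzero spair.
(* Chosen so that tau - b sigma has zero cross product with rho; it is then a multiple of the
   primitive vector rho. *)
pose b := (c^-1)%:MP * h.
have [|a aE] := syzygy_parallel (sigma := fun j => 1 * tau j + (- b) * sigma j)
   (saito_primitive spair) rho0.
  move=> i; rewrite cross_linear hE cE /b mul1r.
  transitivity ((1 - c^-1%:MP * c%:MP) * (h * grad i)); first by ring.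
  by rewrite -mpolyCM mulVf // subrr mul0r.
by exists a, b => i; rewrite -aE mul1r; ring.
Qed.

(** The cross product with rho removes the first term and leaves b c grad f = 0; exchanging the two
    vectors handles [a]. *)
Lemma saito_free r s rho sigma a b : saito_pair r s rho sigma ->
  (forall i, a * rho i + b * sigma i = 0) -> a = 0 /\ b = 0.
Proof.
move=> spair E; have main r' s' u v a' b' : saito_pair r' s' u v ->
    (forall i, a' * u i + b' * v i = 0) -> b' = 0.
  move=> [_ _ [c c0 cE]] E'; have [i gi0] := grad_neq0 fh fred.
  have : cross u (fun j => a' * u j + b' * v j) i = 0.
    by rewrite /cross !E' !mulr0 subrr !if_same.
  rewrite cross_linear cross_self mulr0 add0r cE => /eqP; rewrite !mulf_eq0.
  by rewrite mpolyC_eq0 (negPf c0) (negPf gi0) !orbF => /eqP.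
split; last exact: main spair E.
by apply: (main _ _ _ _ b a (saito_sym spair)) => i; rewrite addrC.
Qed.

Lemma saito_is_free r s rho sigma : saito_pair r s rho sigma -> is_free f.
Proof.
move=> spair; have [[sr rh] [ss sh] _] := spair.
pose Bm : 'M[S]_(2, 3) := \matrix_(i, j) (if i == ord0 then rho j else sigma j).
have mulE (c : 'rV[S]_2) j : (c *m Bm) 0 j = c 0 ord0 * rho j + c 0 (lift ord0 ord0) * sigma j.
  by rewrite mxE !big_ord_recl big_ord0 addr0 !mxE.
exists 2, (fun i => if i == ord0 then r else s), Bm; split.
  move=> i; split=> [|j].
    rewrite /AR /= /jac_comb; under eq_bigr => j _ do rewrite !mxE.
    by case: (i == ord0).
  by rewrite !mxE; case: (i == ord0).
move=> tau st; have [a [b abE]] := saito_span spair st.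
pose c : 'rV[S]_2 := \row_i (if i == ord0 then a else b).
exists c; split=> [|c' c'E].
  by apply/rowP => j; rewrite mulE !mxE /= abE.
have [|e1 e2] := @saito_free r s rho sigma (a - c' 0 ord0) (b - c' 0 (lift ord0 ord0)) spair.
  move=> i; have := abE i; rewrite c'E mulE => e.
  rewrite !mulrBl; transitivity ((a * rho i + b * sigma i) -
    (c' 0 ord0 * rho i + c' 0 (lift ord0 ord0) * sigma i)); first by ring.
  by rewrite e subrr.
apply/rowP => i; rewrite mxE; case: (unliftP ord0 i) => [j ->|->] /=.
  by rewrite (ord1 j); apply/eqP; rewrite -subr_eq0 e2.
by apply/eqP; rewrite -subr_eq0 e1.
Qed.

End Syzygies.

(** * A free syzygy module has a Saito pair *)

Section FreeSyzygies.
Variable K : numFieldType.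
Local Notation S := {mpoly K[3]}.
Local Notation H := (dhomog 3 K).
Local Notation gp := graded_piece.
Implicit Types (p q h : S) (u v w rho sigma tau : 'I_3 -> S).
Variables (D : nat) (f : S).
Hypotheses (fh : f \is D.+1.-homog) (fred : reduced f).
Local Notation grad := (grad f).
Local Notation syzygy := (is_syzygy f).
Local Notation J := (jacobian_ideal f).

Lemma eq_cross u u' v v' i : u =1 u' -> v =1 v' -> cross u v i = cross u' v' i.
Proof. by move=> uu vv; rewrite /cross !uu !vv. Qed.

Lemma cross_sum n (B : 'I_n -> 'I_3 -> S) (a b : 'I_n -> S) i :
  cross (fun j => \sum_k a k * B k j) (fun j => \sum_k b k * B k j) i =
  \sum_k \sum_l a k * b l * cross (B k) (B l) i.
Proof.
have dbl (x y : 'I_n -> S) : (\sum_k x k) * (\sum_l y l) = \sum_k \sum_l x k * y l.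
  by rewrite mulr_suml; apply: eq_bigr => k _; rewrite mulr_sumr.
move: i; apply: forall_ord3; rewrite /cross /= !dbl -sumrB; apply: eq_bigr => k _;
  rewrite -sumrB; apply: eq_bigr => l _; ring.
Qed.

(* the components of u (v x w) + v (w x u) + w (u x v) = det(u, v, w) Id *)
Lemma cross_cyclic u v w i j :
  cross v w i * u j + (cross w u i * v j + cross u v i * w j) =
  (i == j)%:R * \sum_(k < 3) cross v w k * u k.
Proof. by rewrite big_ord3; move: i j; apply: forall_ord3; apply: forall_ord3; rewrite /cross /=; ring. Qed.

(** With g = grad f, the cross product of two Koszul syzygies is a multiple of grad f, and
    [grad_from_cross] makes the multiplier any chosen partial derivative. *)
Lemma cross_cross (g a b : 'I_3 -> S) i :
  cross (cross g a) (cross g b) i = (\sum_(j < 3) g j * cross a b j) * g i.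
Proof. by move: i; rewrite big_ord3; apply: forall_ord3; rewrite /cross /=; ring. Qed.

Lemma cross_syzygy u : syzygy (cross grad u).
Proof. by rewrite /is_syzygy big_ord3 /cross /=; ring. Qed.

Lemma grad_from_cross i : exists a b, \sum_(j < 3) grad j * cross a b j = grad i.
Proof.
have E a b : \sum_(j < 3) grad j * cross a b j =
  grad i0 * cross a b i0 + (grad i1 * cross a b i1 + grad i2 * cross a b i2).
  by rewrite big_ord3.
pose e j (k : 'I_3) : S := (k == j)%:R.
move: i; apply: forall_ord3.
- by exists (e i1), (e i2); rewrite E /cross /e /=; ring.
- by exists (e i2), (e i0); rewrite E /cross /e /=; ring.
- by exists (e i0), (e i1); rewrite E /cross /e /=; ring.
Qed.

(** Write B_i x B_j = h_ij grad f for the basis vectors. The h_ij generate the partial derivatives,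
    which are coprime, and freeness leaves room for only two basis vectors, so that the single h_ij
    up to sign is a unit. *)
Lemma free_saito_pair : is_free f -> exists r s rho sigma, saito_pair f r s rho sigma.
Proof.
move=> [m [e [Bm [BAR Bfree]]]]; pose B (i : 'I_m) (j : 'I_3) := Bm i j.
have sB i : syzygy (B i).
  have [+ _] := BAR i; rewrite /AR /= /jac_comb => E0.
  by rewrite /is_syzygy -[RHS]E0; apply: eq_bigr => j _; rewrite mxE.
have hB i : homogv (e i) (B i) by move=> j; have [_ /(_ j)] := BAR i; rewrite mxE.
have span tau : syzygy tau -> exists a : 'I_m -> S, forall j, tau j = \sum_k a k * B k j.
  move=> st; have [|a [aE _]] := Bfree (\row_j tau j).
    by rewrite /AR /= /jac_comb; under eq_bigr => j _ do rewrite mxE.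
  exists (fun k => a 0 k) => j; have := congr1 (fun r : 'rV_3 => r 0 j) aE.
  by rewrite /= mxE => ->; rewrite mxE.
have free (a : 'I_m -> S) : (forall j, \sum_k a k * B k j = 0) -> forall k, a k = 0.
  move=> a0; have [|x [_ xU]] := Bfree 0.
    by rewrite /AR /= /jac_comb big1 // => j _; rewrite mxE mul0r.
  have x0 : x = 0 by apply: xU; rewrite mul0mx.
  have xa : x = \row_k a k.
    by apply: xU; apply/rowP => j; rewrite !mxE -[LHS](a0 j); apply: eq_bigr => k _; rewrite mxE.
  by move=> k; have := congr1 (fun r : 'rV_m => r 0 k) xa; rewrite x0 !mxE.
have /choice[h0 h0E] := fun ij : 'I_m * 'I_m => syzygy_cross fh fred (sB ij.1) (sB ij.2).
pose h i j := h0 (i, j); have hE i j n : cross (B i) (B j) n = h i j * grad n := h0E (i, j) n.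
have [n0 gn0] := grad_neq0 fh fred.
(* Koszul syzygies expand in the basis, so by [cross_cross] each partial derivative is a combination
   of the h_kl. *)
have divides_grad c : (forall i j, divides c (h i j)) -> forall n, divides c (grad n).
  move=> ch n; have [a [b abE]] := grad_from_cross n.
  have [x xE] := span _ (cross_syzygy a); have [y yE] := span _ (cross_syzygy b).
  have /(mulIf gn0) -> : grad n * grad n0 = (\sum_k \sum_l x k * y l * h k l) * grad n0.
    rewrite -abE -cross_cross.
    have -> : cross (cross grad a) (cross grad b) n0 =
        cross (fun j => \sum_k x k * B k j) (fun j => \sum_k y k * B k j) n0.
      exact: eq_cross.
    rewrite cross_sum mulr_suml; apply: eq_bigr => k _; rewrite mulr_suml.
    by apply: eq_bigr => l _; rewrite hE mulrA.
  by do 2?[apply: divides_sum => ? _]; apply: divides_mull.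
have hxx i : h i i = 0.
  by apply: (mulIf gn0); rewrite -hE cross_self mul0r.
have hsym i j : h i j = - h j i.
  by apply: (mulIf gn0); rewrite mulNr -!hE cross_swap.
have [[i [j hij]]|no] := pselect (exists i j, h i j != 0); last first.
  have [|c gE] := divides_grad 0 _ n0; last by move: gn0; rewrite gE mulr0 eqxx.
  move=> i j; exists 0; rewrite mulr0; apply/eqP; apply: contrapT => /negP hij.
  by apply: no; exists i, j.
have ij : i != j by apply: contraNneq hij => ->; rewrite hxx.
(* A third vector B_k would satisfy h_jk B_i + h_ki B_j + h_ij B_k = 0, by [cross_cyclic] and the
   orthogonality of B_i to grad f; this contradicts freeness. *)
have only k : k = i \/ k = j.
  have [->|ki] := eqVneq k i; [by left|have [->|kj] := eqVneq k j; first by right].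
  pose a l := if l == i then h j k else if l == j then h k i else if l == k then h i j else 0.
  suff : a k = 0 by rewrite /a (negPf ki) (negPf kj) eqxx => hij0; rewrite hij0 eqxx in hij.
  apply: free => n; rewrite (bigD1 i) //= (bigD1 j) 1?eq_sym //= (bigD1 k) ?ki ?kj //=.
  rewrite big1 ?addr0 => [|l /andP[/andP[li lj] lk]]; last first.
    by rewrite /a (negPf li) (negPf lj) (negPf lk) mul0r.
  rewrite /a eqxx [j == i]eq_sym (negPf ij) eqxx (negPf ki) (negPf kj) eqxx.
  apply: (mulIf gn0); rewrite mul0r.
  transitivity (h j k * grad n0 * B i n + (h k i * grad n0 * B j n + h i j * grad n0 * B k n));
    first by ring.
  rewrite -!hE cross_cyclic (_ : \sum_(m0 < 3) _ = h j k * \sum_(m0 < 3) B i m0 * grad m0).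
    by rewrite (sB i) !mulr0.
  by rewrite mulr_sumr; apply: eq_bigr => m0 _; rewrite hE; ring.
(* With two basis vectors, a prime factor of h_ij divides all the h_kl, hence all partial
   derivatives. *)
have hu : h i j \is a GRing.unit.
  apply: contrapT => /negP hu; have [_ [_ _ hp]] := @factorial_mpoly K 3.
  have [p pp ph] := hp _ hij hu; apply: (grad_primitive fh fred pp).
  apply: divides_grad => k l.
  have [->|->] := only k; have [->|->] := only l; rewrite ?hxx //; try exact: divides0.
  by rewrite hsym; apply: dividesN.
move: hu; rewrite mpoly_unitE => /msize_poly1P[c c0 cE].
exists (e i), (e j), (B i), (B j); split=> //.
by exists c => // n; rewrite hE cE.
Qed.

(** The degrees add up to D. If both exceeded r, both would be below D - r, both vectors would be
    multiples of rho, and their cross product would vanish. *)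
Lemma free_minimal_saito_pair r rho : syzygy rho -> homogv r rho -> nonzerov rho ->
    (forall l v, syzygy v -> homogv l v -> nonzerov v -> (r <= l)%N) -> is_free f ->
  exists u v, saito_pair f r (D - r) u v.
Proof.
move=> srho rhoh rho0 minr /free_saito_pair[k [l [u [v uv]]]].
have [[su uh] [sv vh] [c c0 cE]] := uv; have klD := saito_degree fh fred uv.
have [u0 v0] := saito_nonzero fh fred uv.
have ku := minr _ _ su uh u0; have lv := minr _ _ sv vh v0.
have [kr|kr] := eqVneq k r; first by exists u, v; rewrite -kr -klD addKn.
have [lr|lr] := eqVneq l r.
  by exists v, u; rewrite -lr -klD addnK; exact: saito_sym.
have [a aE] : exists h, forall i, u i = h * rho i.
  by apply: (small_syzygy fh fred srho rhoh rho0 minr _ su uh); lia.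
have [b bE] : exists h, forall i, v i = h * rho i.
  by apply: (small_syzygy fh fred srho rhoh rho0 minr _ sv vh); lia.
have [i gi0] := grad_neq0 fh fred.
have : cross u v i = 0 by rewrite /cross !aE !bE; case: ifP => _; [|case: ifP => _]; ring.
by move/eqP; rewrite cE mulf_eq0 mpolyC_eq0 (negPf c0) (negPf gi0).
Qed.

(** * Dimensions of the graded pieces of the syzygy module *)

Local Notation U k := (H k * (H k * H k))%type.

(** Its kernel is AR(f)_k and its image is the Jacobian ideal in degree D + k, so rank-nullity
    relates the two dimensions. *)
Definition jac_map_fun k (u : U k) : H (D + k) :=
  mul_homog (grad i0) k (D + k) u.1 + (mul_homog (grad i1) k (D + k) u.2.1 +
  mul_homog (grad i2) k (D + k) u.2.2).

Lemma jac_map_linear k : linear (@jac_map_fun k).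
Proof.
move=> a u v; rewrite /jac_map_fun /= !linearP !scalerDr.
by rewrite [RHS]addrACA [X in _ = _ + X]addrACA.
Qed.
HB.instance Definition _ k :=
  GRing.isLinear.Build K (U k) (H (D + k)) _ (@jac_map_fun k) (@jac_map_linear k).
Definition jac_map k : 'Hom(U k, H (D + k)) := linfun (@jac_map_fun k).

Definition tripv k (u : U k) (i : 'I_3) : S :=
  if i == i0 then u.1 : S else if i == i1 then u.2.1 : S else u.2.2 : S.

Lemma tripv_homog k (u : U k) : homogv k (tripv u).
Proof. by apply: forall_ord3; rewrite /tripv /=; exact: dhomog_is_dhomog. Qed.

Lemma tripv_inj k (u v : U k) : (forall i, tripv u i = tripv v i) -> u = v.
Proof.
case: u v => [u0 [u1 u2]] [v0 [v1 v2]] uv; have := uv i0; have := uv i1; have := uv i2.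
by rewrite /tripv /= => /dhomog_inj-> /dhomog_inj-> /dhomog_inj->.
Qed.

Lemma jac_mapE k (u : U k) : jac_map k u = \sum_(i < 3) tripv u i * grad i :> S.
Proof.
have -> : jac_map k u = jac_map_fun u by exact: lfunE.
rewrite /jac_map_fun !raddfD /= !(mul_homogE _ (grad_homog fh _)) //.
by rewrite big_ord3 /tripv /= ![grad _ * _]mulrC.
Qed.

Lemma jac_submod : submod J.
Proof. by split; [exact: jacobian_ideal0|exact: jacobian_idealL]. Qed.

Lemma mk_tripv k u : homogv k u -> exists t : U k, forall i, tripv t i = u i.
Proof.
move=> uh; exists (DHomog (uh i0), (DHomog (uh i1), DHomog (uh i2))).
by apply: forall_ord3.
Qed.

Lemma limg_jac_map k : limg (jac_map k) = gp J (D + k).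
Proof.
apply/vspaceP => p; apply/memv_imgP/idP.
  move=> [u _ ->]; apply/(mem_graded _ jac_submod); exists (\row_i tripv u i).
  by rewrite jac_mapE /jac_comb; apply: eq_bigr => i _; rewrite mxE.
move=> /(mem_graded _ jac_submod)[g pE].
have [|t tE] := @mk_tripv k (fun i => pihomog mdeg k (g 0 i)).
  by move=> i; exact: pihomogP.
exists t; rewrite ?memvf //; apply/dhomog_inj; rewrite jac_mapE.
have ph : (p : S) \is (D + k).-homog by exact: dhomog_is_dhomog.
rewrite -(pihomog_dE ph) pE /jac_comb linear_sum; apply: eq_bigr => i _ /=.
by rewrite (pihomogM _ _ (grad_homog fh i)) leq_addr addKn tE.
Qed.

Lemma dim_jacobian k : (\dim (gp J (D + k)) + \dim (lker (jac_map k)) = 3 * 'C(k.+2, 2))%N.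
Proof.
have := limg_ker_dim (jac_map k) fullv; rewrite capfv limg_jac_map addnC => ->.
have dimH := dim_dhomog K k; rewrite dimvf in dimH.
by rewrite dimvf -[dim _]/(dim (H k) + (dim (H k) + dim (H k)))%N dimH; lia.
Qed.

Lemma memv_lker_jac_map k (u : U k) : u \in lker (jac_map k) <-> syzygy (tripv u).
Proof.
rewrite memv_ker; split=> [/eqP/(congr1 (@mpoly_of_dhomog 3 K (D + k)))|su].
  by rewrite jac_mapE.
by apply/eqP/dhomog_inj; rewrite jac_mapE.
Qed.

End FreeSyzygies.

Section SyzygyDimensions.
Variable K : numFieldType.
Local Notation S := {mpoly K[3]}.
Local Notation H := (dhomog 3 K).
Local Notation U k := (H k * (H k * H k))%type.
Implicit Types (p q h : S) (u v w rho sigma tau : 'I_3 -> S).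

Definition scalev_fun rho j k (c : H j) : U k :=
  (mul_homog (rho i0) j k c, (mul_homog (rho i1) j k c, mul_homog (rho i2) j k c)).

Lemma scalev_linear rho j k : linear (@scalev_fun rho j k).
Proof. by move=> a u v; rewrite /scalev_fun !linearP. Qed.
HB.instance Definition _ rho j k :=
  GRing.isLinear.Build K (H j) (U k) _ (@scalev_fun rho j k) (@scalev_linear rho j k).
Definition scalev rho j k : 'Hom(H j, U k) := linfun (@scalev_fun rho j k).

Lemma scalevE rho r j k (c : H j) i : homogv r rho -> (r + j = k)%N ->
  tripv (scalev rho j k c) i = rho i * c.
Proof.
move=> rh rjk; have -> : scalev rho j k c = scalev_fun rho k c by exact: lfunE.
by move: i; apply: forall_ord3; rewrite /tripv /= (mul_homogE _ (rh _) rjk).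
Qed.

Lemma dim_scalev rho r j k : homogv r rho -> (r + j = k)%N -> nonzerov rho ->
  \dim (limg (scalev rho j k)) = 'C(j.+2, 2).
Proof.
move=> rh rjk [i ri0]; rewrite -(dim_dhomog K j); apply: limg_dim_eq.
rewrite capfv; apply/eqP/lker0P => a b /(congr1 (fun t => tripv t i)).
by rewrite !(scalevE _ _ rh rjk) => /(mulfI ri0)/dhomog_inj.
Qed.

Variables (D : nat) (f : S).
Hypotheses (fh : f \is D.+1.-homog) (fred : reduced f).
Local Notation syzygy := (is_syzygy f).
Local Notation syz k := (lker (jac_map D f k)).

Lemma mem_syz k (u : U k) : u \in syz k <-> syzygy (tripv u).
Proof. exact: memv_lker_jac_map. Qed.

Lemma scalev_syz rho r j k : syzygy rho -> homogv r rho -> (r + j = k)%N ->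
  (limg (scalev rho j k) <= syz k)%VS.
Proof.
move=> sr rh rjk; apply/subvP => _ /memv_imgP[c _ ->]; apply/mem_syz.
rewrite /is_syzygy; under eq_bigr => i _ do rewrite (scalevE _ _ rh rjk).
transitivity ((c : S) * \sum_(i < 3) rho i * grad f i); last by rewrite sr mulr0.
by rewrite mulr_sumr; apply: eq_bigr => i _; ring.
Qed.

Lemma dim_syz_ge rho r j k : syzygy rho -> homogv r rho -> nonzerov rho ->
  (r + j = k)%N -> ('C(j.+2, 2) <= \dim (syz k))%N.
Proof.
move=> sr rh r0 rjk; rewrite -(dim_scalev rh rjk r0).
exact/dimvS/(scalev_syz sr rh rjk).
Qed.

Lemma dim_syz_eq0 k : (forall v, syzygy v -> homogv k v -> nonzerov v -> False) ->
  \dim (syz k) = 0%N.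
Proof.
move=> no; apply/eqP; rewrite dimv_eq0 -subv0; apply/subvP => u /mem_syz su.
have [u0|u0] := nonzerov_dec (tripv u).
  by case: (no _ su (@tripv_homog _ k u) u0).
rewrite memv0; apply/eqP/tripv_inj => i; rewrite u0.
by move: i; apply: forall_ord3.
Qed.

Lemma homogv_component k r rho sigma h : homogv r rho -> (r <= k)%N ->
    homogv k sigma -> (forall i, sigma i = h * rho i) ->
  forall i, sigma i = pihomog mdeg (k - r) h * rho i.
Proof.
move=> rh rk sh sE i; rewrite -[LHS](pihomog_dE (sh i)) sE.
by rewrite (pihomogM _ _ (rh i)) rk.
Qed.

Lemma dim_syz_line rho r j k : syzygy rho -> homogv r rho -> nonzerov rho ->
    (r + j = k)%N ->
    (forall v, syzygy v -> homogv k v -> exists h, forall i, v i = h * rho i) ->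
  \dim (syz k) = 'C(j.+2, 2).
Proof.
move=> sr rh r0 rjk line; rewrite -(dim_scalev rh rjk r0); congr (\dim _).
apply/eqP; rewrite eqEsubv (scalev_syz sr rh rjk) andbT.
apply/subvP => u /mem_syz su; have [h hE] := line _ su (@tripv_homog _ k u).
have rk : (r <= k)%N by rewrite -rjk leq_addr.
have := homogv_component rh rk (@tripv_homog _ k u) hE.
rewrite (_ : k - r = j)%N => [uE|]; last by rewrite -rjk addKn.
apply/memv_imgP; exists (proj_homog j h); rewrite ?memvf //; apply/tripv_inj => i.
by rewrite (scalevE _ _ rh rjk) uE mulrC.
Qed.

Lemma dim_syz_saito r s rho sigma j l k : saito_pair f r s rho sigma ->
  (r + j = k)%N -> (s + l = k)%N -> (\dim (syz k) = 'C(j.+2, 2) + 'C(l.+2, 2))%N.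
Proof.
move=> pair rjk slk; have [[sr rh] [ss sh] _] := pair.
have [r0 s0] := saito_nonzero fh fred pair.
rewrite -(dim_scalev rh rjk r0) -(dim_scalev sh slk s0) -dimv_sum_cap.
have -> : (limg (scalev rho j k) :&: limg (scalev sigma l k) = 0)%VS.
  apply/eqP; rewrite -subv0; apply/subvP => u /memv_capP[/memv_imgP[a _ ->]].
  move=> /memv_imgP[b _ /(congr1 (fun t : U k => tripv t)) E].
  have [|a0 _] := @saito_free _ _ _ fh fred _ _ _ _ (a : S) (- (b : S)) pair.
    move=> i; have := congr1 (fun F : 'I_3 -> S => F i) E.
    rewrite (scalevE _ _ rh rjk) (scalevE _ _ sh slk) => e.
    by rewrite mulrC e; ring.
  have -> : a = 0 by apply/dhomog_inj.
  by rewrite linear0 mem0v.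
rewrite dimv0 addn0; congr (\dim _); apply/eqP; rewrite eqEsubv; apply/andP; split; last first.
  by apply/subvP => u /memv_addP[v vV [w wW ->]]; apply: memvD;
    [apply: (subvP (scalev_syz sr rh rjk))|apply: (subvP (scalev_syz ss sh slk))].
apply/subvP => u /mem_syz su; have [a [b abE]] := saito_span fh fred pair su.
have uh i : tripv u i = pihomog mdeg j a * rho i + pihomog mdeg l b * sigma i.
  rewrite -[LHS](pihomog_dE (@tripv_homog _ k u i)) abE linearD /=.
  rewrite (pihomogM _ _ (rh i)) (pihomogM _ _ (sh i)).
  by rewrite -{1 2}rjk -{1 2}slk !leq_addr !addKn.
apply/memv_addP; exists (scalev rho j k (proj_homog j a)); first exact/memv_img/memvf.
exists (scalev sigma l k (proj_homog l b)); first exact/memv_img/memvf.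
apply/tripv_inj => i; rewrite uh.
transitivity (tripv (scalev rho j k (proj_homog j a)) i +
  tripv (scalev sigma l k (proj_homog l b)) i).
  by rewrite (scalevE _ _ rh rjk) (scalevE _ _ sh slk) /= mulrC [X in _ + X]mulrC.
by move: i {uh}; apply: forall_ord3; rewrite /tripv.
Qed.

End SyzygyDimensions.

(** * The dimensions of the Jacobian module *)

(** The counts below are doubled so that binomial coefficients become integer polynomials. *)
Lemma triangular_binE (n : nat) : 2 * ('C(n.+2, 2))%:Z = (n%:Z + 1) * (n%:Z + 2).
Proof. by elim: n => // n IH; rewrite binS bin1 PoszD mulrDr IH; lia. Qed.

Section JacobianModuleDimension.
Variable K : numFieldType.
Local Notation S := {mpoly K[3]}.
Variables (D r : nat) (f : S).
Hypotheses (D_gt0 : (0 < D)%N) (fh : f \is D.+1.-homog) (fred : reduced f).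
Hypotheses (r_mdr : r = mdr f) (r_gt0 : (0 < r)%N) (rD : (r.*2 <= D)%N).
Local Notation J := (jacobian_ideal f).
Local Notation ar k := (\dim (lker (jac_map D f k))).

Lemma minimal_syzygy : exists rho, [/\ is_syzygy f rho, homogv r rho, nonzerov rho &
  forall l v, is_syzygy f v -> homogv l v -> nonzerov v -> (r <= l)%N].
Proof.
have [[rho [AR_rho rhoh] rho0] min] := mdrP fh.
exists (fun i => rho 0 i); split.
- exact: AR_rho.
- by rewrite r_mdr.
- apply: contrapT => no; move/eqP: rho0; apply; apply/rowP => i; rewrite mxE.
  by apply/eqP; apply: contrapT => /negP ri; apply: no; exists i.
move=> l v sv vh [i vi0]; rewrite r_mdr; apply: (min l (\row_i v i)).
  split=> [|j]; last by rewrite mxE.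
  by rewrite /AR /= /jac_comb -[RHS]sv; apply: eq_bigr => j _; rewrite mxE.
by apply/eqP => /rowP /(_ i); rewrite !mxE => /eqP; rewrite (negPf vi0).
Qed.

Lemma excess_ar (k : nat) : excess D J k =
  ('C(k.+2, 2))%:Z - (ar k)%:Z + (if (D <= k)%N then ('C((k - D).+2, 2))%:Z else 0).
Proof. by rewrite /excess; have := dim_jacobian fh k; case: ifP => _; lia. Qed.

Lemma ar_small k : (k < r)%N -> ar k = 0%N.
Proof.
have [rho [_ _ _ min]] := minimal_syzygy => kr.
by apply: dim_syz_eq0 => // v sv vh v0; have := min _ _ sv vh v0; rewrite leqNgt kr.
Qed.

Lemma ar_middle k : (r + k < D)%N -> (r <= k)%N -> ar k = 'C((k - r).+2, 2).
Proof.
have [rho [sr rh r0 min]] := minimal_syzygy => rk kr.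
apply: (dim_syz_line fh sr rh r0 (subnKC kr)) => v sv vh.
exact: (small_syzygy fh fred sr rh r0 min rk sv vh).
Qed.

Lemma ar_ge k : (r <= k)%N -> ('C((k - r).+2, 2) <= ar k)%N.
Proof.
have [rho [sr rh r0 _]] := minimal_syzygy => kr.
exact: (dim_syz_ge fh sr rh r0 (subnKC kr)).
Qed.

Lemma ar_critical : (is_free f /\ ar (D - r) = ('C((D - r.*2).+2, 2)).+1) \/
  (~ is_free f /\ ar (D - r) = 'C((D - r.*2).+2, 2)).
Proof.
have [rho [sr rh r0 min]] := minimal_syzygy.
have rDr : (r <= D - r)%N by lia.
have -> : (D - r.*2 = D - r - r)%N by lia.
have [free|nfree] := pselect (is_free f); [left|right]; split=> //.
  have [u [v uv]] := free_minimal_saito_pair fh fred sr rh r0 min free.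
  by rewrite (dim_syz_saito fh fred uv (subnKC rDr) (addn0 _)) addn1.
apply: (dim_syz_line fh sr rh r0 (subnKC rDr)) => v sv vh.
have rhoP := minimal_syzygy_primitive fh sr rh r0 min.
apply: (syzygy_parallel rhoP r0) => i.
have [h hE] := syzygy_cross fh fred sr sv.
rewrite hE; have [->|h0] := eqVneq h 0; first exact: mul0r.
have szh := cross_degree fh fred rh vh hE h0.
have /msize_poly1P[c c0 hc] : msize h == 1%N.
  by move: h0; rewrite -msize_poly_eq0; move: (msize h) szh => a; lia.
case: nfree; apply: (@saito_is_free _ D f fh fred r (D - r) rho v); split=> //.
by exists c => // j; rewrite hE hc.
Qed.

Lemma ar_free (k : nat) : is_free f -> (D - r <= k)%N ->
  ar k = ('C((k - r).+2, 2) + 'C((k - (D - r)).+2, 2))%N.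
Proof.
have [rho [sr rh r0 min]] := minimal_syzygy => free kD.
have [u [v uv]] := free_minimal_saito_pair fh fred sr rh r0 min free.
by apply: (dim_syz_saito fh fred uv); rewrite subnKC //; lia.
Qed.

(** For k >= r this is a difference of two triangular numbers. The range reaches down to r - 2
    because (k + 1)(k + 2) - r (2k + 3 - r) = (k - r + 1)(k - r + 2) vanishes at r - 1 and r - 2. *)
Lemma excess_plateau (k : int) : r%:Z - 2 <= k -> k + r%:Z < D%:Z ->
  2 * excess D J k = r%:Z * (2 * k + 3 - r%:Z).
Proof.
case: k => k; last first.
  rewrite NegzE => h1 _; have [k0 r1] : k = 0%N /\ r = 1%N by lia.
  by rewrite k0 r1.
move=> h1 h2; rewrite excess_ar leqNgt (_ : (k < D)%N); last by lia.
rewrite addr0; have := triangular_binE k.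
have [kr|rk] := ltnP k r.
  rewrite ar_small //; have [->|->] : k = r.-1 \/ k = r.-2 by lia.
    by nia.
  by nia.
rewrite ar_middle //; last by lia.
have := triangular_binE (k - r); rewrite -subzn //; lia.
Qed.

(** At -1 and -2 the polynomial vanishes, in agreement with the default value of [excess]. *)
Lemma excess_below (k : int) : k < r%:Z -> -2 <= k ->
  2 * excess D J k = (k + 1) * (k + 2).
Proof.
case: k => k; last by rewrite NegzE => _ h; have [->|->] : k = 0%N \/ k = 1%N by lia.
move=> kr _; rewrite excess_ar ar_small // leqNgt (_ : (k < D)%N); last by lia.
by rewrite addr0 subr0; exact: triangular_binE.
Qed.

(** The last term is the first contribution of the Koszul relation of the regular sequence; it
    matters for r = 1, where D + 1 - r = D. *)
Lemma excess_above (k : nat) : (r <= k <= D)%N -> 2 * excess D J k =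
  r%:Z * (2 * k%:Z + 3 - r%:Z) - 2 * ((ar k)%:Z - ('C((k - r).+2, 2))%:Z)
  + (if k == D then 2 else 0).
Proof.
move=> /andP[rk kD]; rewrite excess_ar.
have := triangular_binE k; have := triangular_binE (k - r); rewrite -subzn //.
case: eqP => [->|/eqP kD']; first by rewrite leqnn subnn binn; lia.
by rewrite leqNgt ltn_neqAle kD' kD /=; lia.
Qed.

Local Notation n j := ((jacobian_module_dim f j)%:Z).

(** 2D - r and 2D - r + 1 are the degrees for e = 1 and e = 0, with 1 and 3 the values of (e - 2)(e
    - 3)/2; the parenthesized differences become alpha. *)
Lemma jacobian_module_values : exists V : int, [/\
  forall j : int, n j = n (3 * D%:Z - 3 - j),
  forall j : int, D%:Z + r%:Z - 2 <= j <= 2 * D%:Z - r%:Z - 1 -> n j = V,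
  n (2 * D%:Z - r%:Z) = V - 1 + ((ar (D - r))%:Z - ('C((D - r.*2).+2, 2))%:Z),
  n (2 * D%:Z - r%:Z + 1) = V - 3 + ((ar (D.+1 - r))%:Z - ('C((D.+1 - r.*2).+2, 2))%:Z) &
  is_free f -> V = 0].
Proof.
have [R nE] := jacobian_linkage D_gt0 fh fred.
(* On the plateau the two excesses add up to r (D - r). *)
exists (R - r%:Z * (D%:Z - r%:Z)); split.
- move=> j; rewrite !nE (_ : 2 * D%:Z - 3 - (3 * D%:Z - 3 - j) = j - D%:Z); last by lia.
  by rewrite (_ : 3 * D%:Z - 3 - j - D%:Z = 2 * D%:Z - 3 - j) 1?addrAC; last by lia.
- move=> j jr; rewrite nE.
  have := @excess_plateau (2 * D%:Z - 3 - j); have := @excess_plateau (j - D%:Z).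
  by do 2?[move=> /(_ ltac:(lia) ltac:(lia))]; lia.
- rewrite nE (_ : 2 * D%:Z - 3 - (2 * D%:Z - r%:Z) = r%:Z - 3); last by lia.
  rewrite (_ : 2 * D%:Z - r%:Z - D%:Z = (D - r)%N); last by lia.
  have := @excess_below (r%:Z - 3); have := @excess_above (D - r)%N.
  move=> /(_ ltac:(lia)); rewrite (_ : (D - r == D)%N = false); last by lia.
  rewrite (_ : D - r - r = D - r.*2)%N; last by lia.
  by rewrite -subzn; [move=> e1 /(_ ltac:(lia) ltac:(lia)) e2; lia|lia].
- rewrite nE (_ : 2 * D%:Z - 3 - (2 * D%:Z - r%:Z + 1) = r%:Z - 4); last by lia.
  rewrite (_ : 2 * D%:Z - r%:Z + 1 - D%:Z = (D.+1 - r)%N); last by lia.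
  have := @excess_above (D.+1 - r)%N.
  move=> /(_ ltac:(lia)); rewrite (_ : D.+1 - r - r = D.+1 - r.*2)%N; last by lia.
  (* For r = 1 the index r - 4 = -3 lies outside [excess_below]: the excess is 0 where the
     polynomial would give 1, and the Koszul term at k = D makes up for it. *)
  have [r1|r1] := eqVneq r 1%N.
    have -> : excess D J (r%:Z - 4) = 0 by rewrite r1.
    by rewrite r1 subn1 /= eqxx; lia.
  have := @excess_below (r%:Z - 4); rewrite (_ : (D.+1 - r == D)%N = false); last by lia.
  by rewrite -subzn; [move=> /(_ ltac:(lia) ltac:(lia)) e2 e1; lia|lia].
(* N(f) vanishes in degree -1, so R = x_(2D-2); for a free curve this equals r (D - r). *)
move=> free; have := nE (-1); rewrite [n (-1)]/= (_ : -1 - D%:Z = Negz D); last by rewrite NegzE; lia.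
rewrite [excess _ _ (Negz D)]/= (_ : 2 * D%:Z - 3 - -1 = D.*2.-2); last by lia.
rewrite excess_ar (_ : (D <= D.*2.-2)%N); last by lia.
rewrite ar_free //; last by lia.
have := triangular_binE D.*2.-2; have := triangular_binE (D.*2.-2 - D).
have := triangular_binE (D.*2.-2 - r); have := triangular_binE (D.*2.-2 - (D - r)).
rewrite (_ : (D.*2.-2)%:Z = 2 * D%:Z - 2); last by lia.
rewrite (_ : (D.*2.-2 - D)%:Z = D%:Z - 2); last by lia.
rewrite (_ : (D.*2.-2 - r)%:Z = 2 * D%:Z - 2 - r%:Z); last by lia.
rewrite (_ : (D.*2.-2 - (D - r))%:Z = D%:Z - 2 + r%:Z); last by lia.
lia.
Qed.

End JacobianModuleDimension.

Theorem theorem3p2 (R : realType) (d r : nat) (f : {mpoly R[i][3]})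
    (f_homog : f \is d.-homog) (f_reduced : reduced f)
    (r_mdr : r = mdr f) (r_ge1 : (1 <= r)%N) (r_lt : (2 * r < d)%N) :
  let n (j : int) : int := (jacobian_module_dim f j)%:Z in
  let v : int := (nu d f)%:Z in
  let D : int := d%:Z in
  let r' : int := r%:Z in
  exists alpha : int -> int,
    [/\ (forall e : int, 0 <= e <= 2 ->
          [/\ 0 <= alpha e,
              n (D + r' + e - 5) = n (2 * D - r' - e - 1) &
              n (2 * D - r' - e - 1)
                = v - (((e - 2) * (e - 3)) %/ 2)%Z + alpha e]),
        (alpha 2 = 0 /\
          forall j : int, D + r' - 3 <= j <= 2 * D - r' - 3 -> n j = v) &
        ([/\ alpha 1 = 1, is_free f, n (D + r' - 4) = n (2 * D - r' - 2),
             n (2 * D - r' - 2) = v & v = 0]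
         \/
         [/\ alpha 1 = 0, ~ is_free f,
             n (D + r' - 4) = n (2 * D - r' - 2) &
             n (2 * D - r' - 2) = v - 1])].
Proof.
case: d f_homog r_lt => [|d] f_homog r_lt; first by lia.
(* The degree is now [d.+1]: [d] is the D of the lemmas, whereas the [D] of the statement is the
   degree. *)
have d0 : (0 < d)%N by lia.
have rd : (r.*2 <= d)%N by lia.
have [V [sym plateau n1 n0 Vfree]] :=
  jacobian_module_values d0 f_homog f_reduced r_mdr r_ge1 rd.
have ge1 := ar_ge f_homog r_mdr (k := d - r).
have ge0 := ar_ge f_homog r_mdr (k := d.+1 - r).
have crit := ar_critical d0 f_homog f_reduced r_mdr r_ge1 rd.
move: n1 n0 ge1 ge0 crit.
have -> : (d - r - r = d - r.*2)%N by lia.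
have -> : (d.+1 - r - r = d.+1 - r.*2)%N by lia.
set a1 := \dim (lker (jac_map d f (d - r))); set a0 := \dim (lker (jac_map d f (d.+1 - r))).
set b1 := 'C((d - r.*2).+2, 2); set b0 := 'C((d.+1 - r.*2).+2, 2).
move=> n1 n0 ge1 ge0 crit n v D r'.
(* Half of T, rounded down, lies in the plateau because 2r is at most the degree minus one. *)
have vV : v = V by apply: plateau; rewrite /D; lia.
(* alpha e counts the syzygies of degree (degree of f) - r - e modulo the multiples of the minimal
   one; for e = 2 there are none. *)
exists (fun e => if e == 0 then a0%:Z - b0%:Z else if e == 1 then a1%:Z - b1%:Z else 0).
split.
- move=> e e02; split.
  + by case: eqP => _; [|case: eqP => _ //]; lia.
  + rewrite [LHS]sym; congr (n _); rewrite /D; lia.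
  have [->|[->|->]] : e = 0 \/ e = 1 \/ e = 2 by lia.
  + rewrite (_ : 2 * D - r' - 0 - 1 = 2 * d%:Z - r%:Z + 1); last by rewrite /D; lia.
    by rewrite /n n0 vV eqxx; congr (_ + _); lia.
  + rewrite (_ : 2 * D - r' - 1 - 1 = 2 * d%:Z - r%:Z); last by rewrite /D; lia.
    by rewrite /n n1 vV /=; congr (_ + _); lia.
  + by rewrite /= addr0 mul0r div0z subr0 vV; apply: plateau; rewrite /D; lia.
- by split=> // j jr; rewrite vV; apply: plateau; rewrite /D in jr; lia.
have e1 : n (D + r' - 4) = n (2 * D - r' - 2).
  by rewrite [LHS]sym; congr (n _); rewrite /D; lia.
have n1' : n (2 * D - r' - 2) = V - 1 + (a1%:Z - b1%:Z).
  by rewrite -n1 /n /D; congr (Posz (jacobian_module_dim f _)); lia.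
case: crit => -[fr a1E]; [left|right]; split=> //.
- by rewrite /= a1E; lia.
- by rewrite n1' vV a1E; lia.
- by rewrite vV Vfree.
- by rewrite /= a1E; lia.
- by rewrite n1' vV a1E; lia.
Qed.
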